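(* Let $\Omega\subset\mathbb{R}^d$ be open and bounded, $1<p<\infty$, and let $\nu:\mathbb{R}^d\setminus\{0\}\to[0,\infty)$ be measurable and symmetric with $\int_{\mathbb{R}^d}(1\wedge|h|^p)\nu(h)\,dh<\infty$. Let $\omega\in\{\widetilde\nu_\Omega,\overline\nu_\Omega,\widehat\nu_R\}$ where $R>1$, $|B_R(0)\cap\Omega|>0$ (and $\nu$ is unimodal if $\omega=\widehat\nu_R$). Assume that $\int_\Omega1\wedge\nu(x-y)\,dy>0$ for a.e. $x\in\Omega_\nu\setminus\Omega$ (so that $W:=W^p_\nu(\Omega|\mathbb{R}^d)$ is a reflexive Banach space), and that the Poincaré inequality holds: there is $C_P>0$ with $$\Big\|u-\frac1{|\Omega|}\int_\Omega u\Big\|^p_{L^p(\Omega)}\le C_P\int_\Omega\int_\Omega|u(x)-u(y)|^p\nu(x-y)\,dy\,dx\quad\text{for all }u\in L^p(\Omega).$$ Write $T:=T^p_\nu(\Omega^c)$, $W^\perp:=\{u\in W:\int_\Omega u\,dx=0\}$, and let $f\in W'$ (or $f\in L^{p'}(\Omega)$) and $g\in T'$ (or $g\in L^{p'}(\Omega^c,\omega^{1-p'})$), functions being identified with functionals as in (iv). Consider the problems $$(V')\quad \mathcal{E}(w,v)=\langle f,v\rangle+\langle g,v\rangle\ \ \text{for all }v\in W,\qquad (V'^\perp)\quad \mathcal{E}(u,v)=\langle f,v\rangle+\langle g,v\rangle\ \ \text{for all }v\in W^\perp .$$ (i) (Existence) There is a unique $u\in W^\perp$ satisfying $(V'^\perp)$.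 Problem $(V')$ has a solution $w\in W$ if and only if the compatibility condition $\langle f,1\rangle+\langle g,1\rangle=0$ holds and $w=u+c$ for some $c\in\mathbb{R}$. (ii) (Boundedness) There is $C=C(d,p,\Omega,\nu)>0$ such that any solution $w$ of $(V')$ satisfies $$\Big\|w-\frac1{|\Omega|}\int_\Omega w\Big\|_{W}\le C\big(\|f\|_{W'}+\|g\|_{T'}\big)^{1/(p-1)}.$$ (iii) (Continuity) Moreover, if $u_i=w_i-\frac1{|\Omega|}\int_\Omega w_i$, $i=1,2$, where $w_i$ satisfies $(V')$ with $f=f_i$, $g=g_i$, then $$\|u_1-u_2\|_{W}\le\begin{cases}C\big(\|f_1-f_2\|_{W'}+\|g_1-g_2\|_{T'}\big)^{1/(p-1)}&p\ge2,\\ C\,M\big(\|f_1-f_2\|_{W'}+\|g_1-g_2\|_{T'}\big)&p<2,\end{cases}$$ where $M=M(f_1,f_2,g_1,g_2)=\big(\sum_{i=1}^2\|f_i\|_{W'}+\|g_i\|_{T'}\big)^{\frac{2-p}{p-1}}$. (iv) If $f\in L^{p'}(\Omega)$ and $g\in L^{p'}(\Omega^c,\omega^{1-p'})$ are identified with the forms $v\mapsto\langle f,v\rangle=\int_\Omega f(x)v(x)\,dx$ and $v\mapsto\langle g,v\rangle=\int_{\Omega^c}g(y)v(y)\,dy$ respectively, then $f\in W'$, $g\in T'$, and there is $C_1=C_1(d,p,\Omega,\nu)$ such that $$\|f\|_{W'}\le\|f\|_{L^{p'}(\Omega)},\qquad\|g\|_{T'}\le C_1\|g\|_{L^{p'}(\Omega^c,\omega^{1-p'})};$$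 in other words, for such data $(V')$ is identical to the problem: $\mathcal{E}(w,v)=\int_\Omega fv\,dx+\int_{\Omega^c}gv\,dy$ for all $v\in W$.
   Context: $\nu(h)=\nu(-h)$; $a\wedge b=\min(a,b)$; $\Omega^c=\mathbb{R}^d\setminus\Omega$; $B_R(0)$ is the open ball of radius $R$ centred at $0$; $p'=p/(p-1)$; $\psi(t)=|t|^{p-2}t$. $\operatorname{supp}\nu$ is the complement of the union of all open sets on which $\nu=0$ a.e.; $\Omega_\nu=\Omega+\operatorname{supp}\nu$. $\nu$ is unimodal if it is radial and, for some $c>0$, $\nu(x)\ge c\,\nu(y)$ whenever $|x|\le|y|$; for radial $\nu$ the radial profile is also denoted $\nu$. Weights: $\widetilde\nu_\Omega(x)=\int_\Omega1\wedge\nu(x-y)\,dy$, $\overline\nu_\Omega(x)=\operatorname{ess\,inf}_{y\in\Omega}\nu(x-y)$, $\widehat\nu_R(x)=\nu(R(1+|x|))$. $W^p_\nu(\Omega|\mathbb{R}^d)$: measurable $u:\mathbb{R}^d\to\mathbb{R}$ with $u|_\Omega\in L^p(\Omega)$ and $\int_\Omega\int_{\mathbb{R}^d}|u(x)-u(y)|^p\nu(x-y)\,dy\,dx<\infty$, with norm $\|u\|_W=\big(\|u\|^p_{L^p(\Omega)}+\int_\Omega\int_{\mathbb{R}^d}|u(x)-u(y)|^p\nu(x-y)\,dy\,dx\big)^{1/p}$; functions equal a.e. on $\Omega\cup\Omega_\nu$ are identified. $T^p_\nu(\Omega^c)$: restrictions $v=u|_{\Omega^c}$ of $u\in W$, normed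 by $\|v\|_T=\inf\{\|u\|_W:u\in W,\ u|_{\Omega^c}=v\}$. Primes on spaces denote dual spaces with dual norms; for $g\in T'$ and $v\in W$, $\langle g,v\rangle:=\langle g,v|_{\Omega^c}\rangle$. Energy: $\mathcal{E}(u,v)=\iint_{(\Omega^c\times\Omega^c)^c}\psi(u(x)-u(y))(v(x)-v(y))\nu(x-y)\,dy\,dx$. $L^{p'}(\Omega^c,\omega^{1-p'})$ is the weighted space with norm $(\int_{\Omega^c}|g|^{p'}\omega^{1-p'}dy)^{1/p'}$, with the convention $\omega^{-1}(x)=0$ whenever $\omega(x)=0$. The Neumann datum is prescribed on $\Omega_\nu\setminus\Omega$, i.e. a function $g$ on $\Omega^c$ is taken to be $0$ on $\mathbb{R}^d\setminus\Omega_\nu$.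
   Formalization: In (iv), g is additionally required to vanish a.e. where ω=0 (otherwise its weighted norm may be 0 while the functional is nonzero, so the bound fails), and C₁ may depend on the chosen weight ω, hence on R when ω=ν̂_R. *)

(* Defs.v *)
From HB Require Import structures.
From mathcomp Require Import all_boot all_order all_algebra.
From mathcomp Require Import all_classical all_reals all_analysis.
From mathcomp Require Import ess_sup_inf.

Set Implicit Arguments.
Unset Strict Implicit.
Unset Printing Implicit Defensive.

Import Order.TTheory GRing.Theory Num.Theory.
Import numFieldNormedType.Exports.

Local Open Scope classical_set_scope.
Local Open Scope ring_scope.

(* R^d is 'rV[R]_d, with the vector space and topological structures of the
   library. The library puts no sigma-algebra on matrices: as for n.-tuple, take
   the one generated by the coordinates, i.e. the Borel sigma-algebra (see
   open_measurable_rV below). *)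
Section measurable_rV.
Context {d} {T : sigmaRingType d}.
Variable n : nat.

Definition rV_coord (i : 'I_n) (x : 'rV[T]_n) : T := x ord0 i.

Let rV_set0 : g_sigma_preimage rV_coord set0.
Proof. exact: sigma_algebra0. Qed.

Let rV_setC A : g_sigma_preimage rV_coord A -> g_sigma_preimage rV_coord (~` A).
Proof. exact: sigma_algebraC. Qed.

Let rV_bigcup (F : _^nat) : (forall i, g_sigma_preimage rV_coord (F i)) ->
  g_sigma_preimage rV_coord (\bigcup_i (F i)).
Proof. exact: sigma_algebra_bigcup. Qed.

HB.instance Definition _ := @isMeasurable.Build (measure_tuple_display d)
  'rV[T]_n (g_sigma_preimage rV_coord) rV_set0 rV_setC rV_bigcup.

End measurable_rV.

Lemma measurable_rV_coord d (T : sigmaRingType d) n (i : 'I_n) :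
  measurable_fun [set: 'rV[T]_n] (fun x : 'rV[T]_n => x ord0 i).
Proof.
move=> _ Y mY; rewrite setTI; apply: sub_sigma_algebra => /=.
rewrite -bigcup_seq/=; exists i => /=; first by rewrite mem_index_enum.
by exists Y => //; rewrite setTI.
Qed.

Lemma measurable_fun_rVP d1 d2 (T1 : measurableType d1) (T2 : measurableType d2)
    n (f : T1 -> 'rV[T2]_n) :
  (forall i, measurable_fun [set: T1] (fun x => f x ord0 i)) ->
  measurable_fun [set: T1] f.
Proof.
move=> mf.
suff prefS : g_sigma_preimage (fun i => rV_coord i \o f) `<=` measurable.
  move=> _ A mA; apply: prefS.
  suff -> : g_sigma_preimage (fun i => rV_coord i \o f) =
      preimage_set_system [set: T1] f (g_sigma_preimage (@rV_coord _ T2 n)).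
    by exists A.
  rewrite -[RHS]g_sigma_preimageE; congr (<<s _ >>).
  rewrite predeqE => B; split.
  - rewrite -bigcup_seq => -[i Ii [C mC <-{B}]].
    exists (rV_coord i @^-1` C); last by rewrite !setTI.
    by rewrite -bigcup_seq; exists i => //; exists C => //; rewrite setTI.
  - move=> [C]; rewrite -bigcup_seq => -[i Ii [D mD <-{C}]] <-{B}.
    by rewrite -bigcup_seq; exists i => //; exists D => //; rewrite !setTI.
apply: smallest_sub; first exact: sigma_algebra_measurable.
rewrite -bigcup_seq => A [i Ii [B mB <-]].
exact: mf.
Qed.

Section lebesgue_rV.
Context {R : realType}.
Local Open Scope ereal_scope.

Definition rV_cons n (z : measurableTypeR R * 'rV[R]_n) : 'rV[R]_n.+1 :=
  \row_(i < n.+1) (if unlift ord0 i is Some j then z.2 ord0 j else z.1).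

Lemma measurable_rV_cons n : measurable_fun [set: measurableTypeR R * 'rV[R]_n] (@rV_cons n).
Proof.
apply: measurable_fun_rVP => i.
case: (unliftP ord0 i) => [j ->|->].
  rewrite (_ : (fun _ => _) = (fun x : 'rV[R]_n => x ord0 j) \o snd).
    by apply: measurableT_comp => //; exact: measurable_rV_coord.
  by apply/funext => z /=; rewrite mxE liftK.
rewrite (_ : (fun _ => _) = fst) //.
by apply/funext => z /=; rewrite mxE unlift_none.
Qed.

Section step.
Variables (n : nat) (m : {sigma_finite_measure set 'rV[R]_n -> \bar R}).

Definition lebesgue_rV_step : set 'rV[R]_n.+1 -> \bar R :=
  pushforward (lebesgue_measure \x m) (@rV_cons n).

Let step0 : lebesgue_rV_step set0 = 0.
Proof. by rewrite /lebesgue_rV_step /pushforward preimage_set0 measure0. Qed.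

Let step_ge0 A : 0 <= lebesgue_rV_step A.
Proof. exact: measure_ge0 (lebesgue_measure \x m) _. Qed.

Let step_sigma_additive : semi_sigma_additive lebesgue_rV_step.
Proof.
have mP (A : set 'rV[R]_n.+1) : measurable A -> measurable (@rV_cons n @^-1` A).
  by move=> mA; rewrite -[X in measurable X]setTI; exact: measurable_rV_cons.
move=> F mF tF mUF; rewrite /lebesgue_rV_step /pushforward preimage_bigcup.
apply: measure_semi_sigma_additive.
- by move=> k; exact: mP.
- apply/trivIsetP => i j _ _ ij; rewrite -preimage_setI.
  by move/trivIsetP : tF => /(_ _ _ _ _ ij) ->//; rewrite preimage_set0.
- by rewrite -preimage_bigcup; exact: mP.
Qed.

HB.instance Definition _ := isMeasure.Build _ _ _ lebesgue_rV_step
  step0 step_ge0 step_sigma_additive.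

Let step_sigma_finite : sigma_finite setT lebesgue_rV_step.
Proof.
pose tl (x : 'rV[R]_n.+1) : measurableTypeR R * 'rV[R]_n :=
  (x ord0 ord0, \row_j x ord0 (lift ord0 j)).
have mtl : measurable_fun setT tl.
  apply/measurable_fun_pair; first exact: measurable_rV_coord.
  apply: measurable_fun_rVP => i.
  rewrite (_ : (fun _ => _) = (fun x : 'rV[R]_n.+1 => x ord0 (lift ord0 i))).
    exact: measurable_rV_coord.
  by apply/funext => x /=; rewrite mxE.
have tlK z : tl (rV_cons z) = z.
  case: z => a x; rewrite /tl /rV_cons mxE unlift_none/=; congr pair.
  by apply/rowP => j; rewrite !mxE liftK.
have /sigma_finiteP[F [TF ndF Foo]] := sigma_finiteT (@lebesgue_measure R).
have /sigma_finiteP[G [TG ndG Goo]] := sigma_finiteT m.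
exists (fun k => tl @^-1` (F k `*` G k)).
  rewrite -preimage_bigcup (_ : \bigcup_k _ = setT) ?preimage_setT//.
  apply/seteqP; split => // -[x y] _.
  have [i _ Fx] : (\bigcup_k F k) x by rewrite -TF.
  have [j _ Gy] : (\bigcup_k G k) y by rewrite -TG.
  exists (maxn i j) => //; split => /=.
    by move: x Fx {y Gy}; exact/subsetPset/ndF/leq_maxl.
  by move: y Gy; exact/subsetPset/ndG/leq_maxr.
move=> k; have [mFk Fk] := Foo k; have [mGk Gk] := Goo k; split.
  by rewrite -[X in measurable X]setTI; apply: mtl => //; exact: measurableX.
rewrite /lebesgue_rV_step /pushforward -comp_preimage.
rewrite (_ : tl \o _ = id); last by apply/funext => z /=; rewrite tlK.
rewrite preimage_id product_measure1E//.
by rewrite lte_mul_pinfty// ge0_fin_numE.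
Qed.

HB.instance Definition _ := Measure_isSigmaFinite.Build _ _ _ lebesgue_rV_step
  step_sigma_finite.

End step.

(* d-dimensional Lebesgue measure, as the iterated product of the
   one-dimensional one. *)
Fixpoint lebesgue_rV (n : nat) : {sigma_finite_measure set 'rV[R]_n -> \bar R} :=
  if n is k.+1 then lebesgue_rV_step (lebesgue_rV k)
  else \d_(0%R : 'rV[R]_0).

Lemma lebesgue_rV_box n (A : 'I_n -> set R) : (forall i, measurable (A i)) ->
  lebesgue_rV n [set x : 'rV[R]_n | forall i, A i (x ord0 i)] =
  \prod_(i < n) lebesgue_measure (A i).
Proof.
elim: n A => [|n ih] A mA.
  rewrite big_ord0 /= diracE.
  by have -> : (0%R : 'rV[R]_0) \in [set x : 'rV[R]_0 | forall i, A i (x ord0 i)]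
    by apply/mem_set => -[].
rewrite big_ord_recl -ih; last by move=> i; exact: mA.
rewrite /= /lebesgue_rV_step /pushforward.
have mB : measurable [set x : 'rV[R]_n | forall i, A (lift ord0 i) (x ord0 i)].
  rewrite (_ : mkset _ = \bigcap_(i in [set: 'I_n])
      ((fun x : 'rV[R]_n => x ord0 i) @^-1` A (lift ord0 i))).
    apply: fin_bigcap_measurable => // i _; rewrite -[X in measurable X]setTI.
    exact: measurable_rV_coord.
  by apply/seteqP; split => x /= h i; [move=> _; exact: h|exact: (h i)].
rewrite -product_measure1E//; last exact: mA.
congr (product_measure1 _ _ _).
apply/seteqP; split => -[a x] /=.
  move=> h; split; first by have := h ord0; rewrite mxE unlift_none.
  by move=> i; have := h (lift ord0 i); rewrite mxE liftK.
move=> [h0 h] i; rewrite mxE; case: (unliftP ord0 i) => [j ->|->] //=.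
Qed.

End lebesgue_rV.
Arguments lebesgue_rV R n : clear implicits.

Lemma open_measurable_rV (R : realType) n (U : set 'rV[R]_n) :
  open U -> measurable U.
Proof.
move=> oU.
pose B (qr : 'rV[rat]_n * rat) : set 'rV[R]_n :=
  [set x | forall i, `|x ord0 i - ratr (qr.1 ord0 i)| < ratr qr.2].
pose F qr := [set x | B qr `<=` U /\ B qr x].
have mB qr : measurable (B qr).
  rewrite (_ : B qr = \bigcap_(i in [set: 'I_n])
      ((fun x : 'rV[R]_n => x ord0 i) @^-1`
        ball (ratr (qr.1 ord0 i) : R) (ratr qr.2))).
    apply: fin_bigcap_measurable => // i _; rewrite -[X in measurable X]setTI.
    by apply: measurable_rV_coord => //; exact: measurable_realfun.measurable_ball.
  apply/seteqP; split => x /= h i; last by rewrite distrC; exact: (h i).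
  by move=> _; rewrite /ball/= distrC; exact: h.
have -> : U = \bigcup_qr F qr.
  apply/seteqP; split => [x Ux|x [qr _ [+ Bx]]]; last exact.
  have /nbhs_ballP[e /= e0 eU] : nbhs x U by exact: open_nbhs_nbhs.
  have [r /andP[r0 re]] : exists r : rat, (0 < ratr r :> R) && (ratr r < e / 2).
    have [r] := rat_in_itvoo (divr_gt0 e0 (ltr0Sn R 1)).
    by rewrite in_itv/= => re; exists r.
  have qP i : exists q : rat, `|x ord0 i - ratr q| < ratr r.
    have [|q] := @rat_in_itvoo _ (x ord0 i - ratr r) (x ord0 i + ratr r).
      by rewrite ltrD2l gtrN.
    rewrite in_itv/= => /andP[q1 q2]; exists q.
    by rewrite ltr_distlC q1.
  pose q i := projT1 (cid (qP i)).
  have qE i : `|x ord0 i - ratr (q i)| < ratr r by rewrite /q; case: cid.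
  exists (\row_i q i, r) => //; split; last by move=> i /=; rewrite mxE.
  move=> y By; apply: eU; split => // i j; rewrite ord1 /ball/=.
  rewrite (splitr e) (le_lt_trans (ler_distD (ratr (q j)) _ _))//.
  have := By j; rewrite /= mxE => yq.
  by apply: ltrD; [|rewrite distrC]; apply: lt_trans re; [exact: qE|exact: yq].
apply: countable_bigcupT_measurable => [|qr]; first exact: countableP.
have [BU|BU] := pselect (B qr `<=` U).
  by rewrite (_ : F qr = B qr)//; apply/seteqP; split => x //= -[].
by rewrite (_ : F qr = set0)//; apply/seteqP; split => x //= -[].
Qed.

Section nonlocal_neumann.
Context {R : realType} {d : nat}.
Local Notation V := 'rV[R]_d.
Local Notation mu := (lebesgue_rV R d).
Implicit Types (Omega D : set V) (nu omega u v w g : V -> R) (p : R).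

(* The library norm on 'rV[R]_d is the sup norm. *)
Definition enorm (x : V) : R := Num.sqrt (\sum_i x ord0 i ^+ 2).

Definition conj_exp p : R := p / (p - 1).

Definition mean Omega u : R := (fine (mu Omega))^-1 * \int[mu]_(x in Omega) u x.

(* A kernel R^d \ {0} -> [0, +oo[ is encoded as a total function nu; nothing
   below depends on the (arbitrary nonnegative) value nu 0. *)
Definition levy_kernel p nu :=
  [/\ measurable_fun setT nu,
      forall h, 0 <= nu h,
      forall h, nu (- h) = nu h &
      (\int[mu]_h (Num.min 1 (enorm h `^ p) * nu h)%:E < +oo)%E].

Definition radial nu := forall x y, x != 0 -> y != 0 ->
  enorm x = enorm y -> nu x = nu y.

Definition unimodal nu := radial nu /\
  exists2 c : R, 0 < c & forall x y, x != 0 -> y != 0 ->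
    enorm x <= enorm y -> c * nu y <= nu x.

(* For d > 0 and r >= 0 the constant vector below has Euclidean norm r. *)
Definition profile nu (r : R) : R := nu (const_mx (r / Num.sqrt d%:R)).

Definition ess_support nu : set V :=
  ~` \bigcup_(U in [set U | open U /\ {ae mu, forall x, U x -> nu x = 0}]) U.

Definition nu_hull nu Omega : set V :=
  [set x + h | x in Omega & h in ess_support nu].

Definition tilde_weight nu Omega (x : V) : R :=
  \int[mu]_(y in Omega) Num.min 1 (nu (x - y)).

(* The value +oo off Omega makes this the essential infimum over y in Omega. *)
Definition bar_weight nu Omega (x : V) : R :=
  fine (ess_inf mu (fun y => if y \in Omega then (nu (x - y))%:E else +oo%E)).

Definition hat_weight nu (r : R) (x : V) : R := profile nu (r * (1 + enorm x)).

Definition admissible_weight nu Omega omega : Prop :=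
  [\/ omega = tilde_weight nu Omega,
      omega = bar_weight nu Omega |
      exists r : R, [/\ 1 < r,
        (0 < mu ([set x | (enorm x < r)%R] `&` Omega))%E,
        unimodal nu & omega = hat_weight nu r]].

Local Open Scope ereal_scope.

Definition Lp_int p D u : \bar R := \int[mu]_(x in D) (`|u x| `^ p)%:E.

Definition Lp_norm p D u : \bar R := Lp_int p D u `^ p^-1.

Definition in_Lp p D u : Prop := measurable_fun D u /\ Lp_int p D u < +oo.

Definition gagliardo p nu D1 D2 u : \bar R :=
  \int[mu]_(x in D1) \int[mu]_(y in D2)
    (`|u x - u y| `^ p * nu (x - y))%:E.

(* Function spaces are sets of representatives V -> R, with the identification
   of representatives as a separate relation. *)
Definition W_space p nu Omega : set (V -> R) :=
  [set u | [/\ measurable_fun setT u, Lp_int p Omega u < +oo &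
               gagliardo p nu Omega setT u < +oo]].

Definition W_norm p nu Omega u : \bar R :=
  (Lp_int p Omega u + gagliardo p nu Omega setT u) `^ p^-1.

Definition W_eq nu Omega u v : Prop :=
  {ae mu, forall x, (Omega `|` nu_hull nu Omega) x -> u x = v x}.

Definition W_perp p nu Omega : set (V -> R) :=
  [set u | W_space p nu Omega u /\ (\int[mu]_(x in Omega) u x)%R = 0%R].

(* A function on the complement of Omega is encoded by its extension by 0, as
   given by the library restriction u \_ D. *)
Definition T_space p nu Omega : set (V -> R) :=
  [set u \_ (~` Omega) | u in W_space p nu Omega].

(* The identification on traces induced by that on W_space. *)
Definition T_eq nu Omega u v : Prop :=
  {ae mu, forall x, (nu_hull nu Omega `\` Omega) x -> u x = v x}.

Definition T_norm p nu Omega v : \bar R :=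
  ereal_inf [set W_norm p nu Omega u | u in
    [set u | W_space p nu Omega u /\ T_eq nu Omega (u \_ (~` Omega)) v]].

Definition dual_norm (E : set (V -> R)) (N : (V -> R) -> \bar R)
    (F : (V -> R) -> R) : \bar R :=
  ereal_sup [set `|F v|%:E | v in [set v | E v /\ N v <= 1]].

(* Continuous linear functionals on the quotient of E by eqv, normed by N. *)
Definition in_dual (E : set (V -> R)) (eqv : (V -> R) -> (V -> R) -> Prop)
    (N : (V -> R) -> \bar R) (F : (V -> R) -> R) : Prop :=
  [/\ forall (a : R) u v, E u -> E v ->
        F (fun x => (a * u x + v x)%R) = (a * F u + F v)%R,
      forall u v, E u -> E v -> eqv u v -> F u = F v &
      dual_norm E N F < +oo].

Definition in_dual_W p nu Omega :=
  in_dual (W_space p nu Omega) (W_eq nu Omega) (W_norm p nu Omega).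

Definition in_dual_T p nu Omega :=
  in_dual (T_space p nu Omega) (T_eq nu Omega) (T_norm p nu Omega).

Definition dual_W_norm p nu Omega :=
  dual_norm (W_space p nu Omega) (W_norm p nu Omega).

Definition dual_T_norm p nu Omega :=
  dual_norm (T_space p nu Omega) (T_norm p nu Omega).

Definition psi p (t : R) : R := (`|t| `^ (p - 2) * t)%R.

Definition energy p nu Omega u v : \bar R :=
  \int[mu \x mu]_(z in ~` (~` Omega `*` ~` Omega))
    (psi p (u z.1 - u z.2) * (v z.1 - v z.2) * nu (z.1 - z.2))%:E.

(* The right-hand side <F, v> + <G, v> of the variational problems. *)
Definition data_pairing Omega (F G : (V -> R) -> R) v : R :=
  (F v + G (v \_ (~` Omega)))%R.

(* w satisfies the variational equation for all test functions in E; the problem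
   (V') is E = W_space with w in W_space, its restriction E = W_perp with w in
   W_perp. *)
Definition weak_eq p nu Omega (F G : (V -> R) -> R) (E : set (V -> R)) w : Prop :=
  forall v, E v -> energy p nu Omega w v = (data_pairing Omega F G v)%:E.

Definition solves_V p nu Omega F G w : Prop :=
  W_space p nu Omega w /\ weak_eq p nu Omega F G (W_space p nu Omega) w.

Definition solves_V_perp p nu Omega F G u : Prop :=
  W_perp p nu Omega u /\ weak_eq p nu Omega F G (W_perp p nu Omega) u.

Definition poincare p nu Omega : Prop :=
  exists2 CP : R, (0 < CP)%R & forall u, in_Lp p Omega u ->
    Lp_int p Omega (fun x => u x - mean Omega u)%R <=
    CP%:E * gagliardo p nu Omega Omega u.

Definition interior_functional Omega (f : V -> R) (v : V -> R) : R :=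
  (\int[mu]_(x in Omega) (f x * v x))%R.

Definition exterior_functional Omega (g : V -> R) (v : V -> R) : R :=
  (\int[mu]_(y in ~` Omega) (g y * v y))%R.

(* Norm of L^{p'}(Omega^c, omega^(1 - p')). Since 0 `^ a = 0 for a != 0, the
   weight is 0 where omega is, as in the convention omega^{-1} = 0 there. *)
Definition weighted_int p Omega omega g : \bar R :=
  \int[mu]_(y in ~` Omega)
    (`|g y| `^ conj_exp p * omega y `^ (1 - conj_exp p))%:E.

Definition weighted_norm p Omega omega g : \bar R :=
  weighted_int p Omega omega g `^ (conj_exp p)^-1.

(* Neumann data in L^{p'}(Omega^c, omega^(1 - p')), vanishing off nu_hull. With
   the convention above the norm does not see g on {omega = 0}: as an element of
   the weighted space g is only determined off this set, and the representative
   paired with test functions is the one vanishing there. *)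
Definition in_weighted p nu Omega omega g : Prop :=
  [/\ measurable_fun (~` Omega) g,
      weighted_int p Omega omega g < +oo,
      {ae mu, forall y, (~` Omega) y -> ~ nu_hull nu Omega y -> g y = 0%R} &
      {ae mu, forall y, (~` Omega) y -> omega y = 0%R -> g y = 0%R}].

End nonlocal_neumann.

(* Main.v *)
Require Import Defs.
From HB Require Import structures.
From mathcomp Require Import all_boot all_order all_algebra.
From mathcomp Require Import all_classical all_reals all_analysis.
From mathcomp Require Import ess_sup_inf measurable_realfun ring lra.

Set Implicit Arguments.
Unset Strict Implicit.
Unset Printing Implicit Defensive.

Import Order.TTheory GRing.Theory Num.Theory.
Import numFieldNormedType.Exports.

Local Open Scope classical_set_scope.
Local Open Scope ring_scope.

(** Write S for the set of pairs of points that do not both lie outside Omega. With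
    the weighted difference quotient
      D u (x, y) = (u x - u y) (nu (x - y) 1_S (x, y))^(1/p),
    a linear map from W to L^p of the product Lebesgue measure, the nonlinear form
    is the duality pairing E(u, v) = int psi(D u) D v, and E(u, u) is the p-energy
    int |D u|^p. The Gagliardo part of the norm of W is comparable to this energy
    ([dq_le_gagliardo], [gagliardo_le_dq]), and the Poincare inequality makes the
    energy alone control the norm on the mean-free functions ([W_norm_energy]).

    Existence is the direct method for v |-> int |D v|^p / p - <f + g, v> on the
    mean-free functions. Uniform convexity of |t|^p, in a pointwise form valid for
    every p > 1 ([powR_midpoint]), shows that minimizing sequences are Cauchy in
    energy. If the convergence is fast enough, D v_n converges almost everywhere
    ([fast_ae_cvg]), so completeness of the mean-free space ([W_perp_complete]) and
    lower semicontinuity of the energy both follow from Fatou's lemma, without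
    reflexivity or weak topologies. The minimizer solves the Euler-Lagrange equation
    ([euler_lagrange_exists]). Constants have zero energy, so testing with them
    gives the compatibility condition, and under this condition the problem on W
    and the one on the mean-free functions have the same solutions up to constants
    ([solves_VP]).

    The remaining estimates test the equations with solutions. Testing with the
    solution itself bounds its energy by the data ([solution_bounds]). Subtracting
    the equations of two solutions and testing with their difference bounds the
    integral of (psi a - psi b) (a - b), where a = D w1 and b = D w2
    ([pgap_data]); this dominates |a - b|^p for p >= 2 ([psi_gap_ge2]) and
    |a - b|^2 (|a| + |b|)^(p - 2) for p < 2 ([psi_gap_lt2]), and in the second case
    the weight is controlled by the energies of the two solutions, which produces
    the factor M. With equal data the same argument gives energy zero for the
    difference of two mean-free solutions. The Poincare inequality then makes it
    vanish on Omega, and the positivity of the weight on the hull forces it to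
    vanish there as well ([energy0_ae0]): this is uniqueness.

    For densities, Hoelder's inequality reduces the claim to a trace inequality
      int_(Omega^c) |u|^p omega <= D ||u||^p.
    It holds whenever omega (y) is bounded by the integral of kappa (x - y) over
    x in some part of Omega, for an integrable kernel kappa <= nu: average
    |u y|^p <= 2^p (|u x - u y|^p + |u x|^p) over x ([trace_inequality]). Each of
    the three weights has this property, with kappa = min(1, nu) or
    kappa (h) = min(1, |h|^p) nu (h) ([admissible_traceable]). *)

(** * Pointwise inequalities for |t|^p and its derivative *)

Section pointwise.
Context {R : realType}.
Variable p : R.
Hypothesis p1 : 1 < p.
Implicit Types a b t x y : R.

Let p0 : 0 < p. Proof. by apply: lt_trans p1. Qed.

Lemma powRDp x r t : 0 < x -> x `^ (r + t) = x `^ r * x `^ t.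
Proof. by move=> x0; rewrite powRD// (gt_eqF x0) implybT. Qed.

Lemma powRB_split x : 0 < x -> x `^ p = x ^+ 2 * x `^ (p - 2).
Proof.
move=> x0; rewrite -powR_mulrn ?ltW// -powRDp//.
by congr (_ `^ _); ring.
Qed.

Lemma psi_mul_self a : psi p a * a = `|a| `^ p.
Proof.
rewrite /psi -mulrA -expr2 -real_normK ?num_real// mulrC.
have [->|a0] := eqVneq a 0; first by rewrite normr0 expr0n mul0r powR0 ?gt_eqF.
by rewrite -powRB_split ?normr_gt0.
Qed.

Lemma norm_psi a : `|psi p a| = `|a| `^ (p - 1).
Proof.
rewrite /psi normrM ger0_norm ?powR_ge0//.
have [->|a0] := eqVneq a 0.
  by rewrite normr0 mulr0 powR0// gt_eqF// subr_gt0.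
rewrite -[X in _ * X]powRr1// -powRDp ?normr_gt0//.
by congr (_ `^ _); ring.
Qed.

Lemma psiN a : psi p (- a) = - psi p a.
Proof. by rewrite /psi normrN mulrN. Qed.

Lemma psi_ge0 a : 0 <= a -> psi p a = a `^ (p - 1).
Proof.
by move=> a0; rewrite -{2}(ger0_norm a0) -norm_psi ger0_norm// mulr_ge0// powR_ge0.
Qed.

Lemma le_powR_l x y r : 0 <= r -> 0 <= x -> x <= y -> x `^ r <= y `^ r.
Proof.
by move=> r0 x0 xy; rewrite ge0_ler_powR ?nnegrE// (le_trans x0).
Qed.

Lemma le_powR_neg x y r : r <= 0 -> 0 < x -> x <= y -> y `^ r <= x `^ r.
Proof.
move=> r0 x0 xy; rewrite -[r]opprK !(powRN _ (- r)).
rewrite lef_pV2 ?posrE ?powR_gt0//; last exact: lt_le_trans xy.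
by apply: le_powR_l => //; [rewrite oppr_ge0|exact: ltW].
Qed.

(** Young's inequality in the form that makes [psi p a] a subgradient of
    [|a|^p / p]. *)
Lemma psi_young a b : p * (psi p a * b) <= (p - 1) * `|a| `^ p + `|b| `^ p.
Proof.
have := @conjugate_powR R (`|a| `^ (p - 1)) `|b| (p / (p - 1)) p.
have q0 : 0 < p - 1 by rewrite subr_gt0.
rewrite powR_ge0 normr_ge0 divr_gt0// p0 => /(_ isT isT isT isT).
have -> : (p / (p - 1))^-1 + p^-1 = 1 :> R by field; rewrite !gt_eqF.
move=> /(_ erefl); rewrite -powRrM (_ : (p - 1) * (p / (p - 1)) = p); last first.
  by field; rewrite gt_eqF.
rewrite -(ler_pM2l p0) (_ : p * (`|a| `^ p / (p / (p - 1)) + `|b| `^ p / p) =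
    (p - 1) * `|a| `^ p + `|b| `^ p); last by field; rewrite !gt_eqF.
apply: le_trans; rewrite ler_pM2l// (le_trans (ler_norm _))//.
by rewrite normrM norm_psi.
Qed.

Lemma psi_gradient a b : p * (psi p a * (b - a)) <= `|b| `^ p - `|a| `^ p.
Proof.
have := psi_young a b; rewrite !mulrBr psi_mul_self mulrBl mul1r; lra.
Qed.

Definition psi_gap a b := (psi p a - psi p b) * (a - b).

Lemma psi_gapC a b : psi_gap a b = psi_gap b a.
Proof. by rewrite /psi_gap; ring. Qed.

Lemma psi_gapN a b : psi_gap (- a) (- b) = psi_gap a b.
Proof. by rewrite /psi_gap !psiN; ring. Qed.

Lemma psi_gap_ge0 a b : 0 <= psi_gap a b.
Proof.
have := psi_gradient a b; have := psi_gradient b a.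
rewrite -(pmulr_rge0 _ p0) /psi_gap; nra.
Qed.

(** The strict convexity of [|t|^p] is measured by the monotonicity of its
    derivative at the midpoint. *)
Lemma psi_gradient_gap a b :
  p * psi_gap ((a + b) / 2) a <= `|b| `^ p - `|a| `^ p - p * (psi p a * (b - a)).
Proof.
set m := (a + b) / 2.
have := psi_gradient m b; have := psi_gradient a m.
have -> : b - m = (b - a) / 2 by rewrite /m; field.
rewrite /psi_gap.
have -> : m - a = (b - a) / 2 by rewrite /m; field.
by lra.
Qed.

(** Exchanging the arguments or changing both signs preserves the gap, so its
    lower bounds need only be checked for ordered nonnegative arguments and for
    arguments of opposite signs. *)
Lemma psi_gap_sign_ind (P : R -> R -> Prop) :
  (forall a b, P a b -> P b a) -> (forall a b, P (- a) (- b) -> P a b) ->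
  (forall a b, 0 <= b -> b <= a -> P a b) ->
  (forall a b, 0 < a -> 0 < b -> P a (- b)) -> forall a b, P a b.
Proof.
move=> PC PN P0 P1 a b.
have pos x y : 0 <= x -> 0 <= y -> P x y.
  by move=> x0 y0; have [/P0|/ltW/P0] := leP y x; [exact|move/(_ x0)/PC].
have [a0|a0] := leP 0 a; have [b0|b0] := leP 0 b.
- exact: pos.
- have [a00|a00] := eqVneq a 0.
    by apply: PN; apply: pos; rewrite ?a00 ?oppr0// oppr_ge0 ltW.
  by rewrite -[b]opprK; apply: P1; rewrite ?oppr_gt0// lt0r a00.
- have [b00|b00] := eqVneq b 0.
    by apply: PN; apply: pos; rewrite ?b00 ?oppr0// oppr_ge0 ltW.
  by apply: PC; rewrite -[a]opprK; apply: P1; rewrite ?oppr_gt0// lt0r b00.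
- by apply: PN; apply: pos; rewrite oppr_ge0 ltW.
Qed.

Lemma powR_superadd x y r : 1 <= r -> 0 <= x -> 0 <= y ->
  x `^ r + y `^ r <= (x + y) `^ r.
Proof.
move=> r1 x0 y0; have r0 : 0 < r by apply: lt_le_trans r1.
rewrite -(mulr_powRB1 x0)// -(mulr_powRB1 y0)// -(mulr_powRB1 (addr_ge0 x0 y0))//.
by rewrite mulrDl lerD// ler_wpM2l// le_powR_l ?subr_ge0// ?lerDl ?lerDr.
Qed.

Lemma powR_subadd x y r : 0 < r -> r <= 1 -> 0 < x -> 0 < y ->
  (x + y) `^ r <= x `^ r + y `^ r.
Proof.
move=> r0 r1 x0 y0.
rewrite -(mulr_powRB1 (ltW x0))// -(mulr_powRB1 (ltW y0))//.
rewrite -(mulr_powRB1 (ltW (addr_gt0 x0 y0)))//.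
rewrite mulrDl lerD//; (rewrite ler_wpM2l; [|exact: ltW|]);
  by rewrite // le_powR_neg ?subr_le0// ?lerDl ?lerDr ltW.
Qed.

(** For nonnegative arguments this is the superadditivity of [t^(p-1)]; for
    arguments of opposite signs the larger absolute value is at least half of the
    difference. *)
Lemma psi_gap_ge2 a b : 2 <= p -> `|a - b| `^ p <= 2 `^ p * psi_gap a b.
Proof.
move=> p2; have q1 : 1 <= p - 1 by lra.
have q0 : 0 <= p - 1 by lra.
have two1 : 1 <= 2 `^ p :> R by rewrite -{1}(powRr0 2) ler_powR ?ler1n// ltW.
elim/psi_gap_sign_ind : a / b => a b.
- by rewrite distrC psi_gapC.
- by rewrite psi_gapN -opprD normrN.
- move=> b0 ab; have a0 := le_trans b0 ab.
  have ab0 : 0 <= a - b by rewrite subr_ge0.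
  rewrite ger0_norm//.
  suff h : (a - b) `^ p <= psi_gap a b.
    by rewrite (le_trans h)// ler_peMl// psi_gap_ge0.
  rewrite -(mulr_powRB1 ab0 p0) mulrC /psi_gap ler_wpM2r// !psi_ge0// lerBrDr.
  by rewrite (le_trans (powR_superadd q1 ab0 b0))// subrK.
- move=> a0 b0; rewrite opprK /psi_gap psiN !opprK (psi_ge0 (ltW a0)) (psi_ge0 (ltW b0)).
  have ab0 : 0 < a + b by rewrite addr_gt0.
  rewrite gtr0_norm// -(mulr_powRB1 (ltW ab0) p0) mulrA [leLHS]mulrC.
  rewrite (ler_wpM2r (ltW ab0))//.
  have -> : a + b = 2 * ((a + b) / 2) by field.
  have h0 : 0 <= (a + b) / 2 by rewrite divr_ge0// ltW.
  rewrite powRM// ler_pM ?powR_ge0//.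
    by rewrite ler_powR ?ler1n// lerBlDr lerDl.
  have [ab|/ltW ab] := leP b a.
    by rewrite (@le_trans _ _ (a `^ (p - 1)))// ?lerDl ?powR_ge0// le_powR_l//; lra.
  by rewrite (@le_trans _ _ (b `^ (p - 1)))// ?lerDr ?powR_ge0// le_powR_l//; lra.
Qed.

(** For [p < 2] the function [t^(p-1)] is concave, so on [[b, a]] its slope is at
    least that at [a]: hence the weight, which degenerates for large arguments. *)
Lemma psi_gap_lt2 a b : p < 2 ->
  (p - 1) * (`|a - b| ^+ 2 * (`|a| + `|b|) `^ (p - 2)) <= psi_gap a b.
Proof.
move=> p2; have q0 : 0 < p - 1 by rewrite subr_gt0.
have q1 : 0 < 2 - p by rewrite subr_gt0.
elim/psi_gap_sign_ind : a / b => a b.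
- by rewrite distrC psi_gapC [`|b| + _]addrC.
- by rewrite psi_gapN -opprD !normrN.
- move=> b0; rewrite le_eqVlt => /predU1P[->|ab].
    by rewrite subrr normr0 expr0n mul0r mulr0 psi_gap_ge0.
  have a0 := le_lt_trans b0 ab; have ab0 : 0 < a - b by rewrite subr_gt0.
  rewrite (ger0_norm b0) !gtr0_norm// /psi_gap !psi_ge0//; last exact: ltW.
  rewrite [leLHS](_ : _ = (p - 1) * (a + b) `^ (p - 2) * (a - b) * (a - b)); last by ring.
  rewrite (ler_wpM2r (ltW ab0))//.
  have := @conjugate_powR R (b `^ (p - 1)) (a `^ (2 - p)) (p - 1)^-1 (2 - p)^-1.
  rewrite !powR_ge0 !invr_gt0 q0 q1 => /(_ isT isT isT isT).
  rewrite !invrK (_ : p - 1 + (2 - p) = 1); last by ring.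
  move=> /(_ erefl); rewrite -!powRrM !mulfV ?gt_eqF// (powRr1 b0) (powRr1 (ltW a0)) => h0.
  have w0 : 0 < a `^ (p - 2) by exact: powR_gt0.
  have h : b `^ (p - 1) * a `^ (2 - p) * a `^ (p - 2) <=
      (b * (p - 1) + a * (2 - p)) * a `^ (p - 2) by rewrite ler_pM2r.
  rewrite -mulrA -powRDp// (_ : 2 - p + (p - 2) = 0) ?powRr0 ?mulr1 in h; last by ring.
  have aE : a * a `^ (p - 2) = a `^ (p - 1).
    rewrite -[X in X * _ = _](powRr1 (ltW a0)) -powRDp//.
    by congr (_ `^ _); ring.
  apply: (@le_trans _ _ ((p - 1) * a `^ (p - 2) * (a - b))).
    rewrite (ler_wpM2r (ltW ab0))// (ler_wpM2l (ltW q0))// le_powR_neg ?lerDl//; lra.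
  by rewrite -aE; nra.
- move=> a0 b0; have ab0 : 0 < a + b by rewrite addr_gt0.
  rewrite normrN opprK /psi_gap psiN !opprK (psi_ge0 (ltW a0)) (psi_ge0 (ltW b0)).
  rewrite !gtr0_norm//.
  rewrite -powRB_split// -(mulr_powRB1 (ltW ab0) p0) [X in _ * X <= _]mulrC.
  rewrite mulrA (ler_wpM2r (ltW ab0))// (@le_trans _ _ ((a + b) `^ (p - 1)))//.
    by rewrite ler_piMl ?powR_ge0//; lra.
  by apply: powR_subadd => //; lra.
Qed.

(** A pointwise substitute for Hoelder's inequality with the weight
    [(|a|+|b|)^(p-2)]: either [|a-b|] is below the threshold [t(|a|+|b|)], or the
    weight is at least [t^(2-p)|a-b|^(p-2)], because [p-2] is negative. *)
Lemma psi_gap_split a b t : p < 2 -> 0 < t ->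
  `|a - b| `^ p <= t `^ (p - 2) * (p - 1)^-1 * psi_gap a b +
                   t `^ p * (`|a| + `|b|) `^ p.
Proof.
move=> p2 t0; have q0 : 0 < p - 1 by rewrite subr_gt0.
have s0 : 0 <= `|a| + `|b| by rewrite addr_ge0.
have [st|st] := leP `|a - b| (t * (`|a| + `|b|)).
  rewrite -[leLHS]add0r lerD//.
    by rewrite mulr_ge0 ?psi_gap_ge0// mulr_ge0 ?powR_ge0// invr_ge0 ltW.
  by rewrite -(powRM _ (ltW t0) s0) (le_powR_l (ltW p0)).
rewrite -[leLHS]addr0 lerD ?mulr_ge0 ?powR_ge0//.
have d0 : 0 < `|a - b| by rewrite (le_lt_trans _ st)// mulr_ge0// ltW.
have s1 : 0 < `|a| + `|b|.
  by rewrite (lt_le_trans d0)// ler_normB.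
apply: (@le_trans _ _ (t `^ (p - 2) * (`|a - b| ^+ 2 * (`|a| + `|b|) `^ (p - 2)))).
  rewrite mulrCA -(powRM _ (ltW t0) s0) powRB_split// ler_wpM2l ?exprn_ge0//.
  by apply: le_powR_neg; [lra|exact: mulr_gt0|exact: ltW].
rewrite -mulrA ler_wpM2l ?powR_ge0// -(ler_pM2l q0) mulVKf ?gt_eqF//.
exact: psi_gap_lt2.
Qed.

Lemma powR_max_le x y : Num.max x y `^ p <= x `^ p + y `^ p.
Proof. by rewrite /Num.max; case: ifP => _; rewrite ?lerDl ?lerDr powR_ge0. Qed.

Lemma powR_normD a b : `|a + b| `^ p <= 2 `^ p * (`|a| `^ p + `|b| `^ p).
Proof.
apply: (@le_trans _ _ ((2 * Num.max `|a| `|b|) `^ p)).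
  rewrite (le_powR_l (ltW p0))// (le_trans (ler_normD _ _))//.
  by rewrite mulr_natl mulr2n lerD// le_max lexx ?orbT.
rewrite powRM// ?le_max ?normr_ge0// ler_wpM2l ?powR_ge0//.
exact: powR_max_le.
Qed.

Lemma powR_addD a b : (`|a| + `|b|) `^ p <= 2 `^ p * (`|a| `^ p + `|b| `^ p).
Proof.
by have := powR_normD `|a| `|b|; rewrite ger0_norm ?addr_ge0// !normr_id.
Qed.

(** The error term absorbs the degeneration of the gap for [p < 2], so that the
    qualitative arguments need no distinction of exponents. *)
Lemma psi_gap_bound (e : R) : 0 < e -> exists2 C : R, 0 <= C &
  forall a b, `|a - b| `^ p <= C * psi_gap a b + e * (`|a| `^ p + `|b| `^ p).
Proof.
move=> e0; have [p2|p2] := leP 2 p.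
  exists (2 `^ p); first exact: powR_ge0.
  move=> a b; rewrite (le_trans (psi_gap_ge2 a b p2))// lerDl.
  by rewrite mulr_ge0// ?addr_ge0 ?powR_ge0// ltW.
pose t := (e / 2 `^ p) `^ p^-1.
have t0 : 0 < t by rewrite powR_gt0 ?divr_gt0 ?powR_gt0.
exists (t `^ (p - 2) * (p - 1)^-1).
  by rewrite mulr_ge0 ?powR_ge0// invr_ge0 subr_ge0 ltW.
move=> a b; rewrite (le_trans (psi_gap_split a b p2 t0))// lerD2l.
have tp : t `^ p = e / 2 `^ p.
  by rewrite /t -powRrM mulVf ?gt_eqF// powRr1// divr_ge0 ?powR_ge0// ltW.
rewrite tp -mulrA (ler_wpM2l (ltW e0))// ler_pdivrMl ?powR_gt0//.
exact: powR_addD.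
Qed.

(** Uniform convexity of [|t|^p] up to an arbitrarily small error: the convexity
    defect at the midpoint [m]
    of [a] and [b] dominates that between [m] and the midpoint of [m] and [b]. *)
Lemma powR_midpoint (e : R) : 0 < e -> exists2 C : R, 0 <= C &
  forall a b, `|a - b| `^ p <=
    C * (`|a| `^ p + `|b| `^ p - 2 * `|(a + b) / 2| `^ p)
    + e * (`|a| `^ p + `|b| `^ p).
Proof.
move=> e0.
have e'0 : 0 < e / (4 `^ p * 2) by rewrite divr_gt0 ?mulr_gt0 ?powR_gt0.
have [C C0 hC] := psi_gap_bound e'0.
exists (4 `^ p * C / p).
  by rewrite divr_ge0 ?mulr_ge0 ?powR_ge0 // ltW.
move=> a b; set m := (a + b) / 2; pose k := (m + b) / 2.
have mid_le (x y z : R) : `|x| <= z -> `|y| <= z -> `|(x + y) / 2| <= z.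
  move=> xz yz; rewrite normrM [X in _ * X]ger0_norm// ler_pdivrMr//.
  by apply: le_trans (ler_normD _ _) _; rewrite mulr_natr mulr2n lerD.
have defect : p * psi_gap k m <= `|a| `^ p + `|b| `^ p - 2 * `|m| `^ p.
  have := psi_gradient_gap m b; rewrite -/k => h1.
  have h2 := psi_gradient m a.
  have ab : a - m = - (b - m) by rewrite /m; field.
  by rewrite ab mulrN mulrN in h2; lra.
have hm : `|m| `^ p <= `|a| `^ p + `|b| `^ p.
  apply: (@le_trans _ _ ((Num.max `|a| `|b|) `^ p)); last exact: powR_max_le.
  by rewrite (le_powR_l (ltW p0))//; apply: (mid_le); rewrite le_max lexx ?orbT.
have hk : `|k| `^ p <= `|a| `^ p + `|b| `^ p.
  apply: (@le_trans _ _ ((Num.max `|a| `|b|) `^ p)); last exact: powR_max_le.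
  rewrite (le_powR_l (ltW p0))//; apply: (mid_le); [rewrite /m|by rewrite le_max lexx orbT].
  by apply: (mid_le); rewrite le_max lexx ?orbT.
have -> : a - b = 4 * (m - k) by rewrite /k /m; field.
rewrite normrM [`|4|]ger0_norm// powRM// (distrC m k).
have q0 := powR_gt0 p (ltr0Sn R 3).
apply: (@le_trans _ _ (4 `^ p * (C * (p^-1 * (`|a| `^ p + `|b| `^ p - 2 * `|m| `^ p)) +
    e / (4 `^ p * 2) * (2 * (`|a| `^ p + `|b| `^ p))))).
  rewrite ler_wpM2l ?powR_ge0// (le_trans (hC k m))// lerD//.
    by rewrite ler_wpM2l// ler_pdivlMl.
  by rewrite (ler_wpM2l (ltW e'0))//; lra.
rewrite le_eqVlt; apply/orP; left; apply/eqP; field.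
by rewrite !gt_eqF.
Qed.

End pointwise.

Section powR_continuity.
Context {R : realType}.
Implicit Types (a r p : R) (y : R^nat).

Lemma cvg_powR_pos y a r : 0 < a -> y n @[n --> \oo] --> a ->
  y n `^ r @[n --> \oo] --> a `^ r.
Proof.
move=> a0 ya; apply: (@continuous_cvg _ _ _ _ _ y (fun x => x `^ r) a) => //.
apply: differentiable_continuous; apply/derivable1_diffP.
by apply: derivable_powR; rewrite in_itv/= a0.
Qed.

Lemma cvg_powR_norm y a r : 0 < r -> y n @[n --> \oo] --> a ->
  `|y n| `^ r @[n --> \oo] --> `|a| `^ r.
Proof.
move=> r0 ya; have [a0|a0] := eqVneq a 0; last first.
  by apply: cvg_powR_pos; [rewrite normr_gt0|exact: cvg_norm].
rewrite a0 normr0 powR0 ?gt_eqF//; apply/cvgrPdist_lt => e e0.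
have e'0 : 0 < e `^ r^-1 by rewrite powR_gt0.
move/cvgrPdist_lt : ya => /(_ _ e'0); apply: filterS => n.
rewrite a0 !sub0r !normrN (ger0_norm (powR_ge0 _ _)) => yn.
have -> : e = (e `^ r^-1) `^ r by rewrite -powRrM mulVf ?gt_eqF// powRr1// ltW.
by rewrite gt0_ltr_powR ?nnegrE ?powR_ge0.
Qed.

Lemma cvg_psi p y a : 1 < p -> y n @[n --> \oo] --> a ->
  psi p (y n) @[n --> \oo] --> psi p a.
Proof.
move=> p1 ya; have [a0|a0] := eqVneq a 0; last first.
  by apply: cvgM => //; apply: cvg_powR_pos; [rewrite normr_gt0|exact: cvg_norm].
rewrite a0 {2}/psi mulr0; apply/norm_cvg0P.
under eq_fun do rewrite norm_psi//.
have q0 : 0 < p - 1 by rewrite subr_gt0.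
by have := cvg_powR_norm q0 ya; rewrite a0 normr0 powR0 ?gt_eqF.
Qed.

End powR_continuity.

(** * The p-energy of functions on a measure space *)

Section p_energy.
Context {R : realType} {dT} {T : measurableType dT} (m : {measure set T -> \bar R}).
Variable p : R.
Hypothesis p1 : 1 < p.
Implicit Types (U V W f g : T -> R).

Let p0 : 0 < p. Proof. by apply: lt_trans p1. Qed.

Definition isLp U := measurable_fun setT U /\
  m.-integrable setT (EFin \o (fun z => `|U z| `^ p)).

Definition penergy U : R := \int[m]_z (`|U z| `^ p).

Lemma integrable_dom f g : measurable_fun setT f -> (forall z, `|f z| <= g z) ->
  m.-integrable setT (EFin \o g) -> m.-integrable setT (EFin \o f).
Proof.
move=> mf fg; apply: le_integrable => //.
  exact/measurable_EFinP.
by move=> z _; rewrite lee_fin (le_trans (fg z))// ler_norm.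
Qed.

Lemma rintegrableD f g : m.-integrable setT (EFin \o f) ->
  m.-integrable setT (EFin \o g) ->
  m.-integrable setT (EFin \o (fun z => f z + g z)).
Proof. by move=> fi gi; have := integrableD measurableT fi gi. Qed.

Lemma rintegrableB f g : m.-integrable setT (EFin \o f) ->
  m.-integrable setT (EFin \o g) ->
  m.-integrable setT (EFin \o (fun z => f z - g z)).
Proof. by move=> fi gi; have := integrableB measurableT fi gi. Qed.

Lemma rintegrableZ a f : m.-integrable setT (EFin \o f) ->
  m.-integrable setT (EFin \o (fun z => a * f z)).
Proof. by move=> fi; have := integrableZl measurableT a fi. Qed.

Lemma measurable_fun_powR_norm U :
  measurable_fun setT U -> measurable_fun setT (fun z => `|U z| `^ p).
Proof.
move=> mU; apply: (measurableT_comp (measurable_powR p)).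
exact: measurableT_comp.
Qed.

Lemma measurable_fun_psi U :
  measurable_fun setT U -> measurable_fun setT (fun z => psi p (U z)).
Proof.
move=> mU; apply: measurable_funM => //.
apply: (measurableT_comp (measurable_powR (p - 2))).
exact: measurableT_comp.
Qed.

Lemma isLpP U : isLp U <->
  measurable_fun setT U /\ (\int[m]_z (`|U z| `^ p)%:E < +oo)%E.
Proof.
split=> -[mU iU]; split=> //.
  by have /integrableP[_] := iU; under eq_integral do rewrite gee0_abs ?lee_fin ?powR_ge0//.
apply/integrableP; split; first exact/measurable_EFinP/measurable_fun_powR_norm.
by under eq_integral do rewrite gee0_abs ?lee_fin ?powR_ge0//.
Qed.

Lemma penergyE U : isLp U -> (penergy U)%:E = (\int[m]_z (`|U z| `^ p)%:E)%E.
Proof. by move=> [mU iU]; rewrite /penergy /Rintegral fineK// integrable_fin_num. Qed.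

Lemma penergy_ge0 U : 0 <= penergy U.
Proof. by apply: Rintegral_ge0 => z _; exact: powR_ge0. Qed.

Lemma isLp_lin a U V : isLp U -> isLp V -> isLp (fun z => a * U z + V z).
Proof.
move=> [mU iU] [mV iV].
have mW : measurable_fun setT (fun z => a * U z + V z).
  by apply: measurable_funD => //; exact: measurable_funM.
split=> //; apply: (@integrable_dom _
    (fun z => 2 `^ p * (`|a| `^ p * `|U z| `^ p + `|V z| `^ p))).
- exact: measurable_fun_powR_norm.
- move=> z; rewrite ger0_norm ?powR_ge0//.
  by have := powR_normD p1 (a * U z) (V z); rewrite normrM powRM.
- by apply/rintegrableZ/rintegrableD => //; exact: rintegrableZ.
Qed.

Lemma isLpB U V : isLp U -> isLp V -> isLp (fun z => U z - V z).
Proof.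
move=> lU lV; have := isLp_lin (-1) lV lU.
by under eq_fun do rewrite mulN1r addrC.
Qed.

Lemma isLpZ a U : isLp U -> isLp (fun z => a * U z).
Proof.
move=> lU; have l0 : isLp (fun=> 0).
  have := isLp_lin (-1) lU lU; under eq_fun do rewrite mulN1r addNr.
  by [].
by have := isLp_lin a lU l0; under eq_fun do rewrite addr0.
Qed.

Lemma penergyZ a U : isLp U -> penergy (fun z => a * U z) = `|a| `^ p * penergy U.
Proof.
move=> [_ iU]; rewrite /penergy -RintegralZl//.
by under eq_Rintegral do rewrite normrM powRM//.
Qed.

Lemma powR_psi_bound a b : `|psi p a * b| <= `|a| `^ p + `|b| `^ p.
Proof.
rewrite normrM norm_psi//.
have [ab|/ltW ab] := leP `|a| `|b|.
  rewrite -[leLHS]add0r lerD ?powR_ge0// mulrC -[leRHS]mulr_powRB1//.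
  by rewrite ler_wpM2l// le_powR_l// subr_ge0 ltW.
rewrite -[leLHS]addr0 lerD ?powR_ge0// -[leRHS]mulr_powRB1// mulrC.
by rewrite ler_wpM2r// powR_ge0.
Qed.

Lemma integrable_psi U V : isLp U -> isLp V ->
  m.-integrable setT (EFin \o (fun z => psi p (U z) * V z)).
Proof.
move=> [mU iU] [mV iV].
apply: (@integrable_dom _ (fun z => `|U z| `^ p + `|V z| `^ p)).
- by apply: measurable_funM => //; exact: measurable_fun_psi.
- by move=> z; exact: powR_psi_bound.
- exact: rintegrableD.
Qed.

Definition ppair U V : R := \int[m]_z (psi p (U z) * V z).

Lemma ppair_self U : ppair U U = penergy U.
Proof. by rewrite /ppair; under eq_Rintegral do rewrite psi_mul_self//. Qed.

Lemma ppair_lin U a V W : isLp U -> isLp V -> isLp W ->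
  ppair U (fun z => a * V z + W z) = a * ppair U V + ppair U W.
Proof.
move=> lU lV lW; rewrite /ppair.
rewrite -RintegralZl//; last exact: integrable_psi.
rewrite -RintegralD//; [|apply: rintegrableZ; exact: integrable_psi
                        |exact: integrable_psi].
by apply: eq_Rintegral => z _; ring.
Qed.

Lemma ppairZ U a V : isLp U -> isLp V -> ppair U (fun z => a * V z) = a * ppair U V.
Proof.
move=> lU lV; rewrite /ppair -RintegralZl//; last exact: integrable_psi.
by apply: eq_Rintegral => z _; ring.
Qed.

Lemma ppairB U V W : isLp U -> isLp V -> isLp W ->
  ppair U (fun z => V z - W z) = ppair U V - ppair U W.
Proof.
move=> lU lV lW; have := ppair_lin (-1) lU lW lV.
rewrite mulN1r addrC => <-; apply: eq_Rintegral => z _.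
by ring.
Qed.

Lemma ppair_gradient U V : isLp U -> isLp V ->
  penergy U + p * (ppair U V - penergy U) <= penergy V.
Proof.
move=> lU lV; rewrite -ppair_self -ppairB// ppair_self.
have iUV := integrable_psi lU (isLpB lV lU).
rewrite /ppair -RintegralZl//.
rewrite /penergy -RintegralD//; [|by case: lU|exact: rintegrableZ iUV].
apply: le_Rintegral => //.
- by apply: rintegrableD => //;
    [case: lU|exact: rintegrableZ iUV].
- by case: lV.
- by move=> z _; have := psi_gradient p1 (U z) (V z); lra.
Qed.

(** Both pairings are with the difference, as they are when the weak equations of
    two solutions are tested with it. *)
Definition pgap U V : R := ppair U (fun z => U z - V z) - ppair V (fun z => U z - V z).

Lemma integrable_pgap U V : isLp U -> isLp V ->
  m.-integrable setT (EFin \o (fun z => psi_gap p (U z) (V z))).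
Proof.
move=> lU lV; have lUV := isLpB lU lV.
have -> : (fun z => psi_gap p (U z) (V z)) =
    (fun z => psi p (U z) * (U z - V z) - psi p (V z) * (U z - V z)).
  by apply/funext => z; rewrite /psi_gap mulrBl.
by apply: rintegrableB; exact: integrable_psi.
Qed.

Lemma pgapE U V : isLp U -> isLp V -> pgap U V = \int[m]_z psi_gap p (U z) (V z).
Proof.
move=> lU lV; have lUV := isLpB lU lV.
rewrite /pgap /ppair -RintegralB//; try exact: integrable_psi.
by apply: eq_Rintegral => z _; rewrite /psi_gap mulrBl.
Qed.

Lemma pgap_ge0 U V : isLp U -> isLp V -> 0 <= pgap U V.
Proof.
by move=> lU lV; rewrite pgapE//; apply: Rintegral_ge0 => z _; exact: psi_gap_ge0.
Qed.

Lemma le_pgap (A B : R) U V : isLp U -> isLp V ->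
  (forall z, `|U z - V z| `^ p <= A * psi_gap p (U z) (V z) +
     B * (`|U z| `^ p + `|V z| `^ p)) ->
  penergy (fun z => U z - V z) <= A * pgap U V + B * (penergy U + penergy V).
Proof.
move=> lU lV le; rewrite pgapE// /penergy.
have iG := integrable_pgap lU lV.
have [[mU iU] [mV iV]] := (lU, lV).
have iUV := rintegrableD iU iV.
rewrite -RintegralD// -!RintegralZl// -RintegralD//; try exact: rintegrableZ.
apply: le_Rintegral => //; first by case: (isLpB lU lV).
by apply: rintegrableD; exact: rintegrableZ.
Qed.

Lemma pgap_ge2 U V : 2 <= p -> isLp U -> isLp V ->
  penergy (fun z => U z - V z) <= 2 `^ p * pgap U V.
Proof.
move=> p2 lU lV; rewrite -[leRHS]addr0 -(mul0r (penergy U + penergy V)).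
by apply: le_pgap => // z; rewrite mul0r addr0; exact: psi_gap_ge2.
Qed.

Lemma pgap_lt2 U V t : p < 2 -> 0 < t -> isLp U -> isLp V ->
  penergy (fun z => U z - V z) <= t `^ (p - 2) * (p - 1)^-1 * pgap U V +
    t `^ p * 2 `^ p * (penergy U + penergy V).
Proof.
move=> p2 t0 lU lV; apply: le_pgap => // z.
rewrite (le_trans (psi_gap_split p1 _ _ p2 t0))// lerD2l -mulrA ler_wpM2l ?powR_ge0//.
exact: powR_addD.
Qed.

Lemma pgap_eq0 U V : isLp U -> isLp V -> pgap U V <= 0 ->
  penergy (fun z => U z - V z) = 0.
Proof.
move=> lU lV g0; have /eqP g00 : pgap U V == 0 by rewrite eq_le g0 pgap_ge0.
apply/eqP; rewrite eq_le penergy_ge0 andbT; apply/ler_addgt0Pl => e e0.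
rewrite addr0; set B := penergy U + penergy V.
have B0 : 0 <= B by rewrite addr_ge0 ?penergy_ge0.
have e'0 : 0 < e / (B + 1) by rewrite divr_gt0// ltr_wpDl.
have [C C0 hC] := psi_gap_bound p1 e'0.
rewrite (@le_trans _ _ (C * pgap U V + e / (B + 1) * B))//; first exact: le_pgap.
rewrite g00 mulr0 add0r mulrAC ler_pdivrMr ?ltr_wpDl// ler_wpM2l ?ltW//.
by rewrite ltrDl.
Qed.

Lemma penergy_midpoint (e : R) : 0 < e -> exists2 C : R, 0 <= C &
  forall U V, isLp U -> isLp V -> penergy (fun z => U z - V z) <=
    C * (penergy U + penergy V - 2 * penergy (fun z => 2^-1 * (U z + V z))) +
    e * (penergy U + penergy V).
Proof.
move=> e0; have [C C0 hC] := powR_midpoint p1 e0; exists C => // U V lU lV.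
have lM : isLp (fun z => 2^-1 * (U z + V z)).
  apply: isLpZ; have := isLp_lin 1 lU lV; under eq_fun do rewrite mul1r.
  by [].
have [[[mU iU] [mV iV]] [mM iM]] := (lU, lV, lM).
have iUV := rintegrableD iU iV.
have i2 := rintegrableZ 2 iM.
have iS := rintegrableB iUV i2.
rewrite /penergy -RintegralD// -(@RintegralZl _ _ _ m setT _ 2 measurableT iM)// -RintegralB// -!RintegralZl//.
rewrite -RintegralD//; try exact: rintegrableZ.
apply: le_Rintegral => //.
- by case: (isLpB lU lV).
- by apply: rintegrableD; exact: rintegrableZ.
- by move=> z _; have := hC (U z) (V z); rewrite [_ / 2]mulrC.
Qed.

Lemma penergyB_le U V : isLp U -> isLp V ->
  penergy (fun z => U z - V z) <= 2 `^ p * (penergy U + penergy V).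
Proof.
move=> lU lV; have [[_ iU] [_ iV]] := (lU, lV).
rewrite /penergy -RintegralD// -RintegralZl//; last exact: rintegrableD.
apply: le_Rintegral => //.
- by case: (isLpB lU lV).
- exact/rintegrableZ/rintegrableD.
- by move=> z _; have := powR_normD p1 (U z) (- V z); rewrite normrN.
Qed.

Lemma penergy_eq0 U : isLp U -> penergy U = 0 -> {ae m, forall z, U z = 0}.
Proof.
move=> lU pU; have U0 := penergyE lU; rewrite pU in U0.
have [mU iU] := lU.
have : (\int[m]_z `|(`|U z| `^ p)%:E| = 0)%E.
  by under eq_integral do rewrite gee0_abs ?lee_fin ?powR_ge0//; rewrite -U0.
move/(ae_eq_integral_abs m measurableT (measurable_int m iU)).
apply: filterS => z /(_ I) -[] /powR_eq0_eq0 /eqP.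
by rewrite normr_eq0 => /eqP.
Qed.

Lemma penergy_ae0 U : measurable_fun setT U -> {ae m, forall z, U z = 0} ->
  isLp U /\ penergy U = 0.
Proof.
move=> mU aeU.
have i0 : (\int[m]_z (`|U z| `^ p)%:E = 0)%E.
  rewrite (_ : 0%E = \int[m]_z (0%E : \bar R))%E; last by rewrite integral0.
  apply: ge0_ae_eq_integral => //.
  - exact/measurable_EFinP/measurable_fun_powR_norm.
  - by apply: filterS aeU => z -> _; rewrite normr0 powR0// gt_eqF.
by split; [apply/isLpP; rewrite i0|rewrite /penergy /Rintegral i0].
Qed.

(** Fatou's lemma, phrased so that it yields membership of the limit as well. *)
Lemma penergy_fatou (W_ : (T -> R)^nat) W (c : R) :
  (forall n, isLp (W_ n)) -> measurable_fun setT W ->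
  {ae m, forall z, W_ n z @[n --> \oo] --> W z} ->
  (\forall n \near \oo, penergy (W_ n) <= c) -> isLp W /\ penergy W <= c.
Proof.
move=> lW mW aeW Wc.
have le : (\int[m]_z (`|W z| `^ p)%:E <= c%:E)%E.
  pose f n z := (`|W_ n z| `^ p)%:E.
  have mf n : measurable_fun setT (f n).
    by apply/measurable_EFinP; apply: measurable_fun_powR_norm; case: (lW n).
  have f0 n z : setT z -> (0 <= f n z)%E by move=> _; rewrite lee_fin powR_ge0.
  apply: (@le_trans _ _ (\int[m]_z limn_einf (f ^~ z))%E).
    rewrite le_eqVlt; apply/orP; left; apply/eqP; apply: ae_eq_integral => //.
    - exact/measurable_EFinP/measurable_fun_powR_norm.
    - under eq_fun do rewrite limn_einf_lim.
      apply: (emeasurable_fun_cvg (fun n z => einfs (f ^~ z) n)).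
        by move=> n; exact: measurable_fun_einfs.
      by move=> z _; exact: is_cvg_einfs.
    - apply: filterS aeW => z cvz _; apply/esym.
      have cvf : f ^~ z @ \oo --> (`|W z| `^ p)%:E.
        apply: cvg_EFin; first by near=> n.
        exact: cvg_powR_norm.
      by rewrite is_cvg_limn_einfE; [exact/cvg_lim|apply/cvg_ex; eexists; exact: cvf].
  apply: le_trans (fatou m measurableT mf f0) _.
  rewrite limn_einf_lim; apply: lime_le; first exact: is_cvg_einfs.
  near=> n; apply: (@le_trans _ _ (\int[m]_z f n z)%E).
    by apply: ereal_inf_lbound; exists n => //=.
  by rewrite /f -penergyE// lee_fin; near: n.
split; first by apply/isLpP; split=> //; exact: le_lt_trans le (ltry _).
by rewrite -lee_fin penergyE//; apply/isLpP; split=> //; exact: le_lt_trans le (ltry _).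
Unshelve. all: by end_near.
Qed.

End p_energy.

(** * Rapidly converging sequences *)

Section fast_sequences.
Context {R : realType}.
Variable p : R.
Hypothesis p1 : 1 < p.

Let p0 : 0 < p. Proof. by apply: lt_trans p1. Qed.

Definition half_pow (n : nat) : R := ((2 ^ (n + 1))%:R)^-1.

Definition fast_rate (n : nat) : R := half_pow n * half_pow n `^ p.

Lemma half_pow_gt0 n : 0 < half_pow n.
Proof. by rewrite invr_gt0 ltr0n expn_gt0. Qed.

Lemma fast_rate_gt0 n : 0 < fast_rate n.
Proof. by rewrite mulr_gt0 ?powR_gt0 ?half_pow_gt0. Qed.

Lemma cvg_half_pow : half_pow n @[n --> \oo] --> (0 : R).
Proof.
have -> : half_pow = geometric 2^-1 2^-1.
  apply/funext => n; rewrite /half_pow /= addn1 natrX exprS invfM exprVn.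
  by [].
by apply: cvg_geometric; rewrite ger0_norm// invf_lt1// ltr1n.
Qed.

Lemma cvg_fast_rate_root : fast_rate n `^ p^-1 @[n --> \oo] --> (0 : R).
Proof.
have h0 := cvg_half_pow.
have h1 : `|half_pow n| `^ p^-1 * half_pow n @[n --> \oo] --> `|0 : R| `^ p^-1 * 0.
  by apply: cvgM => //; apply: cvg_powR_norm => //; rewrite invr_gt0.
rewrite mulr0 in h1; apply: cvg_trans h1; apply: near_eq_cvg; apply: nearW => n.
have hn := half_pow_gt0 n.
rewrite gtr0_norm// /fast_rate powRM ?powR_ge0//; last exact: ltW.
by rewrite -[X in _ = _ * X]powRrM mulfV ?gt_eqF// powRr1// ltW.
Qed.

Lemma cvg_fast_rate : fast_rate n @[n --> \oo] --> (0 : R).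
Proof.
have h0 := cvg_half_pow.
have h1 : half_pow n * `|half_pow n| `^ p @[n --> \oo] --> (0 : R) * `|0 : R| `^ p.
  by apply: cvgM => //; exact: cvg_powR_norm.
rewrite mul0r in h1; apply: cvg_trans h1; apply: near_eq_cvg; apply: nearW => n.
by rewrite gtr0_norm ?half_pow_gt0.
Qed.

(** The rate is chosen such that the p-energies of the increments are summable
    even after division by the p-th powers of a summable sequence of
    thresholds. *)
Lemma fast_ae_cvg {dT} {T : measurableType dT} (m : {measure set T -> \bar R})
    (W_ : (T -> R)^nat) (C : R) :
  (forall n, isLp m p (W_ n)) ->
  (forall n, penergy m p (fun z => W_ n z - W_ n.+1 z) <= C * fast_rate n) ->
  {ae m, forall z, cvgn (fun n => W_ n z)}.
Proof.
move=> lW WC.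
pose f n z := ((half_pow n `^ p)^-1 * `|W_ n z - W_ n.+1 z| `^ p)%:E.
have lD n : isLp m p (fun z => W_ n z - W_ n.+1 z) by exact: isLpB.
have if_ n : m.-integrable setT (f n).
  by have [_ i] := lD n; exact: (rintegrableZ (half_pow n `^ p)^-1 i).
have f0 n z : (0 <= f n z)%E by rewrite lee_fin mulr_ge0 ?invr_ge0 ?powR_ge0.
have intf n : (\int[m]_z f n z <= (C / (2 ^ (n + 1))%:R)%:E)%E.
  have [_ i] := lD n; rewrite /f.
  rewrite -[leLHS]fineK; last exact: integrable_fin_num (if_ n).
  rewrite lee_fin -/(Rintegral _ _ _) RintegralZl// ler_pdivrMl ?powR_gt0 ?half_pow_gt0//.
  by rewrite mulrC -mulrA; exact: WC.
pose S z := (\sum_(0 <= n <oo) f n z)%E.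
have mS : measurable_fun setT S.
  by apply: ge0_emeasurable_sum => // n _; exact: measurable_int (if_ n).
have iS : m.-integrable setT S.
  apply/integrableP; split=> //.
  under eq_integral do rewrite gee0_abs ?nneseries_ge0//.
  rewrite integral_nneseries//; last by move=> n; exact: measurable_int (if_ n).
  apply: (@le_lt_trans _ _ (\sum_(0 <= n <oo) (C / (2 ^ (n + 1))%:R)%:E)%E).
    by apply: lee_nneseries => [n _ _|n _]; [exact: integral_ge0|exact: intf].
  by rewrite (cvg_lim _ (@cvg_geometric_eseries_half R C 0%N))// ltry.
have := integrable_ae measurableT iS.
apply: filterS => z /(_ I); set s := S z => sfin.
have s0 : (0 <= s)%E by exact: nneseries_ge0.
have bd n : `|W_ n.+1 z - W_ n z| <= fine s `^ p^-1 * half_pow n.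
  have h0 := half_pow_gt0 n.
  have : (f n z <= s)%E.
    have := nneseries_lim_ge (P := xpredT) (m := 0%N) n.+1 (fun i _ _ => f0 i z).
    by apply: le_trans; rewrite big_nat_recr//= leeDr// sume_ge0.
  rewrite -(fineK sfin) lee_fin ler_pdivrMl ?powR_gt0// distrC => h.
  have := le_powR_l _ (powR_ge0 _ _) h; move=> /(_ p^-1).
  rewrite invr_ge0 => /(_ (ltW p0)).
  rewrite -powRrM mulfV ?gt_eqF// powRr1// => /le_trans; apply.
  rewrite powRM ?powR_ge0 ?fine_ge0// -powRrM mulfV ?gt_eqF// powRr1 ?(ltW h0)//.
  by rewrite mulrC.
have cvs : cvgn (series (telescope (W_ ^~ z))).
  apply: normed_cvg; apply: (@series_le_cvg _ _ (geometric (fine s `^ p^-1 * 2^-1) 2^-1)).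
  - by move=> n; exact: normr_ge0.
  - by move=> n; rewrite /= !mulr_ge0 ?powR_ge0 ?exprn_ge0.
  - move=> n; rewrite /telescope /= (le_trans (bd n))//.
    by rewrite -mulrA ler_wpM2l ?powR_ge0// /half_pow addn1 natrX exprS invfM exprVn.
  - by apply: is_cvg_geometric_series; rewrite ger0_norm// invf_lt1// ltr1n.
have -> : (fun n => W_ n z) = (fun n => W_ 0%N z + series (telescope (W_ ^~ z)) n).
  by apply/funext => n; rewrite -eq_sum_telescope.
by apply: is_cvgD => //; exact: is_cvg_cst.
Qed.

End fast_sequences.

(** * The direct method for p-energies *)

Section direct_method.
Context {R : realType} {dT} {T : measurableType dT} (m : {measure set T -> \bar R}).
Variable p : R.
Hypothesis p1 : 1 < p.
Context {X : Type}.
(** [D] plays the role of a linear gradient on a space [E] of representatives; the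
    p-energy of [D] bounds the functional [L], and [E] is complete for it in the
    sense of fast Cauchy sequences. No norm on [E] is involved. *)
Variables (E : set (X -> R)) (D : (X -> R) -> T -> R) (L : (X -> R) -> R) (K : R).
Implicit Types u v w : X -> R.

Hypothesis E0 : E (fun=> 0).
Hypothesis E_lin : forall (a : R) u v, E u -> E v -> E (fun x => a * u x + v x).
Hypothesis D_lp : forall v, E v -> isLp m p (D v).
Hypothesis D_lin : forall (a : R) u v,
  D (fun x => a * u x + v x) = fun z => a * D u z + D v z.
Hypothesis L_lin : forall (a : R) u v, E u -> E v ->
  L (fun x => a * u x + v x) = a * L u + L v.
Hypothesis K0 : 0 <= K.
Hypothesis L_bounded : forall v, E v -> `|L v| <= K * penergy m p (D v) `^ p^-1.
Hypothesis E_complete : forall v_ : (X -> R)^nat, (forall n, E (v_ n)) ->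
  (forall n k, (n <= k)%N ->
    penergy m p (fun z => D (v_ n) z - D (v_ k) z) <= fast_rate p n) ->
  exists2 u, E u & {ae m, forall z, D (v_ n) z @[n --> \oo] --> D u z}.

Let p0 : 0 < p. Proof. by apply: lt_trans p1. Qed.

Let J v : R := penergy m p (D v) - p * L v.

Let DB u v : D (fun x => u x - v x) = fun z => D u z - D v z.
Proof.
have := D_lin (-1) v u; rewrite (_ : (fun x => -1 * v x + u x) = (fun x => u x - v x)).
  by move=> ->; apply/funext => z; ring.
by apply/funext => x; ring.
Qed.

Let EB u v : E u -> E v -> E (fun x => u x - v x).
Proof.
move=> Eu Ev; rewrite (_ : (fun x => u x - v x) = (fun x => -1 * v x + u x)).
  exact: E_lin.
by apply/funext => x; ring.
Qed.

Let LB u v : E u -> E v -> L (fun x => u x - v x) = L u - L v.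
Proof.
move=> Eu Ev; rewrite (_ : (fun x => u x - v x) = (fun x => -1 * v x + u x)).
  by rewrite L_lin//; ring.
by apply/funext => x; ring.
Qed.

(** Since [p > 1], a linear term is absorbed by half of the p-th power: this makes
    [J] coercive. *)
Let absorb : exists B : R, 0 <= B /\
  forall x : R, 0 <= x -> p * (K * x) <= 2^-1 * x `^ p + B.
Proof.
have q0 : 0 < p - 1 by rewrite subr_gt0.
pose x0 := (2 * (p * K)) `^ (p - 1)^-1.
have pK : 0 <= p * K by rewrite mulr_ge0// ltW.
exists (p * K * x0); split; first by rewrite mulr_ge0// powR_ge0.
move=> x x00; rewrite mulrA.
have [xx|xx] := leP x x0.
  by rewrite -[leLHS]add0r lerD ?mulr_ge0 ?powR_ge0// ler_wpM2l.
rewrite -[leLHS]addr0 lerD ?mulr_ge0 ?powR_ge0 ?(ltW p0)// -(mulr_powRB1 x00 p0).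
have : x0 `^ (p - 1) <= x `^ (p - 1).
  by apply: le_powR_l; [exact: ltW|exact: powR_ge0|exact: ltW].
rewrite /x0 -powRrM mulVf ?gt_eqF// powRr1 ?mulr_ge0 ?(ltW p0)// => h.
rewrite [leLHS]mulrC [leRHS]mulrCA ler_wpM2l//.
by rewrite ler_pdivlMl.
Qed.

Let coercive : exists2 B : R, 0 <= B & forall v, E v -> penergy m p (D v) <= 2 * (J v + B).
Proof.
have [B [B0 hB]] := absorb; exists B => // v Ev.
have := hB _ (powR_ge0 (penergy m p (D v)) p^-1).
rewrite -powRrM mulVf ?gt_eqF// powRr1 ?penergy_ge0//.
move=> h3; have h2 := L_bounded Ev; have h1 := ler_norm (L v); rewrite /J.
move: (ler_wpM2l (ltW p0) (le_trans h1 h2)) h3.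
by move: (penergy m p (D v)) => N; lra.
Qed.

Let I : R := inf [set J v | v in E].

Let has_infJ : has_inf [set J v | v in E].
Proof.
split; first by exists (J (fun=> 0)); exists (fun=> 0).
have [B B0 hB] := coercive; exists (- B) => _ [v Ev <-].
move: (le_trans (penergy_ge0 m p (D v)) (hB _ Ev)); lra.
Qed.

Let IJ v : E v -> I <= J v.
Proof. by move=> Ev; apply: ge_inf; [case: has_infJ|exists v]. Qed.

Let D0 : D (fun=> 0) = (fun=> 0).
Proof.
have := D_lin (-1) (fun=> 0) (fun=> 0); under eq_fun do rewrite mulr0 addr0.
by move=> ->; apply/funext => z; ring.
Qed.

Let L0 : L (fun=> 0) = 0.
Proof.
have := L_lin (-1) E0 E0; under [X in L X]eq_fun do rewrite mulr0 addr0.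
by move=> ->; ring.
Qed.

Let midpoint_defect u v w (d : R) : I <= J w -> J u <= I + d -> J v <= I + d ->
  L w = 2^-1 * (L u + L v) ->
  penergy m p (D u) + penergy m p (D v) - 2 * penergy m p (D w) <= 2 * d.
Proof.
rewrite /J => Iw Iu Iv Lw; rewrite Lw in Iw; move: Iu Iv Iw.
move: (penergy m p (D w)) (penergy m p (D u)) (penergy m p (D v)) => x y z.
by move=> *; lra.
Qed.

(** Two almost minimizers are close in energy, since their midpoint cannot
    fall below the infimum. *)
Let almost_minimizers (e : R) : 0 < e -> exists2 d : R, 0 < d <= 1 &
  forall u v, E u -> E v -> J u <= I + d -> J v <= I + d ->
  penergy m p (fun z => D u z - D v z) <= e.
Proof.
move=> e0; have [B B0 hB] := coercive.
pose B1 := 4 * (`|I| + 1 + B).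
have B10 : 0 < B1 by rewrite mulr_gt0// ltr_wpDr// ltr_wpDl.
have e'0 : 0 < e / (2 * B1) by rewrite divr_gt0// mulr_gt0.
have [C C0 hC] := penergy_midpoint m p1 e'0.
exists (Num.min 1 (e / (4 * (C + 1)))).
  rewrite lt_min ltr01/= divr_gt0 ?mulr_gt0 ?ltr_wpDl//=.
  by rewrite ge_min lexx.
set d := Num.min _ _ => u v Eu Ev Ju Jv.
have d1 : d <= 1 by rewrite ge_min lexx.
have d2 : d <= e / (4 * (C + 1)) by rewrite ge_min lexx orbT.
have h := hC _ _ (D_lp Eu) (D_lp Ev); apply: le_trans h _.
have eN w : E w -> J w <= I + d -> penergy m p (D w) <= B1 / 2.
  move=> Ew Jw; rewrite (le_trans (hB _ Ew))// /B1.
  by move: (ler_norm I) Jw d1; move: `|I| (J w) => nI Jw; lra.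
have Nu := eN _ Eu Ju; have Nv := eN _ Ev Jv.
pose w x := 2^-1 * (u x + v x).
have wE : w = (fun x => 2^-1 * u x + (2^-1 * v x + (fun=> 0) x)).
  by apply/funext => x; rewrite /w addr0; ring.
have Ev2 : E (fun x => 2^-1 * v x + (fun=> 0) x) by exact: E_lin.
have Ew : E w by rewrite wE; exact: E_lin.
have Dw : D w = fun z => 2^-1 * (D u z + D v z).
  by rewrite wE !D_lin D0; apply/funext => z; rewrite addr0; ring.
have Lw : L w = 2^-1 * (L u + L v).
  by rewrite wE !L_lin// L0 addr0; ring.
have defect : penergy m p (D u) + penergy m p (D v) -
    2 * penergy m p (fun z => 2^-1 * (D u z + D v z)) <= 2 * d.
  by rewrite -Dw; exact: midpoint_defect (IJ Ew) Ju Jv Lw.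
apply: (@le_trans _ _ (C * (2 * d) + e / (2 * B1) * B1)).
  apply: lerD; first by rewrite ler_wpM2l.
  apply: ler_wpM2l; first exact: ltW.
  by rewrite [leRHS]splitr; apply: lerD; [exact: Nu|exact: Nv].
have -> : e / (2 * B1) * B1 = e / 2 by field; rewrite gt_eqF.
suff h2 : C * (2 * d) <= e / 2 by rewrite [leRHS]splitr lerD2r.
apply: (@le_trans _ _ (C * (2 * (e / (4 * (C + 1)))))).
  by rewrite ler_wpM2l// ler_wpM2l.
have -> : C * (2 * (e / (4 * (C + 1)))) = e / 2 * (C / (C + 1)).
  by field; rewrite gt_eqF// ltr_wpDl.
by rewrite ler_piMr ?divr_ge0 ?(ltW e0)// ler_pdivrMr ?ltr_wpDl// mul1r lerDl.
Qed.

Let minimizing : exists v_ : (X -> R)^nat, [/\ forall n, E (v_ n),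
  forall n k, (n <= k)%N ->
    penergy m p (fun z => D (v_ n) z - D (v_ k) z) <= fast_rate p n &
  forall e, 0 < e -> \forall n \near \oo, J (v_ n) <= I + e].
Proof.
have dP n := almost_minimizers (fast_rate_gt0 p n).
pose d_ n := sval (cid2 (dP n)).
have d0 n : 0 < d_ n by rewrite /d_; case: cid2 => /= ? /andP[].
have dE n : forall u v, E u -> E v -> J u <= I + d_ n -> J v <= I + d_ n ->
    penergy m p (fun z => D u z - D v z) <= fast_rate p n.
  by rewrite /d_; case: cid2.
pose c_ := fix c n := if n is k.+1 then Num.min (c k) (Num.min (d_ n) (half_pow n))
  else Num.min (d_ 0%N) (half_pow 0).
have c0 n : 0 < c_ n.
  by elim: n => [|n ih] /=; rewrite !lt_min ?ih d0 half_pow_gt0.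
have cS n k : (n <= k)%N -> c_ k <= c_ n.
  elim: k => [|k ih]; first by rewrite leqn0 => /eqP ->.
  rewrite leq_eqVlt => /predU1P[-> //|]; rewrite ltnS => /ih; apply: le_trans.
  by rewrite /= ge_min lexx.
have cd n : c_ n <= d_ n by case: n => [|n] /=; rewrite !ge_min lexx ?orbT.
have ch n : c_ n <= half_pow n by case: n => [|n] /=; rewrite !ge_min lexx ?orbT.
have vP n : exists2 v, E v & J v <= I + c_ n.
  have [_ [v Ev <-]] := inf_adherent (c0 n) has_infJ.
  by rewrite -/I => /ltW h; exists v.
pose v_ n := sval (cid2 (vP n)).
have Ev n : E (v_ n) by rewrite /v_; case: cid2.
have Jv n : J (v_ n) <= I + c_ n by rewrite /v_; case: cid2.
exists v_; split=> //.
- move=> n k nk; apply: dE => //; rewrite (le_trans (Jv _))// lerD2l//.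
  exact: le_trans (cS _ _ nk) (cd n).
- move=> e e0; have /cvgrPdist_lt/(_ _ e0) := @cvg_half_pow R.
  apply: filterS => n; rewrite sub0r normrN gtr0_norm ?half_pow_gt0// => h.
  by rewrite (le_trans (Jv n))// lerD2l (le_trans (ch n))// ltW.
Qed.

Let minimizer : exists2 u, E u & J u <= I.
Proof.
have [v_ [Ev cau minJ]] := minimizing.
have [u Eu Du] := E_complete Ev cau.
exists u => //.
have [[mDu _] lv] := (D_lp Eu, fun n => D_lp (Ev n)).
(* Fatou's lemma in the second index of the Cauchy estimate *)
have close n : penergy m p (fun z => D (v_ n) z - D u z) <= fast_rate p n.
  apply: (proj2 (@penergy_fatou _ _ _ m p p1 (fun k z => D (v_ n) z - D (v_ k) z)
    _ _ _ _ _ _)).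
  - by move=> k; exact: isLpB.
  - by apply: measurable_funB => //; case: (lv n).
  - by apply: filterS Du => z cz; apply: cvgB => //; exact: cvg_cst.
  - by near=> k; apply: cau; near: k; exact: nbhs_infty_ge.
apply/ler_addgt0Pl => e e0.
have e2 : 0 < e / 2 by rewrite divr_gt0.
suff : penergy m p (D u) <= I + e + p * L u by rewrite /J; move: (penergy _ _ _); move=> *; lra.
apply: (proj2 (@penergy_fatou _ _ _ m p p1 (fun k => D (v_ k)) _ _ lv mDu Du _)).
have e'0 : 0 < e / 2 / (p * K + 1) by rewrite divr_gt0// ltr_wpDl// mulr_ge0// ltW.
have /cvgrPdist_lt/(_ _ e'0) rate0 := cvg_fast_rate_root p1.
near=> n.
have Jn : J (v_ n) <= I + e / 2 by near: n; exact: minJ.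
have rn : fast_rate p n `^ p^-1 < e / 2 / (p * K + 1).
  have : `|0 - fast_rate p n `^ p^-1| < e / 2 / (p * K + 1) by near: n.
  by rewrite sub0r normrN ger0_norm ?powR_ge0.
have Ln : p * L (v_ n) <= p * L u + e / 2.
  have h := L_bounded (EB (Ev n) Eu).
  rewrite LB// DB in h.
  have h2 : K * penergy m p (fun z => D (v_ n) z - D u z) `^ p^-1 <=
      K * (e / 2 / (p * K + 1)).
    rewrite ler_wpM2l// (le_trans _ (ltW rn))// le_powR_l ?penergy_ge0//.
    by rewrite invr_ge0 ltW.
  have h3 : p * (K * (e / 2 / (p * K + 1))) <= e / 2.
    have -> : p * (K * (e / 2 / (p * K + 1))) = e / 2 * (p * K / (p * K + 1)).
      by field; rewrite gt_eqF// ltr_wpDl// mulr_ge0// ltW.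
    rewrite ler_piMr ?(ltW e2)// ler_pdivrMr ?mul1r ?lerDl//.
    by rewrite ltr_wpDl// mulr_ge0// ltW.
  have := ler_wpM2l (ltW p0) (le_trans (ler_norm _) (le_trans h h2)).
  move: h3; rewrite mulrBr; move=> *; lra.
move: Jn Ln; rewrite /J; move: (penergy m p (D (v_ n))); move=> *; lra.
Unshelve. all: by end_near. Qed.

(** The minimizer of the convex functional [J] solves the Euler-Lagrange
    equation: comparing with [u + t v] and using the subgradient at [u + t v]
    instead of [u], the difference quotient never has to be
    differentiated under the integral; only continuity of [psi] is used. *)
Lemma euler_lagrange_exists :
  exists2 u, E u & forall v, E v -> ppair m p (D u) (D v) = L v.
Proof.
have [u Eu Ju] := minimizer; exists u => //.
suff half v : E v -> L v <= ppair m p (D u) (D v).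
  move=> v Ev; apply/eqP; rewrite eq_le half// andbT.
  have := half _ (EB E0 Ev); rewrite LB// L0 DB D0 sub0r.
  rewrite (_ : (fun z => 0 - D v z) = (fun z => -1 * D v z)); last first.
    by apply/funext => z; ring.
  by rewrite ppairZ; [rewrite mulN1r lerN2|exact: p1|exact: D_lp|exact: D_lp].
move=> Ev; have lu := D_lp Eu; have lv := D_lp Ev.
have step (t : R) : 0 < t -> L v <= ppair m p (fun z => t * D v z + D u z) (D v).
  move=> t0; have Ew := E_lin t Ev Eu; have lw := D_lp Ew; rewrite D_lin in lw.
  have h1 := le_trans Ju (IJ Ew); rewrite /J D_lin L_lin// in h1.
  have h2 := ppair_gradient p1 lw lu.
  have h3 : ppair m p (fun z => t * D v z + D u z) (D u) -
     penergy m p (fun z => t * D v z + D u z) =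
     - t * ppair m p (fun z => t * D v z + D u z) (D v).
    rewrite -(ppair_self m p1) ppair_lin//; ring.
  rewrite h3 in h2.
  have pt : 0 < p * t by rewrite mulr_gt0.
  rewrite mulNr mulrN mulrA in h2; rewrite -(ler_pM2l pt); move: h1 h2.
  move: (ppair _ _ _ _) (penergy m p _) (penergy m p (D u)) => q N1 N0.
  by rewrite mulrDr !mulrA => h1 h2; lra.
pose t_ (n : nat) : R := half_pow n.
pose f n z := (psi p (t_ n * D v z + D u z) * D v z)%:E.
have mv : measurable_fun setT (D v) by case: lv.
have mu_ : measurable_fun setT (D u) by case: lu.
pose g z := 2 `^ p * (`|D v z| `^ p + `|D u z| `^ p) + `|D v z| `^ p.
have ig : m.-integrable setT (EFin \o g).
  have [[_ iv] [_ iu]] := (lv, lu).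
  by apply: rintegrableD => //; apply: rintegrableZ; exact: rintegrableD.
have fcv : {ae m, forall z, setT z -> f n z @[n --> \oo] --> (psi p (D u z) * D v z)%:E}.
  apply: aeW => z _; apply: cvg_EFin; first by near=> n.
  apply: cvgM; last exact: cvg_cst.
  apply: cvg_psi => //; rewrite -[X in _ --> X]add0r; apply: cvgD; last exact: cvg_cst.
  rewrite -[X in _ --> X](mul0r (D v z)); apply: cvgM; last exact: cvg_cst.
  exact: cvg_half_pow.
have t0 n : 0 <= t_ n <= 1.
  by rewrite ltW ?half_pow_gt0//= invf_le1 ?ltr0n ?expn_gt0// ler1n expn_gt0.
have fg : {ae m, forall z, forall n, setT z -> (`|f n z| <= (EFin \o g) z)%E}.
  apply: aeW => z n _; rewrite /= lee_fin (le_trans (powR_psi_bound p1 _ _))// lerD2r.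
  have [tn0 tn1] := andP (t0 n).
  rewrite (le_trans (powR_normD p1 _ _))// ler_wpM2l ?powR_ge0// lerD2r.
  rewrite normrM le_powR_l ?(ltW p0)// ?mulr_ge0//.
  by rewrite ger0_norm// ler_piMl.
have mf n := measurable_int m (integrable_psi p1 (isLp_lin p1 (t_ n) lv lu) lv).
have mf0 := measurable_int m (integrable_psi p1 lu lv).
have [i0 _ lim] := dominated_convergence measurableT mf mf0 fcv ig fg.
rewrite -lee_fin /ppair /Rintegral fineK; last exact: (integrable_fin_num measurableT i0).
rewrite -(cvg_lim _ lim)//; apply: lime_ge; first by apply/cvg_ex; eexists; exact: lim.
apply: nearW => n; have i1 := integrable_psi p1 (isLp_lin p1 (t_ n) lv lu) lv.
rewrite /= -[leRHS]fineK; last exact: (integrable_fin_num measurableT i1).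
by rewrite lee_fin; apply: step; exact: half_pow_gt0.
Unshelve. all: by end_near. Qed.

End direct_method.

(** * Lebesgue measure on R^d *)

Section lebesgue_translation.
Context {R : realType}.

Let leb_shift_measurable (a : R) :
  measurable_fun [set: measurableTypeR R] (fun x : measurableTypeR R => x + a : measurableTypeR R).
Proof. by apply: measurable_funD. Qed.

Lemma lebesgue_measure_shift (a : R) (A : set (measurableTypeR R)) : measurable A ->
  lebesgue_measure ((fun x => x + a) @^-1` A) = lebesgue_measure A.
Proof.
move=> mA; apply/esym.
pose f (x : measurableTypeR R) : measurableTypeR R := x + a.
pose m : {measure set (measurableTypeR R) -> \bar R} :=
  measure_function_pushforward__canonical__measure_function_Measure
    (@lebesgue_measure R) (leb_shift_measurable a).
rewrite (lebesgue_measure_unique (mu := m))// => X [[b c] _ <-].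
rewrite /m /= /pushforward.
have -> : (fun x => x + a) @^-1` `]b, c] = `](b - a), (c - a)]%classic.
  by apply/seteqP; split=> x /=; rewrite !in_itv/= ltrBlDr lerBrDr.
rewrite !lebesgue_measure_itv/= !lte_fin ltrD2r -!EFinB.
by case: ifP => // _; congr EFin; ring.
Qed.

Lemma ge0_integral_shift1 (a : R) (f : measurableTypeR R -> \bar R) :
  measurable_fun setT f -> (forall x, (0 <= f x)%E) ->
  (\int[lebesgue_measure]_x f (x + a)%R = \int[lebesgue_measure]_x f x)%E.
Proof.
move=> mf f0.
have := @ge0_integral_pushforward _ _ _ _ R _ (leb_shift_measurable a)
  lebesgue_measure setT f measurableT mf (fun y _ => f0 y).
rewrite preimage_setT => <-; apply/esym.
apply: (eq_measure_integral
  (measure_function_pushforward__canonical__measure_function_Measure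
    (@lebesgue_measure R) (leb_shift_measurable a))) => A mA _.
exact/esym/lebesgue_measure_shift.
Qed.

Lemma measurable_rVD n (h : 'rV[R]_n) :
  measurable_fun [set: 'rV[R]_n] (fun x => x + h).
Proof.
apply: measurable_fun_rVP => i.
under eq_fun do rewrite mxE.
by apply: measurable_funD => //; exact: measurable_rV_coord.
Qed.

Lemma lebesgue_rV_shift n (h : 'rV[R]_n) (A : set 'rV[R]_n) : measurable A ->
  lebesgue_rV R n ((fun x => x + h) @^-1` A) = lebesgue_rV R n A.
Proof.
elim: n h A => [|n ih] h A mA.
  congr (lebesgue_rV R 0 _); apply/seteqP; split=> x /=;
  by rewrite (_ : x + h = x)//; apply/rowP => -[].
rewrite /= /lebesgue_rV_step /pushforward /product_measure1.
have mB : measurable (@rV_cons R n @^-1` A).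
  by rewrite -[X in measurable X]setTI; exact: measurable_rV_cons.
pose f (a : measurableTypeR R) := lebesgue_rV R n (xsection (@rV_cons R n @^-1` A) a).
have mf : measurable_fun setT f by exact: measurable_fun_xsection.
rewrite -[RHS](ge0_integral_shift1 (h ord0 ord0) mf)//.
apply: eq_integral => a _ /=; rewrite /f.
have mBa := measurable_xsection (a + h ord0 ord0) mB.
rewrite -(ih (\row_j h ord0 (lift ord0 j)) _ mBa); congr (lebesgue_rV R n _).
apply/seteqP; split => x; rewrite /xsection /= !inE /=.
  move=> H; congr (A _) : H; apply/rowP => i; rewrite !mxE.
  by case: unliftP => [j ->|->]; rewrite ?mxE.
move=> H; congr (A _) : H; apply/rowP => i; rewrite !mxE.
by case: unliftP => [j ->|->]; rewrite ?mxE.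
Qed.

Lemma ge0_integral_shift n (h : 'rV[R]_n) (f : 'rV[R]_n -> \bar R) :
  measurable_fun setT f -> (forall x, (0 <= f x)%E) ->
  (\int[lebesgue_rV R n]_x f (x + h)%R = \int[lebesgue_rV R n]_x f x)%E.
Proof.
move=> mf f0.
have := @ge0_integral_pushforward _ _ _ _ R _ (measurable_rVD h)
  (lebesgue_rV R n) setT f measurableT mf (fun y _ => f0 y).
rewrite preimage_setT => <-.
apply/esym; apply: (eq_measure_integral
  (measure_function_pushforward__canonical__measure_function_Measure
    (lebesgue_rV R n) (measurable_rVD h))) => A mA _.
exact/esym/lebesgue_rV_shift.
Qed.

Lemma ae_shift n (h : 'rV[R]_n) (P : 'rV[R]_n -> Prop) :
  {ae lebesgue_rV R n, forall x, P x} -> {ae lebesgue_rV R n, forall x, P (x + h)}.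
Proof.
move=> [N [mN N0 PN]]; exists ((fun x => x + h) @^-1` N); split.
- by rewrite -[X in measurable X]setTI; exact: measurable_rVD.
- by rewrite -N0; exact: lebesgue_rV_shift.
- by move=> x /= nP; apply: PN.
Qed.

End lebesgue_translation.

Section rV_geometry.
Context {R : realType} {d : nat}.
Local Notation V := 'rV[R]_d.
Local Notation mu := (lebesgue_rV R d).
Implicit Types (x y h : V).

Lemma enorm_ge0 x : 0 <= enorm x.
Proof. exact: sqrtr_ge0. Qed.

Lemma sqr_enorm x : enorm x ^+ 2 = \sum_i x ord0 i ^+ 2.
Proof. by rewrite sqr_sqrtr// sumr_ge0// => i _; exact: sqr_ge0. Qed.

Lemma enormN x : enorm (- x) = enorm x.
Proof. by congr Num.sqrt; apply: eq_bigr => i _; rewrite mxE sqrrN. Qed.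

Lemma ler_coord_enorm x i : `|x ord0 i| <= enorm x.
Proof.
rewrite -(ler_pXn2r (n := 2))// ?nnegrE ?enorm_ge0// sqr_enorm real_normK ?num_real//.
by rewrite (bigD1 i)//= lerDl sumr_ge0// => j _; exact: sqr_ge0.
Qed.

Lemma ler_norm_enorm x : `|x| <= enorm x.
Proof.
rewrite /Num.Def.normr/= mx_normrE; apply: bigmax_le => [|[i j] _ /=].
  exact: enorm_ge0.
by rewrite (ord1 i); exact: ler_coord_enorm.
Qed.

Lemma ler_coord_norm x i : `|x ord0 i| <= `|x|.
Proof.
rewrite [in leRHS]/Num.Def.normr/= mx_normrE.
exact: (le_bigmax _ (fun ij => `|x ij.1 ij.2|) (ord0, i)).
Qed.

Lemma enorm_eq0 x : enorm x = 0 -> x = 0.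
Proof.
by move=> e0; apply/eqP; rewrite -normr_eq0 eq_le normr_ge0 andbT -e0 ler_norm_enorm.
Qed.

Lemma ler_enormD x y : enorm (x + y) <= enorm x + enorm y.
Proof.
have [x0|x0] := eqVneq (enorm x) 0.
  by rewrite x0 add0r (enorm_eq0 x0) add0r.
have [y0|y0] := eqVneq (enorm y) 0.
  by rewrite y0 addr0 (enorm_eq0 y0) addr0.
have {}x0 : 0 < enorm x by rewrite lt_neqAle eq_sym x0 enorm_ge0.
have {}y0 : 0 < enorm y by rewrite lt_neqAle eq_sym y0 enorm_ge0.
rewrite -(ler_pXn2r (n := 2))// ?nnegrE ?addr_ge0 ?enorm_ge0//.
rewrite sqrrD !sqr_enorm.
have -> : \sum_i (x + y) ord0 i ^+ 2 = \sum_i x ord0 i ^+ 2 +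
    \sum_i (x ord0 i * y ord0 i *+ 2) + \sum_i y ord0 i ^+ 2.
  by rewrite -!big_split/=; apply: eq_bigr => i _; rewrite mxE sqrrD.
rewrite lerD2r lerD2l.
apply: (@le_trans _ _ (\sum_i (enorm y / enorm x * x ord0 i ^+ 2 +
    enorm x / enorm y * y ord0 i ^+ 2))).
  apply: ler_sum => i _; rewrite -subr_ge0.
  have -> : enorm y / enorm x * x ord0 i ^+ 2 + enorm x / enorm y * y ord0 i ^+ 2 -
      x ord0 i * y ord0 i *+ 2 =
      (enorm x * enorm y)^-1 * (enorm y * x ord0 i - enorm x * y ord0 i) ^+ 2.
    by field; rewrite !gt_eqF.
  by rewrite mulr_ge0 ?sqr_ge0// invr_ge0 mulr_ge0// ltW.
rewrite big_split/= -!mulr_sumr -!sqr_enorm.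
rewrite le_eqVlt; apply/orP; left; apply/eqP; field.
by rewrite !gt_eqF.
Qed.

Lemma measurable_enorm : measurable_fun [set: V] (@enorm R d).
Proof.
have -> : @enorm R d = fun x => (\sum_i x ord0 i * x ord0 i) `^ 2^-1.
  apply/funext => x; rewrite powR12_sqrt; last first.
    by apply: sumr_ge0 => i _; rewrite -expr2 sqr_ge0.
  by rewrite /enorm; under eq_bigr do rewrite expr2.
apply: (measurableT_comp (measurable_powR _)).
by apply: measurable_sum => i; apply: measurable_funM; exact: measurable_rV_coord.
Qed.

Lemma measurable_rVB : measurable_fun [set: V * V] (fun z => z.1 - z.2).
Proof.
apply: measurable_fun_rVP => i; under eq_fun do rewrite !mxE.
apply: measurable_funB.
  by apply: (measurableT_comp (@measurable_rV_coord _ _ d i)).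
by apply: (measurableT_comp (@measurable_rV_coord _ _ d i)).
Qed.

Lemma bounded_lebesgue_lty (A : set V) : measurable A -> bounded_set A ->
  (mu A < +oo)%E.
Proof.
move=> mA [M [_ bA]].
pose r : R := `|M| + 1; pose I : set R := `[- r, r]%classic.
have rA x : A x -> `|x| <= r.
  by apply: bA; rewrite /r (le_lt_trans (ler_norm M))// ltrDl.
pose B := [set x : V | forall i, `[- r, r]%classic (x ord0 i)].
have mB : measurable B.
  rewrite (_ : B = \bigcap_(i in [set: 'I_d]) ((fun x : V => x ord0 i) @^-1` `[- r, r])).
    apply: fin_bigcap_measurable => // i _; rewrite -[X in measurable X]setTI.
    by apply: measurable_rV_coord.
  by apply/seteqP; split=> x /= h i; [move=> _; exact: h|exact: (h i)].
apply: (@le_lt_trans _ _ (mu B)).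
  apply: le_measure; rewrite ?inE// => x /rA xr i /=.
  by rewrite in_itv/= -ler_norml (le_trans _ xr)// ler_coord_norm.
rewrite /B (@lebesgue_rV_box R d (fun=> I)); last by move=> _; exact: measurable_itv.
have h : (0 <= lebesgue_measure I < +oo)%E.
  rewrite measure_ge0/= lebesgue_measure_itv/=.
  by case: ifP => _; rewrite ?ltry// -EFinB ltry.
suff /andP[] : (0 <= \prod_(i < d) lebesgue_measure I < +oo)%E by [].
apply: (big_ind (fun x : \bar R => (0 <= x < +oo)%E)) => [|x y|i _]; last exact: h.
  by rewrite lee01 ltry.
by move=> /andP[x0 xy] /andP[y0 yy]; rewrite mule_ge0//= lte_mul_pinfty// ge0_fin_numE.
Qed.

Lemma open_rational_box (U : set V) x : open U -> U x ->
  exists qr : 'rV[rat]_d * rat,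
    (forall i, `|x ord0 i - ratr (qr.1 ord0 i)| < ratr qr.2) /\
    [set y : V | forall i, `|y ord0 i - ratr (qr.1 ord0 i)| < ratr qr.2] `<=` U.
Proof.
move=> oU Ux.
have /nbhs_ballP[e /= e0 eU] : nbhs x U by exact: open_nbhs_nbhs.
have [r] := rat_in_itvoo (divr_gt0 e0 (ltr0Sn R 1)).
rewrite in_itv/= => /andP[r0 re].
have qP i : exists q : rat, `|x ord0 i - ratr q| < ratr r.
  have [|q] := @rat_in_itvoo _ (x ord0 i - ratr r) (x ord0 i + ratr r).
    by rewrite ltrD2l gtrN.
  rewrite in_itv/= => /andP[q1 q2]; exists q.
  by rewrite ltr_distlC q1.
pose q i := sval (cid (qP i)).
have qE i : `|x ord0 i - ratr (q i)| < ratr r by rewrite /q; case: cid.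
exists (\row_i q i, r); split; first by move=> i /=; rewrite mxE.
move=> y By; apply: eU; split => // i j; rewrite ord1 /ball/=.
rewrite (splitr e) (le_lt_trans (ler_distD (ratr (q j)) _ _))//.
have := By j; rewrite /= mxE => yq.
by apply: ltrD; [|rewrite distrC]; apply: lt_trans re; [exact: qE|exact: yq].
Qed.

Lemma lebesgue_open_gt0 (U : set V) : open U -> U !=set0 -> (0 < mu U)%E.
Proof.
move=> oU [x Ux].
have /nbhs_ballP[e /= e0 eU] : nbhs x U by exact: open_nbhs_nbhs.
have e2 : 0 < e / 2 by rewrite divr_gt0.
pose I i : set R := `[x ord0 i - e / 2, x ord0 i + e / 2]%classic.
have I0 i : (0 < lebesgue_measure (I i))%E.
  rewrite lebesgue_measure_itv/= lte_fin ltrD2l gtrN//= -EFinB lte_fin; lra.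
apply: (@lt_le_trans _ _ (mu [set y : V | forall i, I i (y ord0 i)])).
  rewrite (@lebesgue_rV_box R d I); last by move=> i; exact: measurable_itv.
  apply: (big_ind (fun x : \bar R => (0 < x)%E)) => [|a b|i _]; last exact: I0.
    exact: lte01.
  exact: mule_gt0.
apply: le_measure; rewrite ?inE; last 2 first.
- exact: open_measurable_rV.
- move=> y yI; apply: eU; split => // i j; rewrite ord1 /ball/=.
  have := yI j; rewrite /I/= in_itv/= => /andP[h1 h2].
  rewrite ltr_distlC; apply/andP; split; lra.
rewrite (_ : [set y : V | _] = \bigcap_(i in [set: 'I_d]) ((fun x : V => x ord0 i) @^-1` I i)).
  apply: fin_bigcap_measurable => // i _; rewrite -[X in measurable X]setTI.
  by apply: measurable_rV_coord => //; exact: measurable_itv.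
by apply/seteqP; split=> y /= h i; [move=> _; exact: h|exact: (h i)].
Qed.

(** Lindeloef: the complement of the essential support is a countable union of
    rational boxes on which [nu] vanishes almost everywhere. *)
Lemma ae_ess_support (nu : V -> R) :
  {ae mu, forall h, ~ ess_support nu h -> nu h = 0}.
Proof.
pose B (qr : 'rV[rat]_d * rat) : set V :=
  [set x | forall i, `|x ord0 i - ratr (qr.1 ord0 i)| < ratr qr.2].
pose null qr := {ae mu, forall x, B qr x -> nu x = 0}.
pose P (k : nat) (h : V) := forall qr, unpickle k = Some qr -> null qr -> B qr h -> nu h = 0.
have : forall k, {ae mu, forall h, P k h}.
  move=> k; rewrite /P; case: (unpickle k) => [qr|]; last by apply: aeW.
  have [nq|nq] := pselect (null qr).
    by apply: filterS nq => h hq _ [<-] _ /hq.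
  by apply: aeW => h _ [<-].
move=> /ae_foralln; apply: filterS => h Ph /contrapT -[U [oU nU] Uh].
have [qr [Bh BU]] := open_rational_box oU Uh.
apply: (Ph (pickle qr) qr) => //; first by rewrite pickleK.
by apply: filterS nU => x Ux Bx; apply: Ux; exact: BU.
Qed.

End rV_geometry.

(** * The function space W and its energy *)

Section restricted_tonelli.
Context {R : realType} {d1 d2} {T1 : measurableType d1} {T2 : measurableType d2}.
Variables (m1 : {sigma_finite_measure set T1 -> \bar R})
  (m2 : {sigma_finite_measure set T2 -> \bar R}).
Variables (F : T1 * T2 -> \bar R) (A : set T1) (B : set T2).
Hypotheses (mF : measurable_fun setT F) (F0 : forall z, (0 <= F z)%E).
Hypotheses (mA : measurable A) (mB : measurable B).
Local Open Scope ereal_scope.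

Let mFr : measurable_fun setT (F \_ (A `*` B)).
Proof.
apply/(measurable_restrictT _ _).1; first exact: measurableX.
exact: measurable_funTS.
Qed.

Let Fr0 z : 0 <= (F \_ (A `*` B)) z.
Proof. by rewrite patchE; case: ifP. Qed.

Lemma tonelli_in1 : \int[m1 \x m2]_(z in A `*` B) F z =
  \int[m1]_(x in A) \int[m2]_(y in B) F (x, y).
Proof.
rewrite [LHS]integral_mkcond (@fubini_tonelli1 _ _ _ _ R m1 m2 _ mFr Fr0) [RHS]integral_mkcond.
apply: eq_integral => x _; rewrite patchE /fubini_F; case: ifPn => xA.
  rewrite [RHS]integral_mkcond; apply: eq_integral => y _; rewrite !patchE.
  by rewrite in_setX/= xA.
under eq_integral do rewrite patchE in_setX/= (negbTE xA)/=.
by rewrite integral0.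
Qed.

Lemma tonelli_in2 : \int[m1 \x m2]_(z in A `*` B) F z =
  \int[m2]_(y in B) \int[m1]_(x in A) F (x, y).
Proof.
rewrite [LHS]integral_mkcond (@fubini_tonelli2 _ _ _ _ R m1 m2 _ mFr Fr0) [RHS]integral_mkcond.
apply: eq_integral => y _; rewrite patchE /fubini_G; case: ifPn => yB.
  rewrite [RHS]integral_mkcond; apply: eq_integral => x _; rewrite !patchE.
  by rewrite in_setX/= yB andbT.
under eq_integral do rewrite patchE in_setX/= (negbTE yB) andbF/=.
by rewrite integral0.
Qed.

Lemma ae_fst (P : T1 -> Prop) : {ae m1, forall x, P x} ->
  {ae m1 \x m2, forall z, P z.1}.
Proof.
move=> [N [mN N0 PN]]; exists (N `*` setT); split; first exact: measurableX.
  by rewrite product_measure1E// [X in (X * _)%E](N0 : m1 N = 0) mul0e.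
by move=> -[x y] /= nP; split=> //; exact: PN.
Qed.

Lemma ae_snd (P : T2 -> Prop) : {ae m2, forall x, P x} ->
  {ae m1 \x m2, forall z, P z.2}.
Proof.
move=> [N [mN N0 PN]]; exists (setT `*` N); split; first exact: measurableX.
  by rewrite product_measure1E// [X in (_ * X)%E](N0 : m2 N = 0) mule0.
by move=> -[x y] /= nP; split=> //; exact: PN.
Qed.

End restricted_tonelli.

Section energy_space.
Context {R : realType} {d : nat}.
Local Notation V := 'rV[R]_d.
Local Notation mu := (lebesgue_rV R d).
Local Notation mu2 := (lebesgue_rV R d \x lebesgue_rV R d)%E.
Variables (Omega : set V) (p : R) (nu : V -> R).
Hypotheses (p1 : 1 < p) (mOmega : measurable Omega).
Hypotheses (mnu : measurable_fun setT nu) (nu0 : forall h, 0 <= nu h)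
  (nuN : forall h, nu (- h) = nu h).
Implicit Types (u v w : V -> R).

Let p0 : 0 < p. Proof. by apply: lt_trans p1. Qed.

Definition strip : set (V * V) := ~` (~` Omega `*` ~` Omega).

(** The weighted difference quotient: it turns the energy into the duality
    pairing of L^p with respect to the product Lebesgue measure. *)
Definition dq_weight (z : V * V) : R := (nu (z.1 - z.2) * \1_strip z) `^ p^-1.

Definition dq u (z : V * V) : R := (u z.1 - u z.2) * dq_weight z.

Lemma measurable_strip : measurable strip.
Proof. by apply: measurableC; apply: measurableX; exact: measurableC. Qed.

Lemma stripE z : strip z <-> Omega z.1 \/ Omega z.2.
Proof.
rewrite /strip /setX /= not_andP; split.
  by move=> [/contrapT|/contrapT]; [left|right].
by move=> [h|h]; [left|right]; exact.
Qed.

Let mnuB : measurable_fun setT (fun z : V * V => nu (z.1 - z.2)).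
Proof. exact: (measurableT_comp mnu measurable_rVB). Qed.

Lemma measurable_dq u : measurable_fun setT u -> measurable_fun setT (dq u).
Proof.
move=> mu_; apply: measurable_funM.
  by apply: measurable_funB; apply: (measurableT_comp mu_).
apply: (measurableT_comp (measurable_powR _)).
by apply: measurable_funM => //; apply: measurable_indic; exact: measurable_strip.
Qed.

Lemma dq_lin (a : R) u v :
  dq (fun x => a * u x + v x) = fun z => a * dq u z + dq v z.
Proof. by apply/funext => z; rewrite /dq; ring. Qed.

Lemma dqB u v : dq (fun x => u x - v x) = fun z => dq u z - dq v z.
Proof. by apply/funext => z; rewrite /dq; ring. Qed.

Lemma dqDcst u (c : R) : dq (fun x => u x + c) = dq u.
Proof. by apply/funext => z; rewrite /dq; ring. Qed.

Let w0 z : 0 <= nu (z.1 - z.2) * \1_strip z.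
Proof. by rewrite mulr_ge0// indicE ler0n. Qed.

Lemma powR_dq u z :
  `|dq u z| `^ p = `|u z.1 - u z.2| `^ p * nu (z.1 - z.2) * \1_strip z.
Proof.
rewrite /dq normrM powRM// (ger0_norm (powR_ge0 _ _)) -mulrA; congr (_ * _).
by rewrite /dq_weight -powRrM mulVf ?gt_eqF// powRr1.
Qed.

Lemma psi_scale (a k : R) : 0 <= k -> psi p (a * k) = psi p a * k `^ (p - 1).
Proof.
rewrite le_eqVlt => /predU1P[<-|k0].
  by rewrite mulr0 /psi mulr0 powR0 ?mulr0// gt_eqF// subr_gt0.
rewrite /psi normrM (gtr0_norm k0) powRM ?(ltW k0)//.
rewrite [p - 1](_ : _ = p - 2 + 1); last by ring.
by rewrite (powRDp (p - 2) 1 k0) powRr1 ?(ltW k0)//; ring.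
Qed.

Lemma psi_dq u v z : psi p (dq u z) * dq v z =
  psi p (u z.1 - u z.2) * (v z.1 - v z.2) * nu (z.1 - z.2) * \1_strip z.
Proof.
rewrite /dq psi_scale ?powR_ge0// mulrACA -[RHS]mulrA; congr (_ * _).
rewrite mulrC mulr_powRB1 ?powR_ge0//.
by rewrite /dq_weight -powRrM mulVf ?gt_eqF// powRr1.
Qed.

Lemma energyE u v : energy p nu Omega u v =
  (\int[mu2]_z (psi p (dq u z) * dq v z)%:E)%E.
Proof.
rewrite /energy integral_mkcond; apply: eq_integral => z _.
rewrite patchE psi_dq indicE -/strip.
by case: ifPn => h; rewrite ?mulr1 ?mulr0.
Qed.

Lemma energy_pair u v : isLp mu2 p (dq u) -> isLp mu2 p (dq v) ->
  energy p nu Omega u v = (ppair mu2 p (dq u) (dq v))%:E.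
Proof.
move=> lu lv; rewrite energyE /ppair /Rintegral fineK//.
by apply: integrable_fin_num => //; exact: integrable_psi.
Qed.

Let G u (z : V * V) := (`|u z.1 - u z.2| `^ p * nu (z.1 - z.2))%:E.

Let mG u : measurable_fun setT u -> measurable_fun setT (G u).
Proof.
move=> mu_; apply/measurable_EFinP; apply: measurable_funM => //.
apply: measurable_fun_powR_norm.
by apply: measurable_funB; apply: (measurableT_comp mu_).
Qed.

Let G0 u z : (0 <= G u z)%E. Proof. by rewrite lee_fin mulr_ge0// powR_ge0. Qed.

Let int_dq u : (\int[mu2]_z (`|dq u z| `^ p)%:E = \int[mu2]_(z in strip) G u z)%E.
Proof.
rewrite [RHS]integral_mkcond; apply: eq_integral => z _.
rewrite patchE powR_dq indicE; case: ifPn => h; by rewrite ?mulr1 ?mulr0.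
Qed.

Lemma gagliardo_swap A B u : measurable A -> measurable B -> measurable_fun setT u ->
  gagliardo p nu A B u =
  (\int[mu]_(y in B) \int[mu]_(x in A) (`|u x - u y| `^ p * nu (x - y))%:E)%E.
Proof.
move=> mA mB mu_; rewrite -(tonelli_in2 mu mu (mG mu_) (G0 u) mA mB).
by rewrite (tonelli_in1 mu mu (mG mu_) (G0 u) mA mB).
Qed.

Lemma gagliardo_le_dq (B : set V) u : measurable B -> measurable_fun setT u ->
  (gagliardo p nu Omega B u <= \int[mu2]_z (`|dq u z| `^ p)%:E)%E.
Proof.
move=> mB mu_; rewrite int_dq /gagliardo -(tonelli_in1 mu mu (mG mu_) (G0 u) mOmega mB).
apply: ge0_subset_integral => //.
- exact: measurableX.
- exact: measurable_strip.
- exact: measurable_funTS (mG mu_).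
- by move=> z [zO _]; apply/stripE; left.
Qed.

(** The set [strip] consists of the pairs with first point in [Omega] and, up to
    exchanging the points, of a part of them. *)
Lemma dq_le_gagliardo u : measurable_fun setT u ->
  (\int[mu2]_z (`|dq u z| `^ p)%:E <= gagliardo p nu Omega setT u + gagliardo p nu Omega setT u)%E.
Proof.
move=> mu_; rewrite int_dq.
have E1 := tonelli_in1 mu mu (mG mu_) (G0 u) mOmega measurableT.
have E2 := tonelli_in2 mu mu (mG mu_) (G0 u) measurableT mOmega.
have E3 : (\int[mu2]_(z in setT `*` Omega) G u z = gagliardo p nu Omega setT u)%E.
  rewrite E2 /gagliardo; apply: eq_integral => y _; apply: eq_integral => x _.
  by rewrite /G/= distrC -nuN opprB.
have -> : strip = (Omega `*` setT) `|` (~` Omega `*` Omega).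
  apply/seteqP; split => -[x y] /=.
    move=> /stripE/= [xO|yO]; first by left.
    by have [xO|xO] := pselect (Omega x); [left|right].
  by move=> [[xO _]|[xO yO]]; apply/stripE => /=; [left|right].
have mO1 : measurable (Omega `*` (setT : set V)) by exact: measurableX.
have mO2 : measurable (~` Omega `*` Omega) by apply: measurableX => //; exact: measurableC.
rewrite ge0_integral_setU//; last 2 first.
- exact: measurable_funTS (mG mu_).
- apply/disj_setPS => -[x y] /= [[xO _] [nxO _]]; exact: nxO.
rewrite E1 leeD// -E3; apply: ge0_subset_integral => //.
- exact: measurableX.
- exact: measurable_funTS (mG mu_).
- by move=> [x y] [_ yO].
Qed.

Lemma integral_restrict_powR u :
  (\int[mu]_x (`|(u \_ Omega) x| `^ p)%:E = Lp_int p Omega u)%E.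
Proof.
rewrite /Lp_int [RHS]integral_mkcond; apply: eq_integral => x _.
rewrite !patchE; case: ifPn => // _.
by rewrite normr0 powR0// gt_eqF.
Qed.

(** Membership in the function space becomes p-integrability of two linear
    expressions in [u], so that the theory of p-energies applies to both. *)
Lemma W_spaceP u : W_space p nu Omega u <->
  [/\ measurable_fun setT u, isLp mu p (u \_ Omega) & isLp mu2 p (dq u)].
Proof.
split=> [[mu_ lu gu]|[mu_ /isLpP[_ lu] /isLpP[_ gu]]].
  split=> //; apply/isLpP; split.
  - by apply/(measurable_restrictT _ _).1 => //; exact: measurable_funTS.
  - by rewrite integral_restrict_powR.
  - exact: measurable_dq.
  - by apply: le_lt_trans (dq_le_gagliardo mu_) _; rewrite lte_add_pinfty.
split; [exact: mu_|by rewrite -integral_restrict_powR|].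
exact: le_lt_trans (gagliardo_le_dq measurableT mu_) gu.
Qed.

Lemma restrict_lin (D : set V) (a : R) u v :
  (fun x => a * u x + v x) \_ D = (fun x => a * (u \_ D) x + (v \_ D) x).
Proof. by apply/funext => x; rewrite !patchE; case: ifP => //; rewrite mulr0 addr0. Qed.

Lemma W_lin (a : R) u v : W_space p nu Omega u -> W_space p nu Omega v ->
  W_space p nu Omega (fun x => a * u x + v x).
Proof.
move=> /W_spaceP[mu_ lu eu] /W_spaceP[mv lv ev]; apply/W_spaceP; split.
- by apply: measurable_funD => //; exact: measurable_funM.
- by rewrite restrict_lin; exact: isLp_lin.
- by rewrite dq_lin; exact: isLp_lin.
Qed.

Lemma W_B u v : W_space p nu Omega u -> W_space p nu Omega v ->
  W_space p nu Omega (fun x => u x - v x).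
Proof.
move=> Wu Wv; rewrite (_ : (fun x => u x - v x) = (fun x => -1 * v x + u x)).
  exact: W_lin.
by apply/funext => x; ring.
Qed.

End energy_space.

(** * Norms, duality and the Poincare inequality *)

Section norms.
Context {R : realType} {d : nat}.
Local Notation V := 'rV[R]_d.
Local Notation mu := (lebesgue_rV R d).
Local Notation mu2 := (lebesgue_rV R d \x lebesgue_rV R d)%E.
Variables (Omega : set V) (p : R) (nu : V -> R).
Hypotheses (p1 : 1 < p) (mOmega : measurable Omega).
Hypotheses (mnu : measurable_fun setT nu) (nu0 : forall h, 0 <= nu h)
  (nuN : forall h, nu (- h) = nu h).
Implicit Types (u v w : V -> R) (F H : (V -> R) -> R).

Let p0 : 0 < p. Proof. by apply: lt_trans p1. Qed.

Local Notation W := (W_space p nu Omega).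
Local Notation WN := (W_norm p nu Omega).
Local Notation a_ u := (penergy mu p (u \_ Omega)).
Local Notation e_ u := (penergy mu2 p (dq Omega p nu u)).

Definition wnorm u : R := fine (WN u).

Lemma Lp_int_real u : W u -> Lp_int p Omega u = (a_ u)%:E.
Proof.
move=> Wu; have [_ lu _] := (W_spaceP p1 mOmega mnu nu0 nuN u).1 Wu.
rewrite (penergyE lu); exact/esym/integral_restrict_powR.
Qed.

Lemma gagliardo_real u : W u -> exists g : R,
  [/\ gagliardo p nu Omega setT u = g%:E, 0 <= g, g <= e_ u & e_ u <= 2 * g].
Proof.
move=> Wu; have [mu_ _ eu] := (W_spaceP p1 mOmega mnu nu0 nuN u).1 Wu.
have [_ _ gu] := Wu.
have g0 : (0 <= gagliardo p nu Omega setT u)%E.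
  apply: integral_ge0 => x _; apply: integral_ge0 => y _.
  by rewrite lee_fin mulr_ge0// powR_ge0.
have := gagliardo_le_dq p1 mOmega mnu nu0 measurableT mu_; have := dq_le_gagliardo p1 mOmega mnu nu0 nuN mu_.
rewrite -(penergyE eu) -(@fineK _ (gagliardo p nu Omega setT u)) ?ge0_fin_numE//.
rewrite -EFinD !lee_fin => h1 h2; exists (fine (gagliardo p nu Omega setT u)).
by split=> //; [exact: fine_ge0|rewrite mulr_natl mulr2n].
Qed.

(** The energy counts the pairs with exactly one point in [Omega] twice, the norm
    of the space counts them once: hence the factor 2. *)
Lemma W_norm_real u : W u ->
  [/\ WN u = (wnorm u)%:E, 0 <= wnorm u, a_ u <= wnorm u `^ p,
      e_ u <= 2 * wnorm u `^ p & wnorm u `^ p <= a_ u + e_ u].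
Proof.
move=> Wu; have [g [gE g0 ge eg]] := gagliardo_real Wu.
have E : WN u = ((a_ u + g) `^ p^-1)%:E by rewrite /W_norm Lp_int_real// gE -EFinD poweR_EFin.
have a0 := penergy_ge0 mu p (u \_ Omega).
have wE : wnorm u = (a_ u + g) `^ p^-1 by rewrite /wnorm E.
have wp : wnorm u `^ p = a_ u + g.
  by rewrite wE -powRrM mulVf ?gt_eqF// powRr1// addr_ge0.
split; rewrite ?wp.
- by rewrite E wE.
- by rewrite wE powR_ge0.
- by rewrite lerDl.
- by rewrite (le_trans eg)// ler_pM2l// lerDr.
- by rewrite lerD2l.
Qed.

Lemma wnorm_ge0 u : 0 <= wnorm u.
Proof. exact/fine_ge0/poweR_ge0. Qed.

Lemma W_Z (c : R) u : W u -> W (fun x => c * u x).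
Proof.
move=> Wu; have W0 : W (fun x => -1 * u x + u x) by exact: W_lin.
have := W_lin p1 mOmega mnu nu0 nuN c Wu W0.
by under eq_fun do rewrite mulN1r addNr addr0.
Qed.

Lemma W_norm_le1 (c : R) u : 0 < c -> W u -> wnorm u <= c ->
  (WN (fun x => (c^-1 * u x)%R) <= 1)%E.
Proof.
move=> c0 Wu uc; have c'0 : 0 < c^-1 by rewrite invr_gt0.
have Wcu := W_Z c^-1 Wu.
have [mu_ _ _] := Wu.
have [g [gE g0 _ _]] := gagliardo_real Wu.
have gcE : gagliardo p nu Omega setT (fun x => c^-1 * u x) = (c^-1 `^ p * g)%:E.
  have mG : measurable_fun setT (fun z : V * V => (`|u z.1 - u z.2| `^ p * nu (z.1 - z.2))%:E).
    apply/measurable_EFinP; apply: measurable_funM.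
      apply: measurable_fun_powR_norm.
      by apply: measurable_funB; apply: (measurableT_comp mu_).
    exact: (measurableT_comp mnu measurable_rVB).
  have G0 (z : V * V) : (0 <= (`|u z.1 - u z.2| `^ p * nu (z.1 - z.2))%:E)%E.
    by rewrite lee_fin mulr_ge0// powR_ge0.
  have mG' : measurable_fun setT (fun z : V * V =>
      (c^-1 `^ p)%:E * (`|u z.1 - u z.2| `^ p * nu (z.1 - z.2))%:E)%E.
    by apply: measurable_funeM.
  have G'0 (z : V * V) : (0 <=
      (c^-1 `^ p)%:E * (`|u z.1 - u z.2| `^ p * nu (z.1 - z.2))%:E)%E.
    by rewrite mule_ge0// lee_fin powR_ge0.
  have E1 := tonelli_in1 mu mu mG G0 mOmega measurableT.
  have E2 := tonelli_in1 mu mu mG' G'0 mOmega measurableT.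
  have mOT : measurable (Omega `*` (setT : set V)) by exact: measurableX.
  have cp0 : (0 <= (c^-1 `^ p)%:E)%E by rewrite lee_fin powR_ge0.
  have E3 := ge0_integralZl mu2 mOT (measurable_funTS mG) (fun z _ => G0 z) cp0.
  transitivity (\int[mu]_(x in Omega) \int[mu]_y
    ((c^-1 `^ p)%:E * (`|u x - u y| `^ p * nu (x - y))%:E))%E.
    apply: eq_integral => x _; apply: eq_integral => y _.
    rewrite -EFinM -mulrBr normrM powRM// (gtr0_norm c'0); congr EFin; ring.
  by rewrite EFinM -gE; apply: etrans (esym E2) _; apply: etrans E3 _; congr (_ * _)%E.
have aE : a_ (fun x => c^-1 * u x) = c^-1 `^ p * a_ u.
  rewrite (_ : _ \_ Omega = fun x => c^-1 * (u \_ Omega) x).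
    rewrite penergyZ ?gtr0_norm//.
    by have [_ lu _] := (W_spaceP p1 mOmega mnu nu0 nuN u).1 Wu.
  by apply/funext => x; rewrite !patchE; case: ifP => //; rewrite mulr0.
have wE : wnorm u `^ p = a_ u + g.
  rewrite /wnorm /W_norm Lp_int_real// gE -EFinD poweR_EFin/= -powRrM mulVf ?gt_eqF//.
  by rewrite powRr1// addr_ge0// penergy_ge0.
rewrite /W_norm Lp_int_real// aE gcE -EFinD -mulrDr -wE poweR_EFin lee_fin.
rewrite -powRM ?wnorm_ge0 ?(ltW c'0)// -powRrM mulfV ?gt_eqF// powRr1.
  by rewrite mulrC ler_pdivrMr// mul1r.
by rewrite mulr_ge0 ?wnorm_ge0// ltW.
Qed.

(** A linear functional bounded on the unit ball is bounded by the norm;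
    comparing with all c > norm avoids the case of norm 0. *)
Lemma linear_bound (S : \bar R) H : (S < +oo)%E ->
  (forall (c : R) u v, W u -> W v -> H (fun x => c * u x + v x) = c * H u + H v) ->
  (forall v, W v -> (WN v <= 1)%E -> (`|H v|%:E <= S)%E) ->
  forall v, W v -> `|H v| <= fine S * wnorm v.
Proof.
move=> Sy Hlin HS.
have HZ (c : R) v : W v -> H (fun x => c * v x) = c * H v.
  move=> Wv; have W0 : W (fun x => -1 * v x + v x) by exact: W_lin.
  have := Hlin c _ _ Wv W0; have := Hlin (-1) _ _ Wv Wv.
  under eq_fun do rewrite mulN1r addNr; under [X in _ -> H X = _ -> _]eq_fun do rewrite mulN1r addNr addr0.
  by move=> -> ->; ring.
move=> v Wv.
have key (c : R) : 0 < c -> wnorm v <= c -> `|H v| <= fine S * c.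
  move=> c0 vc; have := HS _ (W_Z c^-1 Wv) (W_norm_le1 c0 Wv vc).
  rewrite HZ// normrM gtr0_norm ?invr_gt0// => h.
  have Sfin : S \is a fin_num.
    by rewrite ge0_fin_numE// (le_trans _ h)// lee_fin mulr_ge0// invr_ge0 ltW.
  by move: h; rewrite -[S in (_ <= S)%E]fineK// lee_fin ler_pdivrMl// mulrC.
have S0 : 0 <= fine S.
  have v1 : 0 < wnorm v + 1 by rewrite ltr_wpDl// wnorm_ge0.
  have := key _ v1 _; rewrite lerDl ler01 => /(_ isT) /(le_trans (normr_ge0 _)).
  by rewrite pmulr_lge0.
apply/ler_addgt0Pl => e e0.
have e1 : 0 < e / (fine S + 1) by rewrite divr_gt0// ltr_wpDl.
apply: le_trans (key (wnorm v + e / (fine S + 1)) _ _) _.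
- by rewrite ltr_wpDl// wnorm_ge0.
- by rewrite lerDl ltW.
- rewrite mulrDr addrC lerD2r mulrCA ger_pMr// ler_pdivrMr ?ltr_wpDl//.
  by rewrite mul1r lerDl.
Qed.

End norms.

(** * Mean values, the Poincare inequality and completeness *)

Section mean_free.
Context {R : realType} {d : nat}.
Local Notation V := 'rV[R]_d.
Local Notation mu := (lebesgue_rV R d).
Local Notation mu2 := (lebesgue_rV R d \x lebesgue_rV R d)%E.
Variables (Omega : set V) (p : R) (nu : V -> R).
Hypotheses (oO : open Omega) (bO : bounded_set Omega) (neO : Omega !=set0).
Hypothesis p1 : 1 < p.
Hypotheses (mnu : measurable_fun setT nu) (nu0 : forall h, 0 <= nu h)
  (nuN : forall h, nu (- h) = nu h).
Hypothesis poin : poincare p nu Omega.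
Implicit Types (u v w : V -> R).

Let p0 : 0 < p. Proof. by apply: lt_trans p1. Qed.
Let mO : measurable Omega. Proof. exact: open_measurable_rV. Qed.

Local Notation W := (W_space p nu Omega).
Local Notation Wp := (W_perp p nu Omega).
Local Notation wnorm := (wnorm Omega p nu).
Local Notation a_ u := (penergy mu p (u \_ Omega)).
Local Notation e_ u := (penergy mu2 p (dq Omega p nu u)).
Local Notation WP := (W_spaceP p1 mO mnu nu0 nuN).

Let muO_fin : (mu Omega < +oo)%E. Proof. exact: bounded_lebesgue_lty. Qed.

Let mu_finE : mu Omega = (fine (mu Omega))%:E.
Proof. by rewrite fineK// ge0_fin_numE. Qed.

Let m0 : 0 < fine (mu Omega).
Proof. by rewrite -lte_fin -mu_finE; exact: lebesgue_open_gt0. Qed.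

Let int_cst (c : R) : mu.-integrable Omega (EFin \o (fun=> c)).
Proof.
apply/integrableP; split; first exact/measurable_EFinP.
rewrite (integral_cst mu mO `|c%:E|%E).
by apply: lte_mul_pinfty; [exact: abse_ge0|by rewrite abse_fin_num|exact: muO_fin].
Qed.

Let W_int_powR u : W u -> mu.-integrable Omega (EFin \o (fun x => `|u x| `^ p)).
Proof.
move=> /WP[_ [_ iu] _]; apply/(integrable_mkcond _ mO).
rewrite restrict_EFin; congr (mu.-integrable setT (EFin \o _)): iu.
apply/funext => x; rewrite !patchE; case: ifP => // _.
by rewrite normr0 powR0// gt_eqF.
Qed.

Let a_E u : a_ u = \int[mu]_(x in Omega) (`|u x| `^ p).
Proof.
rewrite [RHS]Rintegral_mkcond; apply: eq_Rintegral => x _; rewrite !patchE.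
by case: ifP => // _; rewrite normr0 powR0// gt_eqF.
Qed.

(** Splitting at the level [t] instead of applying Hoelder's inequality leaves the
    first term as small as desired. *)
Let young_level (t x : R) : 0 < t -> 0 <= x -> x <= t + t `^ (1 - p) * x `^ p.
Proof.
move=> t0 x0; have [xt|tx] := leP x t.
  by rewrite (le_trans xt)// lerDl mulr_ge0// powR_ge0.
have x00 : 0 < x by apply: lt_trans tx.
rewrite (@le_trans _ _ (t `^ (1 - p) * x `^ p))//; last by rewrite lerDr ltW.
rewrite -(@ler_pM2l _ (x `^ (1 - p))) ?powR_gt0// mulrCA -powRDp//.
rewrite [X in _ <= _ * x `^ X](_ : _ = 1); last by ring.
rewrite powRr1 ?(ltW x00)// ler_pM2r//.
by apply: le_powR_neg; [rewrite subr_le0 ltW|exact: t0|exact: ltW].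
Qed.

Lemma W_integrable u : W u -> mu.-integrable Omega (EFin \o u).
Proof.
move=> Wu; have [mu_ _ _] := Wu; have iu := W_int_powR Wu.
apply: (le_integrable mO _ _ (integrableD mO (int_cst 1) iu)).
  by apply/measurable_EFinP; exact: measurable_funTS.
move=> x _; rewrite /= lee_fin [leRHS]ger0_norm ?addr_ge0 ?powR_ge0//.
by have := young_level ltr01 (normr_ge0 (u x)); rewrite powR1 mul1r.
Qed.

Lemma Rintegral_W_bound (t : R) u : 0 < t -> W u ->
  `|\int[mu]_(x in Omega) u x| <= t * fine (mu Omega) + t `^ (1 - p) * a_ u.
Proof.
move=> t0 Wu; have [mu_ _ _] := Wu; have iu := W_int_powR Wu.
have iu1 := W_integrable Wu.
rewrite (le_trans (le_normr_Rintegral mO iu1))// a_E.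
rewrite -(Rintegral_cst mu mO) -(@RintegralZl _ _ _ mu Omega _ (t `^ (1 - p)) mO iu).
have iZ : mu.-integrable Omega (EFin \o (fun x => t `^ (1 - p) * `|u x| `^ p)).
  by have := integrableZl mO (t `^ (1 - p)) iu.
rewrite -RintegralD//.
apply: le_Rintegral => //.
- exact: (integrable_norm iu1).
- by have := integrableD mO (int_cst t) iZ.
- by move=> x _; exact: young_level.
Qed.

Lemma W_cst (c : R) : W (fun=> c).
Proof.
apply/WP; split=> //.
- apply/isLpP; split; first by apply/(measurable_restrictT _ _).1.
  rewrite (integral_restrict_powR Omega p1 (fun=> c)) /Lp_int integral_cst//.
  apply: lte_mul_pinfty; [by rewrite lee_fin powR_ge0|by []|exact: muO_fin].
- rewrite (_ : dq _ _ _ _ = fun=> 0); last by apply/funext => z; rewrite /dq subrr mul0r.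
  by have [] := penergy_ae0 p1 (measurable_cst (0 : R)) (aeW mu2 (fun=> erefl)).
Qed.

Lemma W_subr_cst u (c : R) : W u -> W (fun x => u x - c).
Proof. by move=> Wu; exact: (W_B p1 mO mnu nu0 nuN Wu (W_cst c)). Qed.

Lemma W_perp_mean u : W u -> Wp (fun x => u x - mean Omega u).
Proof.
move=> Wu; split; first exact: W_subr_cst.
rewrite (RintegralB mO (W_integrable Wu) (int_cst _)) Rintegral_cst// /mean mulrAC mulVf ?mul1r ?subrr//.
by rewrite gt_eqF.
Qed.

Lemma W_perp_mean0 u : Wp u -> mean Omega u = 0.
Proof. by move=> [_ u0]; rewrite /mean u0 mulr0. Qed.

Lemma W_perp_lin (a : R) u v : Wp u -> Wp v -> Wp (fun x => a * u x + v x).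
Proof.
move=> [Wu u0] [Wv v0]; split; first exact: W_lin.
have iu := W_integrable Wu; have iv := W_integrable Wv.
have iau : mu.-integrable Omega (EFin \o (fun x => a * u x)).
  by have := integrableZl mO a iu.
by rewrite RintegralD// RintegralZl// u0 v0 mulr0 addr0.
Qed.

Lemma W_perpB u v : Wp u -> Wp v -> Wp (fun x => u x - v x).
Proof.
move=> Wu Wv; rewrite (_ : (fun x => u x - v x) = (fun x => -1 * v x + u x)).
  exact: W_perp_lin.
by apply/funext => x; ring.
Qed.

Lemma W_perp0 : Wp (fun=> 0).
Proof. by split; [exact: W_cst|rewrite Rintegral_cst// mul0r]. Qed.

Lemma poincare_energy : exists2 CP : R, 0 < CP &
  forall u, Wp u -> a_ u <= CP * e_ u.
Proof.
have [CP CP0 h] := poin; exists CP => // u Wpu; have [Wu _] := Wpu.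
have [mu_ lu eu] := (WP u).1 Wu.
have [_ Lu _] := Wu.
have := h u (conj (measurable_funTS mu_) Lu).
rewrite (W_perp_mean0 Wpu); under [X in Lp_int _ _ X]eq_fun do rewrite subr0.
rewrite (Lp_int_real p1 mO mnu nu0 nuN Wu) => /le_trans h1.
rewrite -lee_fin EFinM (penergyE eu); apply: h1.
rewrite lee_pmul2l//.
exact: gagliardo_le_dq.
Qed.

(** On mean-free functions the energy is a norm equivalent to that of the space. *)
Lemma W_norm_energy : exists2 B : R, 0 < B &
  forall u, Wp u -> wnorm u <= B * e_ u `^ p^-1.
Proof.
have [CP CP0 h] := poincare_energy.
exists ((CP + 1) `^ p^-1); first by rewrite powR_gt0// addr_gt0.
move=> u Wpu; have [Wu _] := Wpu.
have [_ w0 _ _ wp] := W_norm_real p1 mO mnu nu0 nuN Wu.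
rewrite -powRM ?penergy_ge0//; last by rewrite addr_ge0// ltW.
have -> : wnorm u = (wnorm u `^ p) `^ p^-1.
  by rewrite -powRrM mulfV ?gt_eqF// powRr1.
apply: le_powR_l; [by rewrite invr_ge0 ltW|exact: powR_ge0|].
by rewrite (le_trans wp)// mulrDl mul1r lerD2r h.
Qed.

(** The Poincare inequality gives almost everywhere convergence in [Omega], fast
    convergence that of the difference quotients. At a pair of [strip] where the
    weight is nonzero, one of the two points lies in [Omega], and the convergence of
    the difference carries over to the other one. The upper limit thus defines a
    measurable limit wherever the kernel can see it. *)
Lemma W_perp_complete (v_ : (V -> R)^nat) : (forall n, Wp (v_ n)) ->
  (forall n k, (n <= k)%N -> penergy mu2 p (fun z => dq Omega p nu (v_ n) z -
    dq Omega p nu (v_ k) z) <= fast_rate p n) ->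
  exists2 u, Wp u & {ae mu2, forall z,
    dq Omega p nu (v_ n) z @[n --> \oo] --> dq Omega p nu u z}.
Proof.
move=> Wv cau; have [CP CP0 hCP] := poincare_energy.
have mv n : measurable_fun setT (v_ n) by have [/WP[]] := Wv n.
have lv n : isLp mu p (v_ n \_ Omega) by have [/WP[]] := Wv n.
have ev n : isLp mu2 p (dq Omega p nu (v_ n)) by have [/WP[]] := Wv n.
have restrictB u v : (fun x => (u \_ Omega) x - (v \_ Omega) x) = (fun x => u x - v x) \_ Omega.
  by apply/funext => x; rewrite !patchE; case: ifP => // _; rewrite subr0.
have cau1 n k : (n <= k)%N ->
    penergy mu p (fun x => (v_ n \_ Omega) x - (v_ k \_ Omega) x) <= CP * fast_rate p n.
  move=> nk; rewrite restrictB (le_trans (hCP _ (W_perpB (Wv n) (Wv k))))//.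
  by rewrite ler_pM2l// dqB; exact: cau.
have cv1 : {ae mu, forall x, cvgn (fun n => (v_ n \_ Omega) x)}.
  by apply: (fast_ae_cvg p1 lv (C := CP)) => n; exact: cau1.
have cv2 : {ae mu2, forall z, cvgn (fun n => dq Omega p nu (v_ n) z)}.
  by apply: (fast_ae_cvg p1 ev (C := 1)) => n; rewrite mul1r; exact: cau.
pose u x := fine (limn_esup (fun n => (v_ n x)%:E)).
have mu_ : measurable_fun setT u.
  apply: (measurableT_comp (fine_measurable measurableT)).
  by apply: measurable_fun_limn_esup => n; exact/measurable_EFinP.
have uE x l : v_ n x @[n --> \oo] --> l -> u x = l.
  move=> cv.
  have cvE : (fun n => (v_ n x)%:E) @ \oo --> l%:E.
    by apply: cvg_EFin; [exact: nearW|exact: cv].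
  by rewrite /u is_cvg_limn_esupE ?(cvg_lim _ cvE)//; apply/cvg_ex; exists l%:E.
have ucvg x : cvgn (fun n => v_ n x) -> v_ n x @[n --> \oo] --> u x.
  by move=> /cvg_ex[l vl]; rewrite (uE _ _ vl).
have cvO : {ae mu, forall x, Omega x -> v_ n x @[n --> \oo] --> u x}.
  apply: filterS cv1 => x cx xO; apply: ucvg; move: cx.
  suff -> : (fun n => (v_ n \_ Omega) x) = (fun n => v_ n x) by [].
  by apply/funext => n; rewrite patchE mem_set.
have cvD : {ae mu2, forall z, dq Omega p nu (v_ n) z @[n --> \oo] --> dq Omega p nu u z}.
  have f1 := ae_fst mu cvO; have f2 := ae_snd mu cvO.
  apply: filterS3 cv2 f1 f2 => z cz c1 c2.
  have [k0|k0] := eqVneq (dq_weight Omega p nu z) 0.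
    rewrite /dq k0 mulr0; under eq_fun do rewrite mulr0; exact: cvg_cst.
  have zS : strip Omega z.
    apply: contrapT => nS; move/eqP: k0; apply.
    by rewrite /dq_weight indicE memNset// mulr0 powR0// gt_eqF// invr_gt0.
  have cdiff : cvgn (fun n => v_ n z.1 - v_ n z.2).
    have -> : (fun n => v_ n z.1 - v_ n z.2) =
        (fun n => dq Omega p nu (v_ n) z * (dq_weight Omega p nu z)^-1).
      by apply/funext => n; rewrite /dq mulfK.
    by apply: is_cvgM => //; exact: is_cvg_cst.
  suff [h1 h2] : v_ n z.1 @[n --> \oo] --> u z.1 /\ v_ n z.2 @[n --> \oo] --> u z.2.
    by apply: cvgM; [exact: cvgB|exact: cvg_cst].
  have [z1|z2] := (stripE Omega z).1 zS.
    split; first exact: c1.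
    apply: ucvg; have -> : (fun n => v_ n z.2) = (fun n => v_ n z.1 - (v_ n z.1 - v_ n z.2)).
      by apply/funext => n; rewrite opprB addrC subrK.
    by apply: is_cvgB => //; apply/cvg_ex; exists (u z.1); exact: c1.
  split; last exact: c2.
  apply: ucvg; have -> : (fun n => v_ n z.1) = (fun n => v_ n z.2 + (v_ n z.1 - v_ n z.2)).
    by apply/funext => n; rewrite addrC subrK.
  by apply: is_cvgD => //; apply/cvg_ex; exists (u z.2); exact: c2.
have mdu := measurable_dq p mO mnu mu_.
have mruO : measurable_fun setT (u \_ Omega).
  by apply/(measurable_restrictT _ _).1 => //; exact: measurable_funTS.
have closeO n : isLp mu p (fun x => (v_ n \_ Omega) x - (u \_ Omega) x) /\
    penergy mu p (fun x => (v_ n \_ Omega) x - (u \_ Omega) x) <= CP * fast_rate p n.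
  apply: (@penergy_fatou _ _ _ mu p p1 (fun k x => (v_ n \_ Omega) x - (v_ k \_ Omega) x)).
  - by move=> k; exact: isLpB.
  - by apply: measurable_funB => //; case: (lv n).
  - apply: filterS cvO => x cx; apply: cvgB; first exact: cvg_cst.
    rewrite patchE; under eq_fun do rewrite patchE.
    by case: ifPn => [/set_mem/cx//|_]; exact: cvg_cst.
  - by near=> k; apply: cau1; near: k; exact: nbhs_infty_ge.
have closeD : isLp mu2 p (fun z => dq Omega p nu (v_ 0%N) z - dq Omega p nu u z).
  apply: (proj1 (@penergy_fatou _ _ _ mu2 p p1 (fun k z =>
    dq Omega p nu (v_ 0%N) z - dq Omega p nu (v_ k) z) _ (fast_rate p 0) _ _ _ _)).
  - by move=> k; exact: isLpB.
  - by apply: measurable_funB => //; case: (ev 0%N).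
  - by apply: filterS cvD => z cz; apply: cvgB => //; exact: cvg_cst.
  - by near=> k; apply: cau.
have Wu : W u.
  apply/WP; split=> //.
    have := isLpB p1 (lv 0%N) (closeO 0%N).1.
    by under eq_fun do rewrite opprB addrC subrK.
  have := isLpB p1 (ev 0%N) closeD.
  by under eq_fun do rewrite opprB addrC subrK.
exists u => //; split=> //.
apply/eqP; rewrite -normr_eq0 eq_le normr_ge0 andbT; apply/ler_addgt0Pl => e e0.
rewrite addr0.
pose t := e / (2 * fine (mu Omega)).
have t0 : 0 < t by rewrite divr_gt0// mulr_gt0.
pose K := t `^ (1 - p) * CP.
have K0 : 0 < K by rewrite mulr_gt0// powR_gt0.
have e'0 : 0 < e / 2 / K by rewrite !divr_gt0.
have /cvgrPdist_lt/(_ _ e'0) rate0 := cvg_fast_rate p1.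
near \oo => n.
have rn : fast_rate p n < e / 2 / K.
  have : `|0 - fast_rate p n| < e / 2 / K by near: n.
  by rewrite sub0r normrN gtr0_norm ?fast_rate_gt0.
have [Wvn vn0] := Wv n.
have Wd := W_B p1 mO mnu nu0 nuN Wvn Wu.
have := Rintegral_W_bound t0 Wd.
rewrite (RintegralB mO (W_integrable Wvn) (W_integrable Wu)) vn0 sub0r normrN.
move=> /le_trans; apply.
have tE : t * fine (mu Omega) = e / 2 by rewrite /t; field; rewrite gt_eqF.
rewrite tE [leRHS]splitr lerD2l -restrictB.
apply: (@le_trans _ _ (t `^ (1 - p) * (CP * fast_rate p n))).
  by rewrite ler_wpM2l ?powR_ge0//; exact: (closeO n).2.
by rewrite mulrA -/K mulrC -ler_pdivlMr// ltW.
Unshelve. all: by end_near. Qed.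

End mean_free.

(** * Equality of representatives *)

Section representatives.
Context {R : realType} {d : nat}.
Local Notation V := 'rV[R]_d.
Local Notation mu := (lebesgue_rV R d).
Local Notation mu2 := (lebesgue_rV R d \x lebesgue_rV R d)%E.
Variables (Omega : set V) (p : R) (nu : V -> R).
Hypothesis oO : open Omega.
Hypothesis p1 : 1 < p.
Hypotheses (mnu : measurable_fun setT nu) (nu0 : forall h, 0 <= nu h)
  (nuN : forall h, nu (- h) = nu h).
Implicit Types (u v w : V -> R).

Let p0 : 0 < p. Proof. by apply: lt_trans p1. Qed.
Let mO : measurable Omega. Proof. exact: open_measurable_rV. Qed.

Local Notation a_ u := (penergy mu p (u \_ Omega)).
Local Notation e_ u := (penergy mu2 p (dq Omega p nu u)).

Let G u (z : V * V) := (`|u z.1 - u z.2| `^ p * nu (z.1 - z.2))%:E.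

Let mG u : measurable_fun setT u -> measurable_fun setT (G u).
Proof.
move=> mu_; apply/measurable_EFinP; apply: measurable_funM.
  apply: measurable_fun_powR_norm.
  by apply: measurable_funB; apply: (measurableT_comp mu_).
exact: (measurableT_comp mnu measurable_rVB).
Qed.

Let G0 u z : (0 <= G u z)%E. Proof. by rewrite lee_fin mulr_ge0// powR_ge0. Qed.

(** The kernel does not see the points outside [Omega] and its hull: their
    differences with points of [Omega] lie outside the support of [nu]. *)
Lemma ae0_energy0 w : measurable_fun setT w ->
  {ae mu, forall x, (Omega `|` nu_hull nu Omega) x -> w x = 0} ->
  [/\ isLp mu p (w \_ Omega), isLp mu2 p (dq Omega p nu w), a_ w = 0 & e_ w = 0].
Proof.
move=> mw w0.
have gag0 : gagliardo p nu Omega setT w = 0%E.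
  have in0 x : Omega x -> w x = 0 -> (\int[mu]_y G w (x, y) = 0)%E.
    move=> Ox wx0; rewrite (_ : 0%E = \int[mu]_y (cst 0%E : V -> \bar R) y)%E; last by rewrite integral0.
    apply: ge0_ae_eq_integral => //.
    - exact: (measurableT_comp (mG mw) (pair1_measurable x)).
    - have := ae_shift (- x) (ae_ess_support nu); apply: filterS2 w0 => y wy nuy _.
      rewrite /G/= wx0 sub0r normrN.
      have [hy|hy] := pselect ((Omega `|` nu_hull nu Omega) y).
        by rewrite wy// normr0 powR0 ?mul0r// gt_eqF.
      rewrite -nuN opprB nuy ?mulr0// => sy; apply: hy; right.
      by exists x => //; exists (y - x) => //; rewrite addrC subrK.
  rewrite /gagliardo (_ : 0%E = \int[mu]_(x in Omega) (cst 0%E : V -> \bar R) x)%E; last by rewrite integral0.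
  apply: ge0_ae_eq_integral => //.
  - apply: measurable_funTS.
    exact: (measurable_fun_fubini_tonelli_F (m2 := mu) _ (mG mw) (G0 w)).
  - by move=> x _; apply: integral_ge0 => y _; exact: (G0 w (x, y)).
  - apply: filterS w0 => x wx Ox; apply: in0 => //; apply: wx; by left.
have a0 : {ae mu, forall x, (w \_ Omega) x = 0}.
  apply: filterS w0 => x wx; rewrite patchE; case: ifPn => // /set_mem Ox.
  by apply: wx; left.
have mwO : measurable_fun setT (w \_ Omega).
  by apply/(measurable_restrictT _ _).1 => //; exact: measurable_funTS.
have [l1 p10] := penergy_ae0 p1 mwO a0.
have e0 : (\int[mu2]_z (`|dq Omega p nu w z| `^ p)%:E <= 0)%E.
  by have := dq_le_gagliardo p1 mO mnu nu0 nuN mw; rewrite gag0 adde0.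
have l2 : isLp mu2 p (dq Omega p nu w).
  apply/isLpP; split; first exact: measurable_dq.
  exact: le_lt_trans e0 (ltry _).
split=> //; apply/eqP; rewrite eq_le penergy_ge0 andbT -lee_fin.
by rewrite (penergyE l2).
Qed.

Lemma W_eq_sub u v : W_eq nu Omega u v ->
  {ae mu, forall x, (Omega `|` nu_hull nu Omega) x -> u x - v x = 0}.
Proof. by apply: filterS => x h Hx; rewrite h// subrr. Qed.

(** If [w(y) != 0], the vanishing of the energy forces [nu(x - y) = 0] for almost
    every [x] in [Omega], against the positivity of the weight at [y]. *)
Lemma energy0_ae0 w :
  {ae mu, forall x, (nu_hull nu Omega `\` Omega) x -> 0 < tilde_weight nu Omega x} ->
  measurable_fun setT w -> isLp mu p (w \_ Omega) -> isLp mu2 p (dq Omega p nu w) ->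
  a_ w = 0 -> e_ w = 0 ->
  {ae mu, forall x, (Omega `|` nu_hull nu Omega) x -> w x = 0}.
Proof.
move=> tw mw lw le a0 e0.
have w0O : {ae mu, forall x, Omega x -> w x = 0}.
  apply: filterS (penergy_eq0 lw a0) => x + Ox.
  by rewrite patchE mem_set.
have gag0 : (\int[mu]_y \int[mu]_(x in Omega) G w (x, y) = 0)%E.
  apply/eqP; rewrite eq_le; apply/andP; split; last first.
    by apply: integral_ge0 => y _; apply: integral_ge0 => x _; exact: (G0 w (x, y)).
  rewrite -(gagliardo_swap p mnu nu0 mO measurableT mw).
  by rewrite (le_trans (gagliardo_le_dq p1 mO mnu nu0 measurableT mw))// -(penergyE le) e0.
have mI : measurable_fun setT (fun y => \int[mu]_(x in Omega) G w (x, y))%E.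
  have mGr : measurable_fun setT (G w \_ (Omega `*` setT)).
    apply/(measurable_restrictT _ _).1; first exact: measurableX.
    by apply: measurable_funTS; exact: mG.
  have Gr0 z : (0 <= (G w \_ (Omega `*` setT)) z)%E by rewrite patchE; case: ifP.
  have := measurable_fun_fubini_tonelli_G (m1 := mu) _ mGr Gr0.
  congr (measurable_fun _ _); apply/funext => y.
  rewrite /fubini_G [RHS]integral_mkcond; apply: eq_integral => x _.
  by rewrite !patchE in_setX/= in_setT andbT.
have ae_in : {ae mu, forall y, \int[mu]_(x in Omega) G w (x, y) = 0}%E.
  have /(ae_eq_integral_abs mu measurableT mI) : (\int[mu]_y `|\int[mu]_(x in Omega) G w (x, y)| = 0)%E.
    rewrite -gag0; apply: eq_integral => y _; rewrite gee0_abs//.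
    by apply: integral_ge0 => x _; exact: (G0 w (x, y)).
  by apply: filterS => y /(_ I).
have w0O' := w0O; apply: filterS3 tw w0O' ae_in => y twy wO iny.
have [Oy _|nOy [//|hy]] := pselect (Omega y); first exact: wO.
apply: contrapT => /eqP wy0.
have := twy (conj hy nOy); rewrite /tilde_weight.
suff -> : \int[mu]_(x in Omega) Num.min 1 (nu (y - x)) = 0 by rewrite ltxx.
have mGy : measurable_fun Omega (fun x => G w (x, y)).
  apply: measurable_funTS; exact: (measurableT_comp (mG mw) (pair2_measurable y)).
have : (\int[mu]_(x in Omega) `|G w (x, y)| = 0)%E.
  by rewrite -iny; apply: eq_integral => x _; rewrite gee0_abs.
move=> /(ae_eq_integral_abs mu mO mGy) aeG.
rewrite /Rintegral (_ : (\int[mu]_(x in Omega) _)%E = 0%E)//.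
rewrite (_ : 0%E = \int[mu]_(x in Omega) (cst 0%E : V -> \bar R) x)%E; last by rewrite integral0.
apply: ge0_ae_eq_integral => //.
- apply/measurable_EFinP; apply: measurable_funTS; apply: measurable_minr => //.
  exact: (measurableT_comp mnu (measurableT_comp measurable_rVB (pair1_measurable y))).
- by move=> x _; rewrite lee_fin le_min ler01 nu0.
- apply: filterS2 aeG w0O => x Gx wx Ox.
  have := Gx Ox; rewrite /G/= wx// sub0r normrN => -[] /eqP.
  rewrite mulf_eq0 powR_eq0 normr_eq0 (negbTE wy0)/= => /eqP nu_0.
  by rewrite -nuN opprB nu_0; congr EFin; apply/min_idPr; exact: ler01.
Qed.

End representatives.

(** * Well-posedness *)

Section absorption.
Context {R : realType}.
Variable p : R.
Hypothesis p1 : 1 < p.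

Let p0 : 0 < p. Proof. by apply: lt_trans p1. Qed.
Let q0 : 0 < p - 1. Proof. by rewrite subr_gt0. Qed.

Lemma powRK (x : R) : 0 <= x -> (x `^ p^-1) `^ p = x.
Proof. by move=> x0; rewrite -powRrM mulVf ?gt_eqF// powRr1. Qed.

Lemma powR_absorb (x c : R) : 0 <= x -> 0 <= c -> x `^ p <= c * x ->
  x <= c `^ (p - 1)^-1.
Proof.
rewrite le_eqVlt => /predU1P[<- _ _|x0 c0 h]; first exact: powR_ge0.
rewrite -(mulr_powRB1 (ltW x0) p0) mulrC ler_pM2r// in h.
have {1}-> : x = (x `^ (p - 1)) `^ (p - 1)^-1.
  by rewrite -powRrM mulfV ?gt_eqF// powRr1// ltW.
by apply: le_powR_l => //; [rewrite invr_ge0 ltW|exact: powR_ge0].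
Qed.

(** At the threshold [t = x / (2 Y)] the last term is at most half of [x^p], and the
    first one bounds the other half. *)
Lemma powR_absorb_split (x Y A : R) : p < 2 -> 0 <= x -> 0 <= Y -> 0 <= A ->
  x `^ p <= Y `^ p ->
  (forall t : R, 0 < t -> x `^ p <= t `^ (p - 2) * (A * x) + t `^ p * Y `^ p) ->
  x <= 4 * (A * Y `^ (2 - p)).
Proof.
move=> p2 x0 Y0 A0 xY h.
have [x00|xN0] := eqVneq x 0; first by rewrite x00 !mulr_ge0// powR_ge0.
have {}x0 : 0 < x by rewrite lt_neqAle eq_sym xN0.
have Y1 : 0 < Y.
  rewrite lt_neqAle Y0 andbT; apply: contraTN xY => /eqP <-.
  by rewrite powR0 ?gt_eqF// -ltNge powR_gt0.
have Y20 : 0 < 2 * Y by rewrite mulr_gt0.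
have t0 : 0 < x / (2 * Y) by rewrite divr_gt0.
have half1 : 2^-1 `^ p <= 2^-1 :> R.
  apply: ge1r_powR; last exact: ltW.
  by rewrite invr_gt0 ltr0n/= invf_le1 ?ltr0n// ler1n.
have tY : (x / (2 * Y)) `^ p * Y `^ p <= x `^ p / 2.
  rewrite -(powRM _ (ltW t0) Y0) (_ : x / (2 * Y) * Y = x * 2^-1); last first.
    by field; rewrite gt_eqF.
  by rewrite powRM ?(ltW x0)// ler_wpM2l// powR_ge0.
have t2 : (x / (2 * Y)) `^ (p - 2) = x `^ (p - 2) * (2 * Y) `^ (2 - p).
  rewrite powRM ?invr_ge0 ?(ltW x0) ?(ltW Y20)//; congr (_ * _).
  rewrite -(powR_inv1 (ltW Y20)) -powRrM; congr (_ `^ _); ring.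
have h1 := h _ t0.
have h2 : x `^ p / 2 <= x `^ (p - 2) * (2 * Y) `^ (2 - p) * (A * x).
  by rewrite -t2; move: h1 tY; clear; lra.
rewrite (powRB_split p x0) in h2.
have xp0 : 0 < x * x `^ (p - 2) by rewrite mulr_gt0// powR_gt0.
have h3 : x / 2 <= (2 * Y) `^ (2 - p) * A.
  rewrite -(ler_pM2l xp0).
  rewrite (_ : x * x `^ (p - 2) * (x / 2) = x ^+ 2 * x `^ (p - 2) / 2); last by ring.
  rewrite (_ : x * x `^ (p - 2) * ((2 * Y) `^ (2 - p) * A) =
    x `^ (p - 2) * (2 * Y) `^ (2 - p) * (A * x))//; last by ring.
have h4 : (2 * Y) `^ (2 - p) <= 2 * Y `^ (2 - p).
  rewrite powRM// ler_wpM2r ?powR_ge0// ler1_powR ?ler1n//.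
  by rewrite lerBlDr -lerBlDl (_ : 2 - 1 = 1) ?(ltW p1)//; ring.
have := ler_wpM2r A0 h4; lra.
Qed.

End absorption.

Section well_posed.
Context {R : realType} {d : nat}.
Local Notation V := 'rV[R]_d.
Local Notation mu := (lebesgue_rV R d).
Local Notation mu2 := (lebesgue_rV R d \x lebesgue_rV R d)%E.
Variables (Omega : set V) (p : R) (nu : V -> R).
Hypotheses (oO : open Omega) (bO : bounded_set Omega) (neO : Omega !=set0).
Hypothesis p1 : 1 < p.
Hypotheses (mnu : measurable_fun setT nu) (nu0 : forall h, 0 <= nu h)
  (nuN : forall h, nu (- h) = nu h).
Hypothesis poin : poincare p nu Omega.
Implicit Types (u v w : V -> R) (F G : (V -> R) -> R).

Let p0 : 0 < p. Proof. by apply: lt_trans p1. Qed.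
Let mO : measurable Omega. Proof. exact: open_measurable_rV. Qed.

Local Notation W := (W_space p nu Omega).
Local Notation Wp := (W_perp p nu Omega).
Local Notation wnorm := (wnorm Omega p nu).
Local Notation Dq := (dq Omega p nu).
Local Notation a_ u := (penergy mu p (u \_ Omega)).
Local Notation e_ u := (penergy mu2 p (Dq u)).
Local Notation WP := (W_spaceP p1 mO mnu nu0 nuN).
Local Notation dW := (dual_W_norm p nu Omega).
Local Notation dT := (dual_T_norm p nu Omega).
Local Notation L := (data_pairing Omega).

Definition functional_on (E : set (V -> R)) F :=
  forall (a : R) u v, E u -> E v -> F (fun x => a * u x + v x) = a * F u + F v.

Local Notation Wlin := (functional_on W).
Local Notation Tlin := (functional_on (T_space p nu Omega)).

Let W0 : W (fun=> 0). Proof. exact: W_cst. Qed.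

Lemma W_norm0 : W_norm p nu Omega (fun=> 0) = 0%E.
Proof.
have [-> w0 _ _ wle] := W_norm_real p1 mO mnu nu0 nuN W0.
have [_ _ a0 e0] := ae0_energy0 oO p1 mnu nu0 nuN (measurable_cst (0 : R))
  (aeW mu (fun=> fun=> erefl)).
rewrite a0 e0 addr0 in wle.
by have /eqP/powR_eq0_eq0 -> : wnorm (fun=> 0) `^ p == 0 by rewrite eq_le wle powR_ge0.
Qed.

Lemma T_norm_restrict v : W v ->
  (T_norm p nu Omega (v \_ (~` Omega)) <= W_norm p nu Omega v)%E.
Proof.
move=> Wv; apply: ereal_inf_lbound; exists v => //; split=> //.
exact: aeW.
Qed.

Lemma dual_W_ge0 F : (0 <= dW F)%E.
Proof.
apply: le_trans (ereal_sup_ubound _) => /=; last first.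
  by exists (fun=> 0) => //; split=> //; rewrite W_norm0.
by rewrite lee_fin.
Qed.

Lemma dual_T_ge0 G : (0 <= dT G)%E.
Proof.
apply: le_trans (ereal_sup_ubound _) => /=; last first.
  exists ((fun=> 0) \_ (~` Omega)) => //; split; first by exists (fun=> 0).
  by rewrite (le_trans (T_norm_restrict W0))// W_norm0.
by rewrite lee_fin.
Qed.

(** Passing to the trace does not increase the norm, so the data act on functions
    of the whole space with the sum of the dual norms. *)
Lemma data_bound F G : Wlin F -> Tlin G -> (dW F < +oo)%E -> (dT G < +oo)%E ->
  [/\ (dW F + dT G = (fine (dW F + dT G))%:E)%E, 0 <= fine (dW F + dT G) &
    forall v, W v -> `|L F G v| <= fine (dW F + dT G) * wnorm v].
Proof.
move=> Fl Gl Fy Gy.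
have Ff : dW F \is a fin_num by rewrite ge0_fin_numE// dual_W_ge0.
have Gf : dT G \is a fin_num by rewrite ge0_fin_numE// dual_T_ge0.
split; first by rewrite fineK// fin_numD Ff.
  by rewrite fine_ge0// adde_ge0 ?dual_W_ge0 ?dual_T_ge0.
move=> v Wv; rewrite fineD// mulrDl (le_trans (ler_normD _ _))// lerD//.
  apply: (linear_bound p1 mO mnu nu0 nuN Fy) => // w Ww w1.
  by apply: ereal_sup_ubound; exists w.
apply: (linear_bound p1 mO mnu nu0 nuN (H := fun v => G (v \_ (~` Omega))) Gy) => //.
  by move=> c u1 u2 W1 W2; rewrite restrict_lin Gl//; [exists u1|exists u2].
move=> w Ww w1; apply: ereal_sup_ubound; exists (w \_ (~` Omega)) => //; split.
  by exists w.
exact: le_trans (T_norm_restrict Ww) w1.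
Qed.

Lemma data_lin F G : Wlin F -> Tlin G -> Wlin (L F G).
Proof.
move=> Fl Gl a u v Wu Wv; rewrite /data_pairing Fl// restrict_lin Gl.
- by rewrite mulrDr addrACA.
- by exists u.
- by exists v.
Qed.

Lemma weak_eqP F G (E : set (V -> R)) w : E `<=` W -> W w ->
  weak_eq p nu Omega F G E w <-> forall v, E v -> ppair mu2 p (Dq w) (Dq v) = L F G v.
Proof.
move=> EW Ww; have [_ _ ew] := (WP w).1 Ww.
split=> h v Ev; have [_ _ ev] := (WP v).1 (EW _ Ev).
  by have := h v Ev; rewrite energy_pair// => -[].
by rewrite energy_pair// h.
Qed.

Lemma perp_subset : Wp `<=` W. Proof. by move=> u []. Qed.

Lemma dq_sub_mean u : Dq (fun x => u x - mean Omega u) = Dq u.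
Proof. exact: dqDcst. Qed.

Lemma perp_solution F G : Wlin F -> Tlin G -> (dW F < +oo)%E -> (dT G < +oo)%E ->
  exists2 u, Wp u & forall v, Wp v -> ppair mu2 p (Dq u) (Dq v) = L F G v.
Proof.
move=> Fl Gl Fy Gy; have [_ K0 Kb] := data_bound Fl Gl Fy Gy.
have [B B0 hB] := W_norm_energy oO p1 mnu nu0 nuN poin.
apply: (@euler_lagrange_exists _ _ _ mu2 p p1 _ Wp Dq (L F G) (fine (dW F + dT G) * B)).
- exact: W_perp0.
- by move=> a u v Wu Wv; exact: W_perp_lin.
- by move=> v [/WP[]].
- by move=> a u v; exact: dq_lin.
- by move=> a u v [Wu _] [Wv _]; exact: data_lin.
- by rewrite mulr_ge0// ltW.
- move=> v Wv; rewrite (le_trans (Kb _ (perp_subset Wv)))// -mulrA.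
  by rewrite ler_wpM2l// hB.
- by move=> v_ Wv cau; exact: W_perp_complete.
Qed.

(** Adding a constant to a test function changes neither its difference quotient nor,
    under the compatibility condition, the value of the data. *)
Lemma solves_VP F G w : Wlin F -> Tlin G -> W w ->
  solves_V p nu Omega F G w <-> L F G (cst 1) = 0 /\
    forall v, Wp v -> ppair mu2 p (Dq w) (Dq v) = L F G v.
Proof.
move=> Fl Gl Ww; have [_ _ ew] := (WP w).1 Ww.
have Ll := data_lin Fl Gl; have W1 : W (cst 1) by exact: W_cst.
have pc u (c : R) : W u -> ppair mu2 p (Dq w) (Dq (fun x => u x + c)) = ppair mu2 p (Dq w) (Dq u).
  by move=> Wu; rewrite dqDcst.
split.
- move=> [_ /(weak_eqP F G (fun _ h => h) Ww) h]; split; last by move=> v [Wv _]; exact: h.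
  rewrite -h//; have [_ _ e1] := (WP _).1 W1.
  rewrite (_ : Dq (cst 1) = fun z => 0 * Dq (cst 1) z).
    by rewrite ppairZ// mul0r.
  by apply/funext => z; rewrite mul0r /dq subrr mul0r.
- move=> [L1 h]; split=> //; apply/(weak_eqP F G (fun _ h => h) Ww) => v Wv.
  have Wpv := W_perp_mean oO bO neO p1 mnu nu0 nuN Wv.
  rewrite -(dq_sub_mean v) h//.
  have := Ll (- mean Omega v) _ _ W1 Wv; rewrite L1 mulr0 add0r => <-.
  by congr (L F G _); apply/funext => x /=; ring.
Qed.

Lemma Dq_diff u v : (fun z => Dq u z - Dq v z) =
  Dq (fun x => (u x - mean Omega u) - (v x - mean Omega v)).
Proof. by apply/funext => z; rewrite /dq; ring. Qed.

(** Subtracting mean values turns the difference of two solutions into an admissible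
    test function without changing its difference quotient. *)
Lemma pgap_data F1 G1 F2 G2 w1 w2 :
  Wlin F1 -> Tlin G1 -> Wlin F2 -> Tlin G2 -> W w1 -> W w2 ->
  (forall v, Wp v -> ppair mu2 p (Dq w1) (Dq v) = L F1 G1 v) ->
  (forall v, Wp v -> ppair mu2 p (Dq w2) (Dq v) = L F2 G2 v) ->
  pgap mu2 p (Dq w1) (Dq w2) =
  L (fun v => F1 v - F2 v) (fun v => G1 v - G2 v)
    (fun x => (w1 x - mean Omega w1) - (w2 x - mean Omega w2)).
Proof.
move=> F1l G1l F2l G2l W1 W2 h1 h2.
have Wpd : Wp (fun x => (w1 x - mean Omega w1) - (w2 x - mean Omega w2)).
  exact: (W_perpB oO bO p1 mnu nu0 nuN (W_perp_mean oO bO neO p1 mnu nu0 nuN W1)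
    (W_perp_mean oO bO neO p1 mnu nu0 nuN W2)).
set v := (fun x => _ - _) in Wpd *.
have E : pgap mu2 p (Dq w1) (Dq w2) =
    ppair mu2 p (Dq w1) (Dq v) - ppair mu2 p (Dq w2) (Dq v).
  exact: (f_equal (fun f => ppair mu2 p (Dq w1) f - ppair mu2 p (Dq w2) f)
    (Dq_diff w1 w2)).
apply: etrans E _.
apply: etrans (f_equal2 (fun a b => a - b) (h1 v Wpd) (h2 v Wpd)) _.
by rewrite /data_pairing opprD addrACA.
Qed.

(** The gap of two solutions with the same data vanishes, hence so do the energy of
    their difference and, by the Poincare inequality, its restriction to [Omega]. *)
Lemma perp_unique F G u1 u2 : Wlin F -> Tlin G ->
  {ae mu, forall x, (nu_hull nu Omega `\` Omega) x -> 0 < tilde_weight nu Omega x} ->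
  Wp u1 -> Wp u2 ->
  (forall v, Wp v -> ppair mu2 p (Dq u1) (Dq v) = L F G v) ->
  (forall v, Wp v -> ppair mu2 p (Dq u2) (Dq v) = L F G v) ->
  W_eq nu Omega u1 u2.
Proof.
move=> Fl Gl tw Wu1 Wu2 h1 h2; have [W1 _] := Wu1; have [W2 _] := Wu2.
have [_ _ e1] := (WP _).1 W1; have [_ _ e2] := (WP _).1 W2.
have Wd := W_perpB oO bO p1 mnu nu0 nuN Wu1 Wu2.
have [md ld ed] := (WP _).1 Wd.1.
have e0 : e_ (fun x => u1 x - u2 x) = 0.
  rewrite dqB; apply: pgap_eq0 => //.
  by rewrite /pgap -dqB h1// h2// subrr.
have [CP CP0 hCP] := poincare_energy oO p1 mnu nu0 nuN poin.
have a0 : a_ (fun x => u1 x - u2 x) = 0.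
  by apply/eqP; rewrite eq_le penergy_ge0 andbT (le_trans (hCP _ Wd))// e0 mulr0.
have := energy0_ae0 oO p1 mnu nu0 nuN tw md ld ed a0 e0.
by apply: filterS => x hx Hx; apply/eqP; rewrite -subr_eq0 hx.
Qed.

Lemma ppair_W_eq u1 u2 v : W u1 -> W u2 -> W v -> W_eq nu Omega u1 u2 ->
  ppair mu2 p (Dq u1) (Dq v) = ppair mu2 p (Dq u2) (Dq v).
Proof.
move=> W1 W2 Wv /W_eq_sub E12.
have [_ _ e1] := (WP _).1 W1; have [_ _ e2] := (WP _).1 W2; have [_ _ ev] := (WP _).1 Wv.
have Wd := W_B p1 mO mnu nu0 nuN W1 W2; have [md _ ed] := (WP _).1 Wd.
have [_ _ _ e0] := ae0_energy0 oO p1 mnu nu0 nuN md E12.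
have ae0 := penergy_eq0 ed e0.
congr fine; apply: ae_eq_integral => //.
- exact: measurable_int (integrable_psi p1 e1 ev).
- exact: measurable_int (integrable_psi p1 e2 ev).
- apply: filterS ae0 => z + _; rewrite dqB => /eqP.
  by rewrite subr_eq0 => /eqP ->.
Qed.

Lemma well_posedness F G :
  {ae mu, forall x, (nu_hull nu Omega `\` Omega) x -> 0 < tilde_weight nu Omega x} ->
  in_dual_W p nu Omega F -> in_dual_T p nu Omega G ->
  exists u, [/\ solves_V_perp p nu Omega F G u,
    forall u', solves_V_perp p nu Omega F G u' -> W_eq nu Omega u' u,
    (exists w, solves_V p nu Omega F G w) <-> L F G (cst 1) = 0 &
    forall w, W w -> (solves_V p nu Omega F G w <->
      L F G (cst 1) = 0 /\ exists c : R, W_eq nu Omega w (fun x => u x + c))].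
Proof.
move=> tw [Fl _ Fy] [Gl _ Gy].
have [u Wu hu] := perp_solution Fl Gl Fy Gy.
have [Wu0 _] := Wu.
have char w : W w -> (solves_V p nu Omega F G w <->
    L F G (cst 1) = 0 /\ exists c : R, W_eq nu Omega w (fun x => u x + c)).
  move=> Ww; split.
    move=> /(solves_VP Fl Gl Ww)[L1 hw]; split=> //; exists (mean Omega w).
    have := perp_unique Fl Gl tw (W_perp_mean oO bO neO p1 mnu nu0 nuN Ww) Wu _ hu.
    rewrite dq_sub_mean => /(_ hw); apply: filterS => x hx Hx.
    by rewrite -hx// subrK.
  move=> [L1 [c wc]]; apply/(solves_VP Fl Gl Ww); split=> [|v Wv]; first exact: L1.
  have Wuc : W (fun x => u x + c).
    by have := W_subr_cst oO bO p1 mnu nu0 nuN (- c) Wu0; rewrite opprK.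
  apply: etrans (ppair_W_eq Ww Wuc (perp_subset Wv) wc) _.
  by rewrite dqDcst; exact: hu.
exists u; split; last exact: char.
- by split; [exact: Wu|apply/(weak_eqP F G perp_subset Wu0)].
- move=> u' [Wu' hu']; apply: (perp_unique Fl Gl tw Wu' Wu _ hu).
  by apply/(weak_eqP F G perp_subset (perp_subset Wu')).
- split=> [[w Vw]|L1]; first by have [Ww _] := Vw; have [] := (char w Ww).1 Vw.
  by exists u; apply/(solves_VP Fl Gl Wu0).
Qed.

Lemma solution_bounds : exists2 B : R, 0 < B & forall F G w,
  Wlin F -> Tlin G -> (dW F < +oo)%E -> (dT G < +oo)%E ->
  solves_V p nu Omega F G w ->
  e_ w `^ p^-1 <= B * fine (dW F + dT G) `^ (p - 1)^-1 /\
  wnorm (fun x => w x - mean Omega w) <= B * fine (dW F + dT G) `^ (p - 1)^-1.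
Proof.
have [B B0 hB] := W_norm_energy oO p1 mnu nu0 nuN poin.
pose B1 := B `^ (p - 1)^-1.
have B10 : 0 < B1 by rewrite powR_gt0.
exists ((1 + B) * B1); first by rewrite mulr_gt0// addr_gt0.
move=> F G w Fl Gl Fy Gy Vw; have [Ww _] := Vw.
have [_ K0 Kb] := data_bound Fl Gl Fy Gy.
have [_ hw] := (solves_VP Fl Gl Ww).1 Vw.
set K := fine _ in K0 Kb *.
have Wpw := W_perp_mean oO bO neO p1 mnu nu0 nuN Ww.
have nw := hB _ Wpw; rewrite dq_sub_mean in nw.
set x := e_ w `^ p^-1 in nw *.
have x0 : 0 <= x by exact: powR_ge0.
have xp : x `^ p = e_ w by rewrite powRK// penergy_ge0.
have xK : x <= B1 * K `^ (p - 1)^-1.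
  rewrite -powRM ?(ltW B0)//; apply: powR_absorb => //.
    by rewrite mulr_ge0// ltW.
  rewrite xp -(ppair_self mu2 p1) -{2}dq_sub_mean hw//.
  rewrite (le_trans (ler_norm _))// (le_trans (Kb _ (perp_subset Wpw)))//.
  by rewrite [B * K]mulrC -mulrA ler_wpM2l.
have X0 : 0 <= B1 * K `^ (p - 1)^-1 := le_trans x0 xK.
split.
  by rewrite -mulrA mulrDl mul1r (le_trans xK)// lerDl mulr_ge0// ltW.
rewrite (le_trans nw)// -mulrA mulrDl mul1r.
apply: (@le_trans _ _ (B * (B1 * K `^ (p - 1)^-1))); first by rewrite ler_pM2l.
by rewrite lerDr.
Qed.

Lemma functionalB (E : set (V -> R)) F1 F2 : functional_on E F1 -> functional_on E F2 ->
  functional_on E (fun v => F1 v - F2 v).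
Proof. by move=> l1 l2 a u v Eu Ev; rewrite l1// l2// mulrBr opprD addrACA. Qed.

Lemma dual_normB (E : set (V -> R)) N F1 F2 :
  (dual_norm E N F1 < +oo)%E -> (dual_norm E N F2 < +oo)%E ->
  (dual_norm E N (fun v => F1 v - F2 v)%R < +oo)%E.
Proof.
move=> y1 y2; apply: le_lt_trans (lte_add_pinfty y1 y2).
apply: ge_ereal_sup => _ [v [Ev Nv] <-].
apply: (@le_trans _ _ (`|F1 v|%:E + `|F2 v|%:E)%E).
  by rewrite -EFinD lee_fin ler_normB.
by apply: leeD; apply: ereal_sup_ubound; exists v.
Qed.

Lemma stability_ge2 : 2 <= p -> exists2 C : R, 0 < C & forall F1 F2 G1 G2 w1 w2,
  in_dual_W p nu Omega F1 -> in_dual_W p nu Omega F2 ->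
  in_dual_T p nu Omega G1 -> in_dual_T p nu Omega G2 ->
  solves_V p nu Omega F1 G1 w1 -> solves_V p nu Omega F2 G2 w2 ->
  wnorm (fun x => (w1 x - mean Omega w1) - (w2 x - mean Omega w2)) <=
  C * fine (dW (fun v => F1 v - F2 v)%R + dT (fun v => G1 v - G2 v)%R) `^ (p - 1)^-1.
Proof.
move=> p2; have [B B0 hB] := W_norm_energy oO p1 mnu nu0 nuN poin.
exists (B * (2 `^ p * B) `^ (p - 1)^-1); first by rewrite !(mulr_gt0, powR_gt0).
move=> F1 F2 G1 G2 w1 w2 [F1l _ F1y] [F2l _ F2y] [G1l _ G1y] [G2l _ G2y] V1 V2.
have [W1 _] := V1; have [W2 _] := V2.
have [_ h1] := (solves_VP F1l G1l W1).1 V1.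
have [_ h2] := (solves_VP F2l G2l W2).1 V2.
have [_ K0 Kb] := data_bound (functionalB F1l F2l) (functionalB G1l G2l)
  (dual_normB F1y F2y) (dual_normB G1y G2y).
set K := fine _ in K0 Kb *.
have Wpd : Wp (fun x => (w1 x - mean Omega w1) - (w2 x - mean Omega w2)).
  exact: (W_perpB oO bO p1 mnu nu0 nuN (W_perp_mean oO bO neO p1 mnu nu0 nuN W1)
    (W_perp_mean oO bO neO p1 mnu nu0 nuN W2)).
have nw := hB _ Wpd; have Kd := Kb _ (perp_subset Wpd).
have [_ _ e1] := (WP _).1 W1; have [_ _ e2] := (WP _).1 W2.
have gap := pgap_ge2 p1 p2 e1 e2.
rewrite (pgap_data F1l G1l F2l G2l W1 W2 h1 h2) (Dq_diff w1 w2) in gap.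
move: nw Kd gap; set v := (fun x => _ - _); move: (e_ v) (penergy_ge0 mu2 p (Dq v)) => e e0.
set x := e `^ p^-1 => nw Kd gap.
have x0 : 0 <= x by exact: powR_ge0.
have xp : x `^ p = e by rewrite powRK.
have xK : x <= (2 `^ p * B * K) `^ (p - 1)^-1.
  apply: powR_absorb => //; first by rewrite !mulr_ge0 ?powR_ge0// ltW.
  rewrite xp (le_trans gap)// -!mulrA ler_wpM2l ?powR_ge0//.
  rewrite (le_trans (ler_norm _))// (le_trans Kd)// [leRHS]mulrCA.
  by rewrite ler_wpM2l.
rewrite (le_trans nw)// -mulrA ler_wpM2l ?(ltW B0)// (le_trans xK)//.
by rewrite powRM// mulr_ge0 ?powR_ge0// ltW.
Qed.

(** The energies of the solutions, hence that of their difference, are at most [Y^p]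
    for a multiple [Y] of the sum of the norms of the data to the power 1/(p-1).
    The weight of the gap is thus controlled by [Y^(2-p)], which is the factor M. *)
Lemma stability_lt2 : p < 2 -> exists2 C : R, 0 < C & forall F1 F2 G1 G2 w1 w2,
  in_dual_W p nu Omega F1 -> in_dual_W p nu Omega F2 ->
  in_dual_T p nu Omega G1 -> in_dual_T p nu Omega G2 ->
  solves_V p nu Omega F1 G1 w1 -> solves_V p nu Omega F2 G2 w2 ->
  wnorm (fun x => (w1 x - mean Omega w1) - (w2 x - mean Omega w2)) <=
  C * (fine (dW F1 + dT G1) + fine (dW F2 + dT G2)) `^ ((2 - p) / (p - 1)) *
  fine (dW (fun v => F1 v - F2 v)%R + dT (fun v => G1 v - G2 v)%R).
Proof.
move=> p2; have [B B0 hB] := W_norm_energy oO p1 mnu nu0 nuN poin.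
have [B' B'0 hB'] := solution_bounds.
have q0 : 0 < p - 1 by rewrite subr_gt0.
pose k := 4 * B'; have k0 : 0 < k by rewrite mulr_gt0.
exists (B * (4 * ((p - 1)^-1 * B * k `^ (2 - p)))).
  by rewrite !(mulr_gt0, powR_gt0) ?invr_gt0.
move=> F1 F2 G1 G2 w1 w2 [F1l _ F1y] [F2l _ F2y] [G1l _ G1y] [G2l _ G2y] V1 V2.
have [W1 _] := V1; have [W2 _] := V2.
have [_ h1] := (solves_VP F1l G1l W1).1 V1.
have [_ h2] := (solves_VP F2l G2l W2).1 V2.
have [_ K0 Kb] := data_bound (functionalB F1l F2l) (functionalB G1l G2l)
  (dual_normB F1y F2y) (dual_normB G1y G2y).
have [E1 _] := hB' _ _ _ F1l G1l F1y G1y V1.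
have [E2 _] := hB' _ _ _ F2l G2l F2y G2y V2.
have [_ K10 _] := data_bound F1l G1l F1y G1y.
have [_ K20 _] := data_bound F2l G2l F2y G2y.
set K := fine (dW (fun v => F1 v - F2 v)%R + _) in K0 Kb *.
set K1 := fine _ in E1 K10 *; set K2 := fine _ in E2 K20 *.
have Wpd : Wp (fun x => (w1 x - mean Omega w1) - (w2 x - mean Omega w2)).
  exact: (W_perpB oO bO p1 mnu nu0 nuN (W_perp_mean oO bO neO p1 mnu nu0 nuN W1)
    (W_perp_mean oO bO neO p1 mnu nu0 nuN W2)).
have nw := hB _ Wpd; have Kd := Kb _ (perp_subset Wpd).
have [_ _ e1] := (WP _).1 W1; have [_ _ e2] := (WP _).1 W2.
have gap t (t0 : 0 < t) := pgap_lt2 p1 p2 t0 e1 e2.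
rewrite (pgap_data F1l G1l F2l G2l W1 W2 h1 h2) (Dq_diff w1 w2) in gap.
have crude : e_ (fun x => (w1 x - mean Omega w1) - (w2 x - mean Omega w2)) <=
    2 `^ p * (e_ w1 + e_ w2).
  by rewrite -(Dq_diff w1 w2); exact: penergyB_le.
move: nw Kd gap crude; set v := (fun x => _ - _).
move: (e_ v) (penergy_ge0 mu2 p (Dq v)) => e e0.
set x := e `^ p^-1 => nw Kd gap crude.
have x0 : 0 <= x by exact: powR_ge0.
have xp : x `^ p = e by rewrite powRK.
pose S := K1 + K2; have S0 : 0 <= S by rewrite addr_ge0.
pose Y := k * S `^ (p - 1)^-1.
have Y0 : 0 <= Y by rewrite mulr_ge0 ?powR_ge0// ltW.
(* the factor 4 in k absorbs one 2^p from the triangle inequality and, as 2 <= 2^p,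
   the sum of two energies *)
have EY : 2 `^ p * (e_ w1 + e_ w2) <= Y `^ p.
  have sub w K' : 0 <= K' -> K' <= S -> e_ w `^ p^-1 <= B' * K' `^ (p - 1)^-1 ->
      e_ w <= (B' * S `^ (p - 1)^-1) `^ p.
    move=> K'0 K'S h; rewrite -[leLHS](powRK p1 (penergy_ge0 mu2 p (Dq w))).
    apply: le_powR_l; [exact: ltW|exact: powR_ge0|].
    rewrite (le_trans h)// ler_wpM2l ?(ltW B'0)// le_powR_l// invr_ge0; exact: ltW.
  have s1 := sub w1 K1 K10 _ E1; rewrite lerDl in s1; have {}s1 := s1 K20.
  have s2 := sub w2 K2 K20 _ E2; rewrite lerDr in s2; have {}s2 := s2 K10.
  have BS : 0 <= B' * S `^ (p - 1)^-1 by rewrite mulr_ge0 ?powR_ge0// ltW.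
  have -> : Y `^ p = 2 `^ p * (2 `^ p * (B' * S `^ (p - 1)^-1) `^ p).
    rewrite -(powRM _ _ BS)// -powRM ?(mulr_ge0 _ BS)//.
    by congr (_ `^ _); rewrite /Y /k; ring.
  rewrite ler_wpM2l ?powR_ge0//.
  apply: (@le_trans _ _ (2 * (B' * S `^ (p - 1)^-1) `^ p)).
    by rewrite mulr_natl mulr2n; apply: lerD.
  by rewrite ler_wpM2r ?powR_ge0// le1r_powR ?ler1n// ltW.
have xK : x <= 4 * ((p - 1)^-1 * B * K * Y `^ (2 - p)).
  apply: powR_absorb_split => //.
  - by rewrite !mulr_ge0 ?invr_ge0// ltW.
  - by rewrite xp (le_trans crude).
  move=> t t0; rewrite xp (le_trans (gap _ t0))//; apply: lerD; last first.
    by rewrite -mulrA ler_wpM2l ?powR_ge0.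
  rewrite -mulrA ler_wpM2l ?powR_ge0// -!mulrA ler_wpM2l ?invr_ge0 ?(ltW q0)//.
  rewrite (le_trans (ler_norm _))// (le_trans Kd)// [leRHS]mulrCA.
  by rewrite ler_wpM2l.
rewrite (le_trans nw)// -!mulrA ler_wpM2l ?(ltW B0)// (le_trans xK)//.
rewrite /Y powRM ?powR_ge0 ?(ltW k0)// -powRrM -/S [(p - 1)^-1 * (2 - p)]mulrC.
rewrite le_eqVlt; apply/orP; left; apply/eqP; ring.
Qed.

End well_posed.

(** * Data given by functions *)

Section hoelder_restricted.
Context {R : realType} {dT} {T : measurableType dT} (m : {measure set T -> \bar R}).
Local Open Scope ereal_scope.

Lemma hoelder_in (A : set T) (f g : T -> R) (q p : R) : measurable A ->
  measurable_fun A f -> measurable_fun A g ->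
  (0 < q)%R -> (0 < p)%R -> (q^-1 + p^-1 = 1)%R ->
  \int[m]_(x in A) `|f x * g x|%:E <=
  (\int[m]_(x in A) (`|f x| `^ q)%:E) `^ q^-1 *
  (\int[m]_(x in A) (`|g x| `^ p)%:E) `^ p^-1.
Proof.
move=> mA mf mg q0 p0 qp.
have restr (h : T -> R) (r : R) : (0 < r)%R ->
    \int[m]_(x in A) (`|h x| `^ r)%:E = \int[m]_x `|(EFin \o (h \_ A)) x| `^ r.
  move=> r0; rewrite [LHS]integral_mkcond; apply: eq_integral => x _.
  by rewrite /= !patchE; case: ifP => _//=; rewrite normr0 powR0 ?gt_eqF.
have := @hoelder _ _ _ m (f \_ A) (g \_ A) q p _ _ q0 p0 qp.
rewrite unlock => H.
have := H ((measurable_restrictT _ mA).1 mf) ((measurable_restrictT _ mA).1 mg).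
rewrite -!restr// => H2; apply: le_trans H2.
rewrite invr1 poweRe1; last by apply: integral_ge0 => x _; exact: poweR_ge0.
rewrite [leLHS]integral_mkcond le_eqVlt; apply/orP; left; apply/eqP.
apply: eq_integral => x _; rewrite /= !patchE.
by case: ifP => _; rewrite ?mulr0 ?normr0 powRr1.
Qed.

End hoelder_restricted.

Section trace.
Context {R : realType} {d : nat}.
Local Notation V := 'rV[R]_d.
Local Notation mu := (lebesgue_rV R d).
Local Notation mu2 := (lebesgue_rV R d \x lebesgue_rV R d)%E.
Variables (Omega : set V) (p : R) (nu : V -> R).
Hypothesis p1 : 1 < p.
Hypothesis mO : measurable Omega.
Hypotheses (mnu : measurable_fun setT nu) (nu0 : forall h, 0 <= nu h)
  (nuN : forall h, nu (- h) = nu h).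
Implicit Types (u v w : V -> R).

Let p0 : 0 < p. Proof. by apply: lt_trans p1. Qed.

(** The trace inequality: if the weight is an average of an integrable part
    [kap] of the kernel over a subset of [Omega], then
    |u(y)|^p <= 2^p (|u(x) - u(y)|^p + |u(x)|^p) can be averaged over [x]. *)
Lemma trace_inequality (B : set V) (kap omega : V -> R) (C : R) :
  measurable B -> B `<=` Omega -> measurable_fun setT kap ->
  (forall h, 0 <= kap h <= nu h) -> (forall h, kap (- h) = kap h) ->
  (\int[mu]_h (kap h)%:E < +oo)%E ->
  measurable_fun setT omega -> (forall y, 0 <= omega y) -> 0 <= C ->
  (forall y, ~ Omega y -> ((omega y)%:E <= C%:E * \int[mu]_(x in B) (kap (x - y))%:E)%E) ->
  exists2 D : R, 0 < D & forall u, W_space p nu Omega u ->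
    (\int[mu]_(y in ~` Omega) (`|u y| `^ p * omega y)%:E <=
      (D * wnorm Omega p nu u `^ p)%:E)%E.
Proof.
move=> mB BO mkap kap0 kapN kapy momega omega0 C0 omegaC.
have k0 h : 0 <= kap h by have /andP[] := kap0 h.
have kn h : kap h <= nu h by have /andP[] := kap0 h.
pose I := fine (\int[mu]_h (kap h)%:E).
have IE : (\int[mu]_h (kap h)%:E = I%:E)%E.
  by rewrite fineK// ge0_fin_numE// integral_ge0// => h _; rewrite lee_fin.
have I0 : 0 <= I by apply: fine_ge0; apply: integral_ge0 => h _; rewrite lee_fin.
exists (C * (2 `^ p * (1 + I)) + 1).
  by rewrite ltr_wpDl// !mulr_ge0 ?powR_ge0// addr_ge0.
move=> u Wu; have [mu_ _ _] := Wu.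
have mOc : measurable (~` Omega) by exact: measurableC.
have mdiff (k : V -> R) : measurable_fun setT k -> measurable_fun setT (fun z : V * V => k (z.1 - z.2)).
  by move=> mk; exact: (measurableT_comp mk measurable_rVB).
have mpow1 : measurable_fun setT (fun z : V * V => `|u z.1| `^ p).
  by apply: measurable_fun_powR_norm; exact: (measurableT_comp mu_).
have mpow2 : measurable_fun setT (fun z : V * V => `|u z.2| `^ p).
  by apply: measurable_fun_powR_norm; exact: (measurableT_comp mu_).
pose X (z : V * V) := (`|u z.2| `^ p * kap (z.1 - z.2))%:E.
pose Y (z : V * V) := (`|u z.1 - u z.2| `^ p * nu (z.1 - z.2))%:E.
pose Z (z : V * V) := (`|u z.1| `^ p * kap (z.1 - z.2))%:E.
have mX : measurable_fun setT X.
  by apply/measurable_EFinP; apply: measurable_funM => //; exact: mdiff.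
have mZ : measurable_fun setT Z.
  by apply/measurable_EFinP; apply: measurable_funM => //; exact: mdiff.
have mY : measurable_fun setT Y.
  apply/measurable_EFinP; apply: measurable_funM; last exact: mdiff.
  apply: measurable_fun_powR_norm.
  by apply: measurable_funB; apply: (measurableT_comp mu_).
have X0 z : (0 <= X z)%E by rewrite lee_fin mulr_ge0// powR_ge0.
have Y0 z : (0 <= Y z)%E by rewrite lee_fin mulr_ge0// powR_ge0.
have Z0 z : (0 <= Z z)%E by rewrite lee_fin mulr_ge0// powR_ge0.
have mS : measurable (B `*` ~` Omega) by exact: measurableX.
have mOT : measurable (Omega `*` (setT : set V)) by exact: measurableX.
have SO : B `*` ~` Omega `<=` Omega `*` setT by move=> z [Bz _]; split=> //; exact: BO.
have stepX : (\int[mu]_(y in ~` Omega) (`|u y| `^ p * omega y)%:E <=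
    C%:E * \int[mu2]_(z in B `*` ~` Omega) X z)%E.
  rewrite (tonelli_in2 mu mu mX X0 mB mOc).
  have mI : measurable_fun setT (fun y => \int[mu]_(x in B) X (x, y))%E.
    have mXr : measurable_fun setT (X \_ (B `*` setT)).
      apply/(measurable_restrictT _ _).1; first exact: measurableX.
      by apply: measurable_funTS; exact: mX.
    have Xr0 z : (0 <= (X \_ (B `*` setT)) z)%E by rewrite patchE; case: ifP.
    have := measurable_fun_fubini_tonelli_G (m1 := mu) _ mXr Xr0.
    congr (measurable_fun _ _); apply/funext => y.
    rewrite /fubini_G [RHS]integral_mkcond; apply: eq_integral => x _.
    by rewrite !patchE in_setX/= in_setT andbT.
  rewrite -ge0_integralZl//; last 2 first.
  - by apply: measurable_funTS.
  - by move=> y _; apply: integral_ge0 => x _; exact: (X0 (x, y)).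
  apply: ge0_le_integral => //.
  - by move=> y _; rewrite lee_fin mulr_ge0// powR_ge0.
  - apply/measurable_EFinP; apply: measurable_funTS; apply: measurable_funM => //.
    exact: measurable_fun_powR_norm.
  - by apply: measurable_funTS; apply: measurable_funeM.
  - move=> y nOy; rewrite EFinM.
    apply: (@le_trans _ _ ((`|u y| `^ p)%:E * (C%:E * \int[mu]_(x in B) (kap (x - y))%:E))%E).
      by apply: lee_wpmul2l; [rewrite lee_fin powR_ge0|exact: omegaC].
    rewrite muleCA lee_wpmul2l ?lee_fin// -ge0_integralZl//.
    + apply/measurable_EFinP; apply: measurable_funTS.
      exact: (measurableT_comp (mdiff _ mkap) (pair2_measurable y)).
    + by move=> x _; rewrite lee_fin.
have stepYZ : (\int[mu2]_(z in B `*` ~` Omega) X z <=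
    (2 `^ p)%:E * (\int[mu2]_(z in Omega `*` setT) Y z + \int[mu2]_(z in Omega `*` setT) Z z))%E.
  rewrite -ge0_integralD//; [|exact: measurable_funTS..].
  rewrite -ge0_integralZl//; last 2 first.
  - by apply: emeasurable_funD; exact: measurable_funTS.
  - by move=> z _; rewrite adde_ge0.
  have mYZ : measurable_fun setT (fun z => (2 `^ p)%:E * (Y z + Z z))%E.
    by apply: measurable_funeM; exact: emeasurable_funD.
  have YZ0 z : (0 <= (2 `^ p)%:E * (Y z + Z z))%E.
    by rewrite mule_ge0 ?adde_ge0// lee_fin powR_ge0.
  apply: (@le_trans _ _ (\int[mu2]_(z in B `*` ~` Omega) ((2 `^ p)%:E * (Y z + Z z)))%E).
    apply: ge0_le_integral => //; [exact: measurable_funTS|exact: measurable_funTS|].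
    move=> z _; rewrite /X /Y /Z -EFinD -EFinM lee_fin.
    rewrite (@le_trans _ _ (2 `^ p * (`|u z.1 - u z.2| `^ p + `|u z.1| `^ p) * kap (z.1 - z.2)))//.
      rewrite ler_wpM2r//; have := powR_normD p1 (u z.2 - u z.1) (u z.1).
      by rewrite subrK distrC.
    rewrite -mulrA ler_wpM2l ?powR_ge0// mulrDl lerD2r ler_wpM2l ?powR_ge0//.
  by apply: ge0_subset_integral => //; exact: measurable_funTS.
have EY : (\int[mu2]_(z in Omega `*` setT) Y z = gagliardo p nu Omega setT u)%E.
  exact: (tonelli_in1 mu mu mY Y0 mO measurableT).
have EZ : (\int[mu2]_(z in Omega `*` setT) Z z = I%:E * Lp_int p Omega u)%E.
  rewrite (tonelli_in1 mu mu mZ Z0 mO measurableT) /Lp_int -ge0_integralZl//; last first.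
    by apply/measurable_EFinP; apply: measurable_funTS; exact: measurable_fun_powR_norm.
  apply: eq_integral => x _; rewrite /Z/= muleC.
  under eq_integral do rewrite EFinM.
  have mk : measurable_fun setT (fun y : V => (kap (x - y))%:E).
    apply/measurable_EFinP.
    exact: (measurableT_comp (mdiff _ mkap) (pair1_measurable x)).
  rewrite ge0_integralZl//; last by move=> y _; rewrite lee_fin.
  congr (_ * _)%E; rewrite -IE.
  have mkE : measurable_fun setT (EFin \o kap) by exact/measurable_EFinP.
  rewrite -(ge0_integral_shift (- x) mkE)//.
  by apply: eq_integral => y _; rewrite /= -kapN opprB.
have [g [gE g0 _ _]] := gagliardo_real p1 mO mnu nu0 nuN Wu.
have LE := Lp_int_real p1 mO mnu nu0 nuN Wu.
set a := penergy mu p (u \_ Omega) in LE.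
have a0 : 0 <= a by exact: penergy_ge0.
have wE : wnorm Omega p nu u `^ p = a + g.
  rewrite /wnorm /W_norm LE gE -EFinD poweR_EFin/= -powRrM mulVf ?gt_eqF//.
  by rewrite powRr1// addr_ge0.
rewrite EY EZ gE LE -EFinM in stepYZ.
apply: (le_trans stepX).
apply: (@le_trans _ _ (C%:E * (2 `^ p * (g + I * a))%:E)%E).
  by rewrite lee_wpmul2l ?lee_fin.
rewrite -EFinM lee_fin wE mulrDl mul1r -[leLHS]addr0 lerD ?addr_ge0//.
rewrite -!mulrA ler_wpM2l// ler_wpM2l ?powR_ge0//.
rewrite mulrDl mul1r mulrDr; apply: lerD; first by rewrite lerDr.
by rewrite lerDl mulr_ge0.
Qed.

End trace.

(** * The three weights *)

Section weights.
Context {R : realType} {d : nat}.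
Local Notation V := 'rV[R]_d.
Local Notation mu := (lebesgue_rV R d).
Variables (Omega : set V) (p : R) (nu : V -> R).
Hypothesis d0 : (0 < d)%N.
Hypotheses (oO : open Omega) (bO : bounded_set Omega) (neO : Omega !=set0).
Hypothesis p1 : 1 < p.
Hypothesis levy : levy_kernel p nu.
Implicit Types (u v w omega : V -> R).

Let p0 : 0 < p. Proof. by apply: lt_trans p1. Qed.
Let mO : measurable Omega. Proof. exact: open_measurable_rV. Qed.
Let mnu : measurable_fun setT nu. Proof. by have [] := levy. Qed.
Let nu0 h : 0 <= nu h. Proof. by have [_ + _ _] := levy. Qed.
Let nuN h : nu (- h) = nu h. Proof. by have [_ _ + _] := levy. Qed.

Let mdiff (k : V -> R) : measurable_fun setT k ->
  measurable_fun setT (fun z : V * V => k (z.1 - z.2)).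
Proof. by move=> mk; exact: (measurableT_comp mk measurable_rVB). Qed.

Definition levy_part (h : V) : R := Num.min 1 (enorm h `^ p) * nu h.

Let min1_ge0 (x : R) : 0 <= x -> 0 <= Num.min 1 x.
Proof. by move=> x0; rewrite le_min ler01. Qed.

Lemma levy_part_ge0 h : 0 <= levy_part h.
Proof. by rewrite mulr_ge0// min1_ge0// powR_ge0. Qed.

Lemma levy_part_le h : levy_part h <= nu h.
Proof. by rewrite ler_piMl// ge_min lexx. Qed.

Lemma levy_partN h : levy_part (- h) = levy_part h.
Proof. by rewrite /levy_part enormN nuN. Qed.

Lemma measurable_levy_part : measurable_fun setT levy_part.
Proof.
apply: measurable_funM => //; apply: measurable_minr => //.
exact: (measurableT_comp (measurable_powR p) measurable_enorm).
Qed.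

Lemma levy_part_lty : (\int[mu]_h (levy_part h)%:E < +oo)%E.
Proof. by have [] := levy. Qed.

Lemma measurable_min1_nu : measurable_fun setT (fun h => Num.min 1 (nu h)).
Proof. exact: measurable_minr. Qed.

(** Near the origin the truncated kernel is at most 1, elsewhere at most the
    integrable part. *)
Lemma min1_nu_lty : (\int[mu]_h (Num.min 1 (nu h))%:E < +oo)%E.
Proof.
pose B := [set h : V | enorm h < 1].
have mB : measurable B.
  rewrite (_ : B = @enorm R d @^-1` `]-oo, 1[); last first.
    by apply/seteqP; split => h /=; rewrite in_itv.
  by rewrite -[X in measurable X]setTI; apply: measurable_enorm.
have bB : (mu B < +oo)%E.
  apply: bounded_lebesgue_lty => //; exists 1; split=> // x x1 h /= h1.
  by rewrite (le_trans (ler_norm_enorm h))// ltW// (lt_trans h1).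
have i1 : (\int[mu]_h (\1_B h)%:E < +oo)%E by rewrite integral_indic// setIT.
have m1 : measurable_fun setT (fun h => (\1_B h)%:E : \bar R).
  by apply/measurable_EFinP; exact: measurable_indic.
have m2 : measurable_fun setT (fun h => (levy_part h)%:E).
  by apply/measurable_EFinP; exact: measurable_levy_part.
apply: (@le_lt_trans _ _ (\int[mu]_h ((\1_B h)%:E + (levy_part h)%:E))%E).
  apply: ge0_le_integral => //.
  - by move=> h _; rewrite lee_fin min1_ge0.
  - by apply/measurable_EFinP; exact: measurable_min1_nu.
  - exact: emeasurable_funD.
  - move=> h _; rewrite -EFinD lee_fin indicE.
    have [h1|h1] := ltP (enorm h) 1.
      rewrite mem_set// (@le_trans _ _ 1)//; first by rewrite ge_min lexx.
      by rewrite lerDl levy_part_ge0.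
    rewrite memNset; last by rewrite /B/= ltNge h1.
    rewrite add0r /levy_part (_ : Num.min 1 (enorm h `^ p) = 1).
      by rewrite mul1r ge_min lexx orbT.
    apply/min_idPl; have -> : 1 = 1 `^ p :> R by rewrite powR1.
    by apply: le_powR_l; [exact: ltW|exact: ler01|].
rewrite ge0_integralD//.
- by rewrite lte_add_pinfty// levy_part_lty.
- by move=> h _; rewrite lee_fin levy_part_ge0.
Qed.

Definition traceable omega := exists2 D : R, 0 < D & forall u, W_space p nu Omega u ->
    (\int[mu]_(y in ~` Omega) (`|u y| `^ p * omega y)%:E <=
      (D * wnorm Omega p nu u `^ p)%:E)%E.

Lemma tilde_weightE y : (tilde_weight nu Omega y)%:E =
  (\int[mu]_(x in Omega) (Num.min 1 (nu (x - y)))%:E)%E.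
Proof.
rewrite /tilde_weight /Rintegral.
have -> : (\int[mu]_(x in Omega) (Num.min 1 (nu (y - x)))%:E =
    \int[mu]_(x in Omega) (Num.min 1 (nu (x - y)))%:E)%E.
  by apply: eq_integral => x _; rewrite -nuN opprB.
rewrite fineK// ge0_fin_numE; last first.
  by apply: integral_ge0 => x _; rewrite lee_fin min1_ge0.
apply: (@le_lt_trans _ _ (\int[mu]_(x in Omega) (cst 1%E x))%E).
  apply: ge0_le_integral => //.
  - by move=> x _; rewrite lee_fin min1_ge0.
  - apply/measurable_EFinP; apply: measurable_funTS.
    exact: (measurableT_comp (mdiff measurable_min1_nu) (pair2_measurable y)).
  - by move=> x _; rewrite lee_fin ge_min lexx.
rewrite (integral_cst mu mO) mul1e; exact: bounded_lebesgue_lty.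
Qed.

Lemma measurable_tilde : measurable_fun setT (tilde_weight nu Omega).
Proof.
apply/measurable_EFinP.
have mF : measurable_fun setT
    ((fun z : V * V => (Num.min 1 (nu (z.1 - z.2)))%:E) \_ (Omega `*` setT)).
  apply/(measurable_restrictT _ _).1; first exact: measurableX.
  by apply: measurable_funTS; apply/measurable_EFinP; exact: (mdiff measurable_min1_nu).
have F0 z : (0 <= ((fun z : V * V => (Num.min 1 (nu (z.1 - z.2)))%:E) \_ (Omega `*` setT)) z)%E.
  by rewrite patchE; case: ifP => // _; rewrite lee_fin min1_ge0.
have := measurable_fun_fubini_tonelli_G (m1 := mu) _ mF F0.
congr (measurable_fun _ _); apply/funext => y; rewrite /= tilde_weightE.
rewrite /fubini_G [RHS]integral_mkcond; apply: eq_integral => x _.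
by rewrite !patchE in_setX/= in_setT andbT.
Qed.

Lemma traceable_tilde : traceable (tilde_weight nu Omega).
Proof.
apply: (@trace_inequality _ _ Omega p nu p1 mO mnu nu0 nuN Omega
  (fun h => Num.min 1 (nu h)) _ 1) => //.
- exact: measurable_min1_nu.
- by move=> h; rewrite min1_ge0//= ge_min lexx orbT.
- by move=> h; rewrite nuN.
- exact: min1_nu_lty.
- exact: measurable_tilde.
- by move=> y; apply: Rintegral_ge0 => x _; exact: min1_ge0.
- by move=> y _; rewrite tilde_weightE mul1e.
Qed.

Lemma separated_ball (U : set V) : open U -> U !=set0 -> U `<=` Omega ->
  exists B : set V, [/\ measurable B, B `<=` U, (0 < mu B)%E, (mu B < +oo)%E &
    exists2 r : R, 0 < r & forall x y, B x -> ~ U y -> r <= enorm (x - y)].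
Proof.
move=> oU [x0 Ux0] UO.
have /nbhs_ballP[e /= e0 eU] : nbhs x0 U by exact: open_nbhs_nbhs.
have e2 : 0 < e / 2 by rewrite divr_gt0.
have BU : ball x0 (e / 2) `<=` U.
  by move=> x Bx; apply: eU; apply: le_ball Bx; rewrite ler_pdivrMr//; lra.
have mB : measurable (ball x0 (e / 2)).
  by apply: open_measurable_rV; exact: ball_open.
exists (ball x0 (e / 2)); split=> //.
- apply: lebesgue_open_gt0; first exact: ball_open.
  by exists x0; exact: ballxx.
- apply: le_lt_trans (bounded_lebesgue_lty mO bO).
  by apply: le_measure; rewrite ?inE//; exact: subset_trans UO.
exists (e / 2) => // x y; rewrite -ball_normE/= => Bx nUy.
rewrite (le_trans _ (ler_norm_enorm _))// leNgt; apply/negP => xy; apply: nUy.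
apply: eU; rewrite -ball_normE/= (splitr e).
by rewrite (le_lt_trans (ler_distD x _ _))// ltrD.
Qed.

(** On a smaller set [B] at positive distance [r] from the complement of [U] the
    kernel is at most [1 / min(1, r^p)] times its integrable part; averaging the
    domination of the weight over [B] gives the hypothesis of the trace inequality. *)
Lemma traceable_dominated (U : set V) (K : R) omega :
  open U -> U !=set0 -> U `<=` Omega -> 0 < K ->
  measurable_fun setT omega -> (forall y, 0 <= omega y) ->
  (forall y, ~ Omega y -> {ae mu, forall x, U x -> omega y <= K * nu (x - y)}) ->
  traceable omega.
Proof.
move=> oU neU UO K0 momega omega0 omegaK.
have [B [mB BU B0 By [r r0 sep]]] := separated_ball oU neU UO.
have [b [b0 BE]] : exists b : R, 0 < b /\ mu B = b%:E.
  have E : mu B = (fine (mu B))%:E by rewrite fineK// ge0_fin_numE.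
  by exists (fine (mu B)); split=> //; rewrite -lte_fin -E.
pose c := Num.min 1 (r `^ p).
have c0 : 0 < c by rewrite lt_min ltr01 powR_gt0.
have mk y : measurable_fun B (fun x => (levy_part (x - y))%:E).
  apply/measurable_EFinP; apply: measurable_funTS.
  exact: (measurableT_comp (mdiff measurable_levy_part) (pair2_measurable y)).
apply: (@trace_inequality _ _ Omega p nu p1 mO mnu nu0 nuN B levy_part _
  (b^-1 * (K / c))) => //.
- exact: subset_trans UO.
- exact: measurable_levy_part.
- by move=> h; rewrite levy_part_ge0 levy_part_le.
- exact: levy_partN.
- exact: levy_part_lty.
- by rewrite !mulr_ge0 ?invr_ge0// ltW.
move=> y nOy.
have h1 : (\int[mu]_(x in B) (omega y)%:E <= \int[mu]_(x in B) ((K / c)%:E * (levy_part (x - y))%:E))%E.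
  apply: ae_ge0_le_integral => //.
  - by move=> x _; rewrite lee_fin.
  - by move=> x _; rewrite -EFinM lee_fin mulr_ge0 ?levy_part_ge0// divr_ge0// ltW.
  - by apply: measurable_funeM.
  - apply: filterS (omegaK y nOy) => x hx Bx.
    rewrite -EFinM lee_fin (le_trans (hx (BU _ Bx)))//.
    rewrite -mulrA ler_pM2l// ler_pdivlMl// /levy_part ler_wpM2r//.
    rewrite le_min ge_min lexx/= ge_min; apply/orP; right.
    apply: le_powR_l; [exact: ltW|exact: ltW|].
    by apply: sep => // /UO.
have KcE : (0 <= (K / c)%:E)%E by rewrite lee_fin divr_ge0// ltW.
have i0 : (0 <= \int[mu]_(x in B) (levy_part (x - y))%:E)%E.
  by apply: integral_ge0 => x _; rewrite lee_fin levy_part_ge0.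
rewrite ge0_integralZl// in h1; last by move=> x _; rewrite lee_fin levy_part_ge0.
rewrite (integral_cst mu mB (omega y)%:E) in h1.
rewrite EFinM -muleA; apply: le_trans (lee_wpmul2l _ h1); last first.
  by rewrite lee_fin invr_ge0 ltW.
have -> : ((omega y)%:E * mu B = (omega y * b)%:E)%E.
  by rewrite EFinM; congr (_ * _)%E; exact: BE.
by rewrite -EFinM lee_fin mulrCA mulVf ?mulr1// gt_eqF.
Qed.

(** The essential infimum over [y] is at least [a] exactly when the section of the set
    [nu (x - y) < a] is negligible, and the measure of sections is measurable. *)
Lemma measurable_bar : measurable_fun setT (bar_weight nu Omega).
Proof.
apply: (measurableT_comp (fine_measurable measurableT)).
move=> mT; apply: (measurability _ (ErealGenCInfty.measurableE R)) => //.
move=> _ [_ [a ->] <-].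
rewrite setTI.
pose A := [set z : V * V | Omega z.2 /\ nu (z.1 - z.2) < a].
have mA : measurable A.
  rewrite (_ : A = (setT `*` Omega) `&` ((fun z : V * V => nu (z.1 - z.2)) @^-1` `]-oo, a[)).
    apply: measurableI; first exact: measurableX.
    by rewrite -[X in measurable X]setTI; apply: (mdiff mnu).
  apply/seteqP; split => -[x y] /=; rewrite in_itv/=.
    by move=> [].
  by move=> [[_ ?] ?].
have mxA x : measurable (xsection A x) by exact: measurable_xsection.
rewrite (_ : _ @^-1` _ = (fun x => mu (xsection A x)) @^-1` [set 0%E]).
  rewrite -[X in measurable X]setTI.
  by apply: (measurable_fun_xsection mu mA) => //; exact: emeasurable_set1.
have xA x : ~` xsection A x =
    [set y | (a%:E <= (if y \in Omega then (nu (x - y))%:E else +oo))%E].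
  apply/seteqP; split => y /=; rewrite /xsection/= inE /A/=.
    case: ifPn => [/set_mem Oy nA|_ _]; last by rewrite leey.
    by rewrite lee_fin leNgt; apply/negP => h; apply: nA.
  by move=> + [Oy h]; rewrite mem_set// lee_fin leNgt h.
apply/seteqP; split => x /=; rewrite in_itv/= andbT.
  move=> /ess_infP [N [mN N0 HN]].
  apply/(subset_measure0 (mxA x) mN _ N0) => y Ay; apply: HN => /=.
  by have := xA x; move=> /seteqP[_ /(_ y)] h /h; apply.
move=> A0; apply/ess_infP; exists (xsection A x); split=> //.
by rewrite -[X in _ `<=` X]setCK; apply: subsetC; rewrite xA.
Qed.

Lemma bar_weight_ge0 x : 0 <= bar_weight nu Omega x.
Proof.
apply: fine_ge0; apply/ess_infP; apply: aeW => y.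
by case: ifP => _; rewrite ?lee_fin ?leey.
Qed.

Lemma bar_weight_le x : {ae mu, forall y, Omega y -> bar_weight nu Omega x <= nu (x - y)}.
Proof.
apply: filterS (ess_inf_le mu (fun y => if y \in Omega then (nu (x - y))%:E else +oo%E)).
move=> y; rewrite /bar_weight; case: (ess_inf _ _) => [b| |] h Oy //=.
by move: h; rewrite mem_set// lee_fin.
Qed.

Lemma traceable_bar : traceable (bar_weight nu Omega).
Proof.
apply: (traceable_dominated (U := Omega) (K := 1)) => //.
- exact: measurable_bar.
- exact: bar_weight_ge0.
- move=> y _; apply: filterS (bar_weight_le y) => x hx Ox.
  by rewrite mul1r -nuN opprB hx.
Qed.

Lemma enorm_le_norm (x : V) : enorm x <= Num.sqrt d%:R * `|x|.
Proof.
rewrite -(ler_pXn2r (n := 2))// ?nnegrE ?mulr_ge0 ?enorm_ge0//.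
rewrite sqr_enorm exprMn sqr_sqrtr//.
rewrite (_ : d%:R * `|x| ^+ 2 = \sum_(i < d) `|x| ^+ 2); last first.
  by rewrite sumr_const card_ord mulr_natl.
apply: ler_sum => i _; rewrite -real_normK ?num_real//.
by rewrite ler_pXn2r ?nnegrE// ler_coord_norm.
Qed.

Lemma open_enorm_lt (r : R) : open [set x : V | enorm x < r].
Proof.
rewrite openE => x /= xr; apply/nbhs_ballP.
pose s : R := Num.sqrt d%:R + 1.
have s0 : 0 < s by rewrite ltr_wpDl// sqrtr_ge0.
exists ((r - enorm x) / s) => /=; first by rewrite divr_gt0// subr_gt0.
move=> y; rewrite -ball_normE/= ltr_pdivlMr// => xy.
rewrite -(subrK x y) (le_lt_trans (ler_enormD _ _))// -ltrBrDr.
rewrite (le_lt_trans _ xy)// (le_trans (enorm_le_norm _))// mulrC distrC.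
by rewrite ler_wpM2l// lerDl.
Qed.

Lemma enorm_const (t : R) : 0 <= t ->
  enorm (const_mx (t / Num.sqrt d%:R) : V) = t.
Proof.
move=> t0; have d1 : 0 < d%:R :> R by rewrite ltr0n.
rewrite /enorm; under eq_bigr do rewrite mxE.
rewrite sumr_const card_ord expr_div_n sqr_sqrtr ?(ltW d1)//.
by rewrite -[X in Num.sqrt X]mulr_natl mulrCA mulfV ?gt_eqF// mulr1 sqrtr_sqr ger0_norm.
Qed.

Lemma measurable_hat (r : R) : measurable_fun setT (hat_weight nu r).
Proof.
apply: (measurableT_comp mnu); apply: measurable_fun_rVP => i.
under eq_fun do rewrite mxE.
apply: measurable_funM => //; apply: measurable_funM => //.
by apply: measurable_funD => //; exact: measurable_enorm.
Qed.

(** For [|x| < r] one has [|x - y| <= r + |y| <= r (1 + |y|)], so unimodality bounds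
    the weight at [y] by the kernel at [x - y]. *)
Lemma traceable_hat (r : R) : 1 < r ->
  (0 < mu ([set x | (enorm x < r)%R] `&` Omega))%E -> unimodal nu ->
  traceable (hat_weight nu r).
Proof.
move=> r1 r0 [_ [c c0 uni]]; have r00 : 0 < r by apply: lt_trans r1.
apply: (traceable_dominated (U := [set x | enorm x < r] `&` Omega) (K := c^-1)).
- by apply: openI => //; exact: open_enorm_lt.
- apply/set0P; apply: contraTN r0 => /eqP ->; by rewrite measure0 ltxx.
- by move=> x [].
- by rewrite invr_gt0.
- exact: measurable_hat.
- by move=> y; exact: nu0.
- move=> y nOy; apply: aeW => x [/= xr Ox].
  have t0 : 0 < r * (1 + enorm y) by rewrite mulr_gt0// ltr_wpDr// enorm_ge0.
  rewrite ler_pdivlMl// /hat_weight /profile; apply: uni.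
  + by rewrite subr_eq0; apply: contra_notN nOy => /eqP <-.
  + apply/eqP => /(congr1 (@enorm R d)); rewrite enorm_const ?(ltW t0)// => h.
    move: t0; rewrite h /enorm big1 ?sqrtr0 ?ltxx// => i _.
    by rewrite mxE expr0n.
  + rewrite enorm_const ?(ltW t0)// (le_trans (ler_enormD _ _))// enormN mulrDr mulr1.
    by rewrite lerD ?(ltW xr)// ler_peMl ?enorm_ge0// ltW.
Qed.

Lemma admissible_traceable omega : admissible_weight nu Omega omega ->
  [/\ measurable_fun setT omega, forall y, 0 <= omega y & traceable omega].
Proof.
case=> [->|->|[r [r1 r0 un ->]]].
- split; [exact: measurable_tilde| |exact: traceable_tilde].
  by move=> y; apply: Rintegral_ge0 => x _; exact: min1_ge0.
- by split; [exact: measurable_bar|exact: bar_weight_ge0|exact: traceable_bar].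
- by split; [exact: measurable_hat|move=> y; exact: nu0|exact: traceable_hat].
Qed.

End weights.

(** * Functionals given by densities *)

Section densities.
Context {R : realType} {d : nat}.
Local Notation V := 'rV[R]_d.
Local Notation mu := (lebesgue_rV R d).
Variables (Omega : set V) (p : R) (nu : V -> R).
Hypothesis oO : open Omega.
Hypothesis p1 : 1 < p.
Hypotheses (mnu : measurable_fun setT nu) (nu0 : forall h, 0 <= nu h)
  (nuN : forall h, nu (- h) = nu h).
Implicit Types (u v w f g : V -> R).

Let p0 : 0 < p. Proof. by apply: lt_trans p1. Qed.
Let q0 : 0 < p - 1. Proof. by rewrite subr_gt0. Qed.
Let mO : measurable Omega. Proof. exact: open_measurable_rV. Qed.
Let mOc : measurable (~` Omega). Proof. exact: measurableC. Qed.

Local Notation W := (W_space p nu Omega).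
Local Notation q := (conj_exp p).
Local Notation wnorm := (wnorm Omega p nu).

Let qp : q^-1 + p^-1 = 1.
Proof. by rewrite /conj_exp; field; rewrite !gt_eqF. Qed.

Let q_gt0 : 0 < q. Proof. by rewrite divr_gt0. Qed.

Lemma integral_bound (A : set V) f (S : \bar R) : measurable A -> measurable_fun A f ->
  (\int[mu]_(x in A) `|f x|%:E <= S)%E -> (S < +oo)%E ->
  mu.-integrable A (EFin \o f) /\ (`|\int[mu]_(x in A) f x|%:E <= S)%E.
Proof.
move=> mA mf fS Sy.
have i : mu.-integrable A (EFin \o f).
  apply/integrableP; split; first exact/measurable_EFinP.
  exact: le_lt_trans fS Sy.
split=> //; rewrite (EFin_normr_Rintegral mA i) (le_trans _ fS)//.
by apply: (le_trans (le_abse_integral mu mA (measurable_int mu i))).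
Qed.

Let W_meas v : W v -> measurable_fun setT v. Proof. by case. Qed.

Lemma interior_bound f v : in_Lp q Omega f -> W v ->
  (\int[mu]_(x in Omega) `|f x * v x|%:E <= Lp_norm q Omega f * (wnorm v)%:E)%E.
Proof.
move=> [mf fy] Wv.
apply: le_trans (hoelder_in mu mO mf (measurable_funTS (W_meas Wv)) q_gt0 p0 qp) _.
apply: lee_wpmul2l; first exact: poweR_ge0.
rewrite -/(Lp_int p Omega v) (Lp_int_real p1 mO mnu nu0 nuN Wv) poweR_EFin lee_fin.
have [_ w0 aw _ _] := W_norm_real p1 mO mnu nu0 nuN Wv.
rewrite -[leRHS](powRr1 w0) -(@mulfV _ p) ?gt_eqF// powRrM.
by apply: le_powR_l => //; [rewrite invr_ge0 ltW|exact: penergy_ge0].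
Qed.

Lemma Lp_norm_fin f : in_Lp q Omega f -> Lp_norm q Omega f \is a fin_num.
Proof.
move=> [_ fy]; rewrite /Lp_norm -(@fineK _ (Lp_int q Omega f)) ?poweR_EFin//.
by rewrite ge0_fin_numE//; apply: integral_ge0 => x _; rewrite lee_fin powR_ge0.
Qed.

Lemma interior_integrable f v : in_Lp q Omega f -> W v ->
  mu.-integrable Omega (EFin \o (fun x => f x * v x)) /\
  (`|interior_functional Omega f v|%:E <= Lp_norm q Omega f * (wnorm v)%:E)%E.
Proof.
move=> Lf Wv; have [mf _] := Lf; apply: integral_bound => //.
- by apply: measurable_funM => //; exact: measurable_funTS (W_meas Wv).
- exact: interior_bound.
- by rewrite ltey_eq fin_numM// Lp_norm_fin.
Qed.

Lemma interior_dual f : in_Lp q Omega f ->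
  in_dual_W p nu Omega (interior_functional Omega f) /\
  (dual_W_norm p nu Omega (interior_functional Omega f) <= Lp_norm q Omega f)%E.
Proof.
move=> Lf; have Nf := Lp_norm_fin Lf.
have bd : (dual_W_norm p nu Omega (interior_functional Omega f) <= Lp_norm q Omega f)%E.
  apply: ge_ereal_sup => _ [v [Wv v1] <-].
  have [_ h] := interior_integrable Lf Wv; apply: (le_trans h).
  have [wE _ _ _ _] := W_norm_real p1 mO mnu nu0 nuN Wv.
  rewrite wE in v1.
  by rewrite -[leRHS]mule1; apply: lee_wpmul2l => //; exact: poweR_ge0.
split; last exact: bd.
split.
- move=> a u v Wu Wv; rewrite /interior_functional.
  have [iu _] := interior_integrable Lf Wu; have [iv _] := interior_integrable Lf Wv.
  rewrite -(RintegralZl a mO iu) -(RintegralD mO (integrableZl mO a iu) iv).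
  by apply: eq_Rintegral => x _; ring.
- move=> u v Wu Wv uv; congr fine; have [mf _] := Lf.
  apply: ae_eq_integral => //.
  + by apply/measurable_EFinP; apply: measurable_funM => //; exact: measurable_funTS (W_meas Wu).
  + by apply/measurable_EFinP; apply: measurable_funM => //; exact: measurable_funTS (W_meas Wv).
  + by apply: filterS uv => x + Ox => ->//; left.
- by apply: le_lt_trans bd _; rewrite ltey_eq Nf.
Qed.

Section exterior.
Variables (omega : V -> R) (D : R).
Hypotheses (momega : measurable_fun setT omega) (omega0 : forall y, 0 <= omega y).
Hypothesis D0 : 0 < D.
Hypothesis trace : forall u, W u ->
  (\int[mu]_(y in ~` Omega) (`|u y| `^ p * omega y)%:E <= (D * wnorm u `^ p)%:E)%E.

Lemma weighted_norm_fin g : in_weighted p nu Omega omega g ->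
  weighted_norm p Omega omega g \is a fin_num.
Proof.
move=> [_ gy _ _]; rewrite /weighted_norm -(@fineK _ (weighted_int p Omega omega g)) ?poweR_EFin//.
by rewrite ge0_fin_numE//; apply: integral_ge0 => x _; rewrite lee_fin mulr_ge0 ?powR_ge0.
Qed.

(** Hoelder's inequality for the densities [g omega^(-1/p)] and
    [v omega^(1/p)]; where [omega] vanishes so does [g]. *)
Lemma exterior_bound g v : in_weighted p nu Omega omega g -> W v ->
  (\int[mu]_(y in ~` Omega) `|g y * v y|%:E <=
   weighted_norm p Omega omega g * (D `^ p^-1 * wnorm v)%:E)%E.
Proof.
move=> [mg gy _ g0] Wv; have mv := W_meas Wv.
pose f y := g y * omega y `^ (- p^-1); pose h y := v y * omega y `^ p^-1.
have mpow (r : R) : measurable_fun setT (fun y => omega y `^ r).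
  exact: (measurableT_comp (measurable_powR r) momega).
have mf : measurable_fun (~` Omega) f.
  by apply: measurable_funM => //; exact: measurable_funTS.
have mh : measurable_fun (~` Omega) h.
  by apply: measurable_funM; exact: measurable_funTS.
have -> : (\int[mu]_(y in ~` Omega) `|g y * v y|%:E = \int[mu]_(y in ~` Omega) `|f y * h y|%:E)%E.
  apply: ge0_ae_eq_integral => //.
  - apply/measurable_EFinP; apply: measurableT_comp => //.
    by apply: measurable_funM => //; exact: measurable_funTS.
  - apply/measurable_EFinP; apply: measurableT_comp => //.
    exact: measurable_funM.
  - apply: filterS g0 => y gy0 Oy; rewrite /f /h.
    have [w0|w0] := eqVneq (omega y) 0; first by rewrite (gy0 Oy w0) !mul0r.
    have wy : 0 < omega y by rewrite lt_neqAle eq_sym w0 omega0.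
    by rewrite mulrACA -powRDp// addNr powRr0 mulr1.
apply: le_trans (hoelder_in mu mOc mf mh q_gt0 p0 qp) _.
have -> : (\int[mu]_(x in ~` Omega) (`|f x| `^ q)%:E = weighted_int p Omega omega g)%E.
  apply: eq_integral => y _; rewrite /f normrM powRM// (ger0_norm (powR_ge0 _ _)).
  rewrite -powRrM; congr (_ * _ `^ _)%:E.
  by rewrite /conj_exp; field; rewrite !gt_eqF.
have -> : (\int[mu]_(x in ~` Omega) (`|h x| `^ p)%:E =
    \int[mu]_(x in ~` Omega) (`|v x| `^ p * omega x)%:E)%E.
  apply: eq_integral => y _; rewrite /h normrM powRM// (ger0_norm (powR_ge0 _ _)).
  by rewrite -powRrM mulVf ?gt_eqF// powRr1.
rewrite -/(weighted_norm p Omega omega g); apply: lee_wpmul2l; first exact: poweR_ge0.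
have t := trace Wv.
have i0 : (0 <= \int[mu]_(y in ~` Omega) (`|v y| `^ p * omega y)%:E)%E.
  by apply: integral_ge0 => y _; rewrite lee_fin mulr_ge0 ?powR_ge0.
have w0 := wnorm_ge0 Omega p nu v.
have -> : (D `^ p^-1 * wnorm v)%:E = ((D * wnorm v `^ p)%:E `^ p^-1)%E.
  rewrite poweR_EFin powRM ?powR_ge0 ?(ltW D0)// -[in RHS]powRrM mulfV ?gt_eqF//.
  by rewrite powRr1.
apply: gt0_ler_poweR => //.
- by rewrite invr_ge0 ltW.
- by rewrite in_itv/= i0 leey.
- by rewrite in_itv/= leey andbT lee_fin mulr_ge0 ?powR_ge0// ltW.
Qed.

Lemma exterior_integrable g v : in_weighted p nu Omega omega g -> W v ->
  mu.-integrable (~` Omega) (EFin \o (fun x => g x * v x)) /\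
  (`|exterior_functional Omega g v|%:E <=
    weighted_norm p Omega omega g * (D `^ p^-1 * wnorm v)%:E)%E.
Proof.
move=> Lg Wv; have [mg _ _ _] := Lg; apply: integral_bound => //.
- by apply: measurable_funM => //; exact: measurable_funTS (W_meas Wv).
- exact: exterior_bound.
- by rewrite ltey_eq fin_numM// weighted_norm_fin.
Qed.

Lemma exterior_restrict g v :
  exterior_functional Omega g (v \_ (~` Omega)) = exterior_functional Omega g v.
Proof. by apply: eq_Rintegral => y yO; rewrite patchE yO. Qed.

(** [g] vanishes off the hull, so the pairing only sees the classes of traces. *)
Lemma exterior_T_eq g u v : in_weighted p nu Omega omega g ->
  measurable_fun setT u -> measurable_fun setT v -> T_eq nu Omega u v ->
  exterior_functional Omega g u = exterior_functional Omega g v.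
Proof.
move=> [mg _ gh _] mu_ mv uv; congr fine; apply: ae_eq_integral => //.
- by apply/measurable_EFinP; apply: measurable_funM => //; exact: measurable_funTS.
- by apply/measurable_EFinP; apply: measurable_funM => //; exact: measurable_funTS.
- apply: filterS2 uv gh => y uvy ghy Oy.
  have [hy|hy] := pselect (nu_hull nu Omega y); first by rewrite uvy.
  by rewrite ghy// !mul0r.
Qed.

Let T_meas u : W u -> measurable_fun setT (u \_ (~` Omega)).
Proof.
by move=> Wu; apply: (measurable_restrictT u mOc).1; exact: measurable_funTS (W_meas Wu).
Qed.

(** The trace norm is an infimum over extensions, so the functional is evaluated on
    one that is optimal up to a small error; its value depends only on the trace. *)
Lemma exterior_dual g : in_weighted p nu Omega omega g ->
  in_dual_T p nu Omega (exterior_functional Omega g) /\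
  (dual_T_norm p nu Omega (exterior_functional Omega g) <=
    (D `^ p^-1)%:E * weighted_norm p Omega omega g)%E.
Proof.
move=> Lg; have Ng := weighted_norm_fin Lg.
have N0 : (0 <= weighted_norm p Omega omega g)%E by exact: poweR_ge0.
have bd : (dual_T_norm p nu Omega (exterior_functional Omega g) <=
    (D `^ p^-1)%:E * weighted_norm p Omega omega g)%E.
  apply: ge_ereal_sup => _ [v [[u0 Wu0 <-{v}] v1] <-].
  rewrite -(fineK Ng) -EFinM lee_fin; set N := fine _.
  have NN : 0 <= N by exact: fine_ge0.
  have DN : 0 <= D `^ p^-1 * N by rewrite mulr_ge0// powR_ge0.
  apply/ler_addgt0Pl => e e0.
  have e1 : 0 < e / (D `^ p^-1 * N + 1) by rewrite divr_gt0// ltr_wpDl.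
  have [_ [u [Wu uv] <-] u1] : exists2 x, [set W_norm p nu Omega u | u in
     [set u | W u /\ T_eq nu Omega (u \_ (~` Omega)) (u0 \_ (~` Omega))]] x &
     (x < (1 + e / (D `^ p^-1 * N + 1))%:E)%E.
    apply: ereal_inf_lt; apply: (le_lt_trans v1).
    by rewrite lte_fin ltrDl.
  rewrite -(exterior_T_eq Lg (T_meas Wu) (T_meas Wu0) uv) exterior_restrict.
  have [_ h] := exterior_integrable Lg Wu.
  rewrite -(fineK Ng) -EFinM lee_fin -/N in h.
  have [wE _ _ _ _] := W_norm_real p1 mO mnu nu0 nuN Wu.
  rewrite wE lte_fin in u1.
  apply: (le_trans h); rewrite mulrA [N * _]mulrC.
  apply: (@le_trans _ _ (D `^ p^-1 * N * (1 + e / (D `^ p^-1 * N + 1)))).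
    by rewrite ler_wpM2l// ltW.
  rewrite mulrDr mulr1 addrC lerD2r mulrCA ler_piMr ?(ltW e0)//.
  by rewrite ler_pdivrMr ?ltr_wpDl// mul1r lerDl.
split; last exact: bd.
split.
- move=> a _ _ [u Wu <-] [v Wv <-].
  rewrite -restrict_lin !exterior_restrict /exterior_functional.
  have [iu _] := exterior_integrable Lg Wu; have [iv _] := exterior_integrable Lg Wv.
  rewrite -(RintegralZl a mOc iu) -(RintegralD mOc (integrableZl mOc a iu) iv).
  by apply: eq_Rintegral => x _; ring.
- move=> _ _ [u Wu <-] [v Wv <-] uv.
  exact: exterior_T_eq (T_meas Wu) (T_meas Wv) uv.
- by apply: le_lt_trans bd _; rewrite ltey_eq fin_numM.
Qed.

Lemma density_weak_eq f g w : in_Lp q Omega f -> in_weighted p nu Omega omega g -> W w ->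
  solves_V p nu Omega (interior_functional Omega f) (exterior_functional Omega g) w <->
  forall v, W v -> energy p nu Omega w v =
    (\int[mu]_(x in Omega) (f x * v x)%:E + \int[mu]_(y in ~` Omega) (g y * v y)%:E)%E.
Proof.
move=> Lf Lg Ww.
have E v : W v -> (data_pairing Omega (interior_functional Omega f)
    (exterior_functional Omega g) v)%:E =
    (\int[mu]_(x in Omega) (f x * v x)%:E + \int[mu]_(y in ~` Omega) (g y * v y)%:E)%E.
  move=> Wv; have [i1 _] := interior_integrable Lf Wv; have [i2 _] := exterior_integrable Lg Wv.
  rewrite /data_pairing exterior_restrict EFinD; congr (_ + _)%E.
    by rewrite /interior_functional /Rintegral fineK//; exact: (integrable_fin_num mO i1).
  by rewrite /exterior_functional /Rintegral fineK//; exact: (integrable_fin_num mOc i2).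
split=> [[_ h] v Wv|h]; first by rewrite (h _ Wv) E.
by split; [exact: Ww|move=> v Wv; rewrite (h _ Wv) E].
Qed.

End exterior.

End densities.

(** * The nonlocal Neumann problem *)

Local Open Scope ereal_scope.

Theorem theorem8p12 (R : realType) (d : nat) (Omega : set 'rV[R]_d) (p : R)
    (nu : 'rV[R]_d -> R) :
  (0 < d)%N -> open Omega -> bounded_set Omega -> Omega !=set0 ->
  (1 < p)%R -> levy_kernel p nu ->
  {ae lebesgue_rV R d, forall x, (nu_hull nu Omega `\` Omega) x ->
    (0 < tilde_weight nu Omega x)%R} ->
  poincare p nu Omega ->
  [/\ (* (i) *)
      forall F G, in_dual_W p nu Omega F -> in_dual_T p nu Omega G ->
      exists u, [/\ solves_V_perp p nu Omega F G u,
        forall u', solves_V_perp p nu Omega F G u' -> W_eq nu Omega u' u,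
        (exists w, solves_V p nu Omega F G w) <->
          data_pairing Omega F G (cst 1%R) = 0%R &
        forall w, W_space p nu Omega w ->
          (solves_V p nu Omega F G w <->
           data_pairing Omega F G (cst 1%R) = 0%R /\
           exists c : R, W_eq nu Omega w (fun x => u x + c)%R)],
      (* (ii) and (iii) *)
      exists2 C : R, (0 < C)%R &
        (forall F G w, in_dual_W p nu Omega F -> in_dual_T p nu Omega G ->
          solves_V p nu Omega F G w ->
          W_norm p nu Omega (fun x => w x - mean Omega w)%R <=
          C%:E * (dual_W_norm p nu Omega F + dual_T_norm p nu Omega G)
                 `^ (p - 1)^-1) /\
        (forall F1 F2 G1 G2 w1 w2,
          in_dual_W p nu Omega F1 -> in_dual_W p nu Omega F2 ->
          in_dual_T p nu Omega G1 -> in_dual_T p nu Omega G2 ->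
          solves_V p nu Omega F1 G1 w1 -> solves_V p nu Omega F2 G2 w2 ->
          let u1 x := (w1 x - mean Omega w1)%R in
          let u2 x := (w2 x - mean Omega w2)%R in
          let delta := dual_W_norm p nu Omega (fun v => F1 v - F2 v)%R +
                       dual_T_norm p nu Omega (fun v => G1 v - G2 v)%R in
          let M := (dual_W_norm p nu Omega F1 + dual_T_norm p nu Omega G1 +
                    (dual_W_norm p nu Omega F2 + dual_T_norm p nu Omega G2))
                   `^ ((2 - p) / (p - 1)) in
          ((2 <= p)%R -> W_norm p nu Omega (fun x => u1 x - u2 x)%R <=
                         C%:E * delta `^ (p - 1)^-1) /\
          ((p < 2)%R -> W_norm p nu Omega (fun x => u1 x - u2 x)%R <=
                        C%:E * M * delta)) &
      (* (iv) *)
      (forall f, in_Lp (conj_exp p) Omega f ->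
        [/\ forall v, W_space p nu Omega v ->
              (lebesgue_rV R d).-integrable Omega (fun x => (f x * v x)%:E),
            in_dual_W p nu Omega (interior_functional Omega f) &
            dual_W_norm p nu Omega (interior_functional Omega f) <=
            Lp_norm (conj_exp p) Omega f]) /\
      (forall omega, admissible_weight nu Omega omega ->
        (exists2 C1 : R, (0 < C1)%R &
          forall g, in_weighted p nu Omega omega g ->
          [/\ forall v, W_space p nu Omega v ->
                (lebesgue_rV R d).-integrable (~` Omega)
                  (fun y => (g y * v y)%:E),
              in_dual_T p nu Omega (exterior_functional Omega g) &
              dual_T_norm p nu Omega (exterior_functional Omega g) <=
              C1%:E * weighted_norm p Omega omega g]) /\
        (forall f g w, in_Lp (conj_exp p) Omega f ->
          in_weighted p nu Omega omega g -> W_space p nu Omega w ->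
          (solves_V p nu Omega (interior_functional Omega f)
             (exterior_functional Omega g) w <->
           forall v, W_space p nu Omega v ->
             energy p nu Omega w v =
             \int[lebesgue_rV R d]_(x in Omega) (f x * v x)%:E +
             \int[lebesgue_rV R d]_(y in ~` Omega) (g y * v y)%:E)))].
Proof.
move=> d0 oO bO neO p1 levy tw poin; have [mnu nu0 nuN _] := levy.
have p0 : (0 < p)%R by apply: lt_trans p1.
have mO : measurable Omega by exact: open_measurable_rV.
have normE u : W_space p nu Omega u -> W_norm p nu Omega u = (wnorm Omega p nu u)%:E.
  by move=> Wu; have [] := W_norm_real p1 mO mnu nu0 nuN Wu.
have mean_free w : W_space p nu Omega w -> W_space p nu Omega (fun x => w x - mean Omega w)%R.
  by move=> Ww; have [] := W_perp_mean oO bO neO p1 mnu nu0 nuN Ww.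
split.
- move=> F G dF dG.
  exact: (well_posedness oO bO neO p1 mnu nu0 nuN poin tw dF dG).
- have [B B0 hB] := solution_bounds oO bO neO p1 mnu nu0 nuN poin.
  have bound C F G w : (B <= C)%R -> in_dual_W p nu Omega F -> in_dual_T p nu Omega G ->
      solves_V p nu Omega F G w -> W_norm p nu Omega (fun x => w x - mean Omega w)%R <=
      C%:E * (dual_W_norm p nu Omega F + dual_T_norm p nu Omega G) `^ (p - 1)^-1.
    move=> BC [Fl _ Fy] [Gl _ Gy] Vw; have [Ww _] := Vw.
    have [E K0 _] := data_bound oO bO p1 mnu nu0 nuN Fl Gl Fy Gy.
    have [_ h] := hB _ _ _ Fl Gl Fy Gy Vw.
    rewrite E poweR_EFin (normE _ (mean_free _ Ww)) -EFinM lee_fin.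
    by rewrite (le_trans h)// ler_wpM2r// powR_ge0.
  have diffW w1 w2 : W_space p nu Omega w1 -> W_space p nu Omega w2 ->
      W_space p nu Omega (fun x => (w1 x - mean Omega w1) - (w2 x - mean Omega w2))%R.
    move=> W1 W2; exact: (W_B p1 mO mnu nu0 nuN (mean_free _ W1) (mean_free _ W2)).
  have [p2|p2] := leP 2%R p.
  + have [C C0 hC] := stability_ge2 oO bO neO p1 mnu nu0 nuN poin p2.
    exists (B + C)%R; first exact: addr_gt0.
    split; first by move=> F G w; apply: bound; rewrite lerDl ltW.
    move=> F1 F2 G1 G2 w1 w2 dF1 dF2 dG1 dG2 V1 V2 u1 u2 delta M.
    split=> [_|//].
    have [[F1l _ F1y] [F2l _ F2y] [G1l _ G1y] [G2l _ G2y]] := And4 dF1 dF2 dG1 dG2.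
    have [E K0 _] := data_bound oO bO p1 mnu nu0 nuN (functionalB F1l F2l)
      (functionalB G1l G2l) (dual_normB F1y F2y) (dual_normB G1y G2y).
    have [W1 _] := V1; have [W2 _] := V2.
    have h := hC _ _ _ _ _ _ dF1 dF2 dG1 dG2 V1 V2.
    rewrite /delta E poweR_EFin (normE _ (diffW _ _ W1 W2)) -EFinM lee_fin.
    by rewrite (le_trans h)// ler_wpM2r ?powR_ge0// lerDr ltW.
  + have [C C0 hC] := stability_lt2 oO bO neO p1 mnu nu0 nuN poin p2.
    exists (B + C)%R; first exact: addr_gt0.
    split; first by move=> F G w; apply: bound; rewrite lerDl ltW.
    move=> F1 F2 G1 G2 w1 w2 dF1 dF2 dG1 dG2 V1 V2 u1 u2 delta M.
    split=> [//|_].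
    have [[F1l _ F1y] [F2l _ F2y] [G1l _ G1y] [G2l _ G2y]] := And4 dF1 dF2 dG1 dG2.
    have [E K0 _] := data_bound oO bO p1 mnu nu0 nuN (functionalB F1l F2l)
      (functionalB G1l G2l) (dual_normB F1y F2y) (dual_normB G1y G2y).
    have [E1 _ _] := data_bound oO bO p1 mnu nu0 nuN F1l G1l F1y G1y.
    have [E2 _ _] := data_bound oO bO p1 mnu nu0 nuN F2l G2l F2y G2y.
    have [W1 _] := V1; have [W2 _] := V2.
    have h := hC _ _ _ _ _ _ dF1 dF2 dG1 dG2 V1 V2.
    rewrite /delta /M E E1 E2 -EFinD poweR_EFin (normE _ (diffW _ _ W1 W2)) -!EFinM lee_fin.
    by rewrite (le_trans h)// ler_wpM2r// ler_wpM2r ?powR_ge0// lerDr ltW.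
- split.
  + move=> f Lf; have [df bf] := interior_dual oO p1 mnu nu0 nuN Lf.
    split; [|exact: df|exact: bf].
    by move=> v Wv; have [] := interior_integrable oO p1 mnu nu0 nuN Lf Wv.
  + move=> omega adm.
    have [mw w0 [D D0 tr]] := admissible_traceable d0 oO bO neO p1 levy adm.
    split.
      exists (D `^ p^-1)%R; first exact: powR_gt0.
      move=> g Lg; have [dg bg] := exterior_dual oO p1 mnu nu0 nuN mw w0 D0 tr Lg.
      split; [|exact: dg|exact: bg].
      by move=> v Wv; have [] := exterior_integrable oO p1 mw w0 D0 tr Lg Wv.
    move=> f g w Lf Lg Ww.
    exact: (density_weak_eq oO p1 mnu nu0 nuN mw w0 D0 tr Lf Lg Ww).
Qed.
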